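(* Let $k\ge 1$ be an integer, and consider, for $0<\varepsilon\le 1$, the problem $\dot{\mathbf u}=\frac1\varepsilon A\mathbf u+\mathbf F(\mathbf u,t)$ on $[0,T]$, $\mathbf u(0)=\varepsilon^\nu\mathbf u_{\mathrm{in}}$, with the assumptions on $A$, $\mathbf F$ given in the context. Assume that the solution $\mathbf u(t)$ satisfies the bounded oscillatory energy condition: there is a constant $C_0$ independent of $\varepsilon$ such that $\|\mathbf u(t)\|\le C_0\varepsilon$ for all $t\in[0,T]$. Let $h=T/N$ ($N$ a positive integer), $t_n=nh$, and let $\mathbf U_n$ be the numerical solution computed by the $k$-th order local linear extension exponential integrator (defined in the context). Let $c_0>0$ be a constant independent of $\varepsilon$. Then there is a constant $C$, independent of $h$ and $\varepsilon$, such that for all large time steps satisfying $h>c_0\varepsilon$, $$\|\mathbf U_n-\mathbf u(t_n)\|\le C\varepsilon h^{k},\qquad n=0,\dots,T/h.$$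
   Context: **Problem.** $d\ge1$; $\nu\in\mathbb R$; $\mathbf u_{\mathrm{in}}\in\mathbb C^d$; $T>0$ independent of $\varepsilon$; $A\in\mathbb C^{d\times d}$ is diagonalizable (not necessarily diagonal) with purely imaginary eigenvalues, i.e. of the form $\mathrm i\lambda$ with $\lambda\in\mathbb R\setminus\{0\}$; the nonlinear term $\mathbf F(\mathbf u,t)\in\mathbb C^d$ is independent of $\varepsilon$, and $\mathbf F$ and its partial derivatives in all variables $u_1,\dots,u_d,t$ up to order $k$ are Lipschitz continuous with Lipschitz constants independent of $\varepsilon$. $\|\cdot\|$ is the Euclidean norm. **Augmented system.** Put $\mathbf x=[\mathbf u^\top,t]^\top$ (components $x_1,\dots,x_{d+1}$), $A_1=\operatorname{diag}\{A,0\}\in\mathbb C^{(d+1)\times(d+1)}$, $\mathbf f(\mathbf x)=[\mathbf F(\mathbf u,t)^\top,1]^\top$, so that $\dot{\mathbf x}=\frac1\varepsilon A_1\mathbf x+\mathbf f(\mathbf x)$, $\mathbf x(0)=[\varepsilon^\nu\mathbf u_{\mathrm{in}}^\top,0]^\top$. **Multi-indices.** For $j\ge0$ let $\tilde{\mathcal I}_{d+1}^{[[j]]}$ be the set of nondecreasing tuples $\alpha=(\alpha_1,\dots,\alpha_j)\in\{1,\dots,d+1\}^j$ (only the empty tuple if $j=0$). For a reference point $\hat{\mathbf x}$ and a tuple $\alpha$ of length $j$, $(\mathbf x-\hat{\mathbf x})^\alpha=\prod_{l=1}^j(x_{\alpha_l}-\hat x_{\alpha_l})$ (equal to $1$ if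 $j=0$); $\chi(\alpha;l)$ is $\alpha$ with its $l$-th entry removed; $\gamma(\alpha)=\prod_{q=1}^{d+1}\big(\#\{i:\alpha_i=q\}\big)!$; $\partial^\alpha/\partial\mathbf x^\alpha=\partial^j/\partial x_{\alpha_1}\cdots\partial x_{\alpha_j}$. Let $D^{[k]}=\sum_{j=0}^k|\tilde{\mathcal I}_{d+1}^{[[j]]}|$. The vector $\mathbf x^{[k,\hat{\mathbf x}]}$ of length $D^{[k]}$ lists all polynomials $(\mathbf x-\hat{\mathbf x})^\alpha$, $\alpha\in\bigcup_{j=0}^k\tilde{\mathcal I}_{d+1}^{[[j]]}$, once each; its first component is $1$, components $2,\dots,d+2$ are $\mathbf x-\hat{\mathbf x}$, and the remaining ones are in any fixed order (different orders give equivalent schemes). **Matrices.** $A_1^{[k]}(\hat{\mathbf x}),A_0^{[k]}(\hat{\mathbf x})\in\mathbb C^{D^{[k]}\times D^{[k]}}$ are the matrices such that, for every $\alpha$ of length $j\le k$, the component corresponding to $\alpha$ of $A_1^{[k]}(\hat{\mathbf x})\mathbf x^{[k,\hat{\mathbf x}]}$ is (identically in $\mathbf x$) $$\sum_{l=1}^j\sum_{m=1}^{d+1}(A_1)_{\alpha_l m}(\mathbf x-\hat{\mathbf x})^{\chi(\alpha;l)}\big((x_m-\hat x_m)+\hat x_m\big),$$ and that of $A_0^{[k]}(\hat{\mathbf x})\mathbf x^{[k,\hat{\mathbf x}]}$ is $$\sum_{l=1}^{j}\sum_{m=0}^{k-j+1}\sum_{\beta\in\tilde{\mathcal I}_{d+1}^{[[m]]}}\frac1{\gamma(\beta)}\frac{\partial^{\beta}f_{\alpha_l}(\hat{\mathbf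 x})}{\partial\mathbf x^{\beta}}(\mathbf x-\hat{\mathbf x})^{\chi(\alpha;l)}(\mathbf x-\hat{\mathbf x})^{\beta}.$$ (The rows of the empty tuple are zero.) **Scheme.** $\mathbf X_0=\mathbf x(0)$ and $$\mathbf X_{n+1}=\mathbf X_n+\Pi_2^{d+2}\,\mathrm e^{\left(\frac1\varepsilon A_1^{[k]}(\mathbf X_n)+A_0^{[k]}(\mathbf X_n)\right)h}e_1,$$ where $e_1$ is the first canonical basis vector of $\mathbb C^{D^{[k]}}$ and $\Pi_2^{d+2}$ extracts components $2,\dots,d+2$. $\mathbf U_n$ consists of the first $d$ components of $\mathbf X_n$. *)

(* Defs.v *)
From HB Require Import structures.
From mathcomp Require Import all_boot all_order all_algebra.
From mathcomp Require Import all_classical all_reals all_analysis.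
From mathcomp Require Import complex.

Set Implicit Arguments.
Unset Strict Implicit.
Unset Printing Implicit Defensive.

Import Order.TTheory GRing.Theory Num.Theory numFieldNormedType.Exports.

Local Open Scope classical_set_scope.
Local Open Scope ring_scope.

(* R[i] packed as a numClosedFieldType, so that the topology which
   MathComp-Analysis puts on every numFieldType is inferred. *)
Definition C (R : realType) : numClosedFieldType := R[i]%C.

Definition toC {R : realType} (x : R) : C R := (x%:C)%C.
Definition reC {R : realType} (z : C R) : R := complex.Re z.

(* Euclidean norm, with values in R. *)
Definition enorm {R : realType} {m : nat} (v : 'cV[C R]_m) : R :=
  Num.sqrt (\sum_(i < m) ComplexField.Normc.normc (v i 0) ^+ 2).

(* Entrywise limit of the exponential series. *)
Definition expmx {R : realType} {m : nat} (M : 'M[C R]_m) : 'M[C R]_m :=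
  lim (series (fun j : nat => (j`!%:R)^-1 *: M ^+ j) @ \oo).

(* The scalars in which the variables u_1, ..., u_d range.  With all of C, the
   derivatives in u_1, ..., u_d below are complex derivatives.  A function on
   C^d that is complex differentiable and globally Lipschitz is affine, so
   real variables (the real line inside C) are admitted as well: these carry
   the nonlinear Lipschitz right-hand sides, such as sin u. *)
Definition scalars {R : realType} (K : set (C R)) : Prop :=
  K = [set: C R] \/ K = range (@toC R).

(* Domain of F as a set of augmented states x = (u, t). *)
Definition aug_dom {R : realType} (K : set (C R)) (d : nat) (T : R) :
    set 'cV[C R]_(d + 1) :=
  [set x | (forall i, K (usubmx x i 0)) /\
           exists2 t : R, 0 <= t <= T & dsubmx x 0 0 = toC t].

Section PartialDerivatives.
Context {R : realType} {n : nat}.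
Implicit Types (D : set 'cV[C R]_n) (g : 'cV[C R]_n -> C R).

Definition diff_quot g (q : 'I_n) (x : 'cV[C R]_n) (z : C R) : C R :=
  z^-1 * (g (x + z *: delta_mx q 0) - g x).

(* Nonzero increments that stay in D: these are complex, real or one-sided
   according to the shape of D near x in direction q. *)
Definition increments D (q : 'I_n) (x : 'cV[C R]_n) : set_system (C R) :=
  within [set z | D (x + z *: delta_mx q 0)] (0 : C R)^'.

Definition has_pderiv D q g x : Prop :=
  cvg (diff_quot g q x z @[z --> increments D q x]).

Definition pderiv D (q : 'I_n) g : 'cV[C R]_n -> C R :=
  fun x => lim (diff_quot g q x z @[z --> increments D q x]).

Definition pderivs D (a : seq 'I_n) g : 'cV[C R]_n -> C R :=
  foldr (pderiv D) g a.

Definition lipschitz_in D g : Prop :=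
  exists L : R, forall x y, D x -> D y ->
    ComplexField.Normc.normc (g x - g y) <= L * enorm (x - y).

Definition Ck_lipschitz D (k : nat) g : Prop :=
  forall a : seq 'I_n, (size a <= k)%N ->
    lipschitz_in D (pderivs D a g) /\
    ((size a < k)%N ->
      forall q x, D x -> has_pderiv D q (pderivs D a g) x).

End PartialDerivatives.

Section Problem.
Context {R : realType} {d : nat}.

Definition solves (K : set (C R)) (A : 'M[C R]_d)
    (F : 'cV[C R]_d -> R -> 'cV[C R]_d) (T eps : R) (u0 : 'cV[C R]_d)
    (u : R -> 'cV[C R]_d) : Prop :=
  u 0 = u0 /\
  forall t : R, 0 <= t <= T ->
    (forall i, K (u t i 0)) /\
    toC s^-1 *: (u (t + s) - u t)
      @[s --> within [set s | 0 <= t + s <= T] (0 : R)^'] -->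
    toC eps^-1 *: (A *m u t) + F (u t) t.

Definition aug_A (A : 'M[C R]_d) : 'M[C R]_(d + 1) := block_mx A 0 0 0.

Definition aug_f (F : 'cV[C R]_d -> R -> 'cV[C R]_d)
    (x : 'cV[C R]_(d + 1)) : 'cV[C R]_(d + 1) :=
  col_mx (F (usubmx x) (reC (dsubmx x 0 0))) (const_mx 1).

End Problem.

Section MultiIndices.
Context {n : nat}.
Implicit Types (a b : seq 'I_n) (r : seq (seq 'I_n)).

Definition nondec a : bool := sorted (fun i j : 'I_n => (i <= j)%N) a.

Definition msort a : seq 'I_n := sort (fun i j : 'I_n => (i <= j)%N) a.

Definition chi a (l : nat) : seq 'I_n := take l a ++ drop l.+1 a.

Definition gamma a : nat := \prod_(q < n) (count_mem q a)`!.

(* r is an enumeration of the multi-indices of degrees 2, ..., k; only this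
   part of the ordering of the components is left free. *)
Definition tail_order (k : nat) r : Prop :=
  uniq r /\ forall a, (a \in r) = (1 < size a <= k)%N && nondec a.

Definition mindices r : seq (seq 'I_n) :=
  [::] :: [seq [:: i] | i <- enum 'I_n] ++ r.

Definition mdim r : nat := (1 + (n + size r))%N.

Definition mindex r (i : 'I_(mdim r)) : seq 'I_n := nth [::] (mindices r) i.

End MultiIndices.

Section Scheme.
Context {R : realType} {n : nat}.
Implicit Types (r : seq (seq 'I_n)) (x y : 'cV[C R]_n) (D : set 'cV[C R]_n).

Definition mono y (a : seq 'I_n) : C R := \prod_(i <- a) y i 0.

(* The vector x^[k, xh], with y standing for x - xh. *)
Definition monos r y : 'cV[C R]_(mdim r) := \col_i mono y (mindex i).

(* Entry (i, j) is the coefficient of the j-th monomial in the polynomial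
   prescribed for the i-th component; see lift_A_monos. *)
Definition lift_A (A1 : 'M[C R]_n) r x : 'M[C R]_(mdim r) :=
  \matrix_(i, j)
    \sum_(l < size (mindex i)) \sum_(m < n)
      A1 (tnth (in_tuple (mindex i)) l) m *
      ((msort (m :: chi (mindex i) l) == mindex j)%:R +
       x m 0 * (chi (mindex i) l == mindex j)%:R).

(* Same encoding; see lift_f_monos. *)
Definition lift_f D (f : 'cV[C R]_n -> 'cV[C R]_n) (k : nat) r x :
    'M[C R]_(mdim r) :=
  \matrix_(i, j)
    \sum_(l < size (mindex i)) \sum_(m < (k - size (mindex i)).+2)
    \sum_(b : m.-tuple 'I_n | nondec b)
      (gamma b)%:R^-1 *
      pderivs D b (fun z => f z (tnth (in_tuple (mindex i)) l) 0) x *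
      (msort (chi (mindex i) l ++ b) == mindex j)%:R.

Definition scheme_step D (A1 : 'M[C R]_n) (f : 'cV[C R]_n -> 'cV[C R]_n)
    (k : nat) r (eps h : R) x : 'cV[C R]_n :=
  x + usubmx (dsubmx
        (expmx (toC h *: (toC eps^-1 *: lift_A A1 r x + lift_f D f k r x))
         *m (col_mx 1%:M 0 : 'cV[C R]_(1 + (n + size r))))).

End Scheme.

Definition lle_scheme {R : realType} {d : nat} (K : set (C R))
    (A : 'M[C R]_d) (F : 'cV[C R]_d -> R -> 'cV[C R]_d) (T : R) (k : nat)
    (r : seq (seq 'I_(d + 1))) (eps h : R) (u0 : 'cV[C R]_d) (j : nat) :
    'cV[C R]_(d + 1) :=
  iter j (scheme_step (aug_dom K T) (aug_A A) (aug_f F) k r eps h)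
    (col_mx u0 0).

Section LiftSpecification.
Context {R : realType} {n : nat}.
Variables (k : nat) (r : seq (seq 'I_n)).
Hypotheses (k_gt0 : (0 < k)%N) (r_order : tail_order k r).
Implicit Types (x y : 'cV[C R]_n).

Lemma leo_trans : transitive (fun i j : 'I_n => (i <= j)%N).
Proof. by move=> ? ? ?; apply: leq_trans. Qed.

Lemma leo_total : total (fun i j : 'I_n => (i <= j)%N).
Proof. by move=> ? ?; apply: leq_total. Qed.

Lemma msort_nondec (a : seq 'I_n) : nondec a -> msort a = a.
Proof. by move=> ?; apply: (sorted_sort leo_trans). Qed.

Lemma mem_mindices (a : seq 'I_n) : (a \in mindices r) = (size a <= k)%N && nondec a.
Proof.
have [_ rE] := r_order.
rewrite inE mem_cat rE; case: a => [|i [|j a]] //=.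
- by rewrite k_gt0 map_f ?mem_enum.
- by case: mapP => // -[].
Qed.

Lemma uniq_mindices : uniq (mindices r).
Proof.
have [r_uniq rE] := r_order.
rewrite /= mem_cat rE /= orbF cat_uniq r_uniq.
rewrite map_inj_uniq ?enum_uniq; last by move=> i j [].
rewrite !andbT; apply/andP; split; first by apply/mapP => -[].
by apply/hasPn => a; rewrite rE => /andP[sa _]; apply/mapP => -[i _ ai];
   rewrite ai in sa.
Qed.

Lemma size_mindices : size (mindices r) = mdim r.
Proof. by rewrite /= size_cat size_map size_enum_ord. Qed.

Lemma mono_msort y a : mono y (msort a) = mono y a.
Proof. by apply: perm_big; rewrite perm_sort. Qed.

Lemma mono_cat y a b : mono y (a ++ b) = mono y a * mono y b.
Proof. by rewrite /mono big_cat. Qed.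

Lemma mindex_mem (i : 'I_(mdim r)) : mindex i \in mindices r.
Proof. by apply: mem_nth; rewrite size_mindices. Qed.

Lemma sum_mono y a : (size a <= k)%N -> nondec a ->
  \sum_(j < mdim r) (a == mindex j)%:R * mono y (mindex j) = mono y a.
Proof.
move=> sa na; have ain : a \in mindices r by rewrite mem_mindices sa.
have ilt : (index a (mindices r) < mdim r)%N by rewrite -size_mindices index_mem.
rewrite (bigD1 (Ordinal ilt)) //= /mindex /= nth_index // eqxx mul1r big1 ?addr0 //.
move=> j jN; case: eqP => [aE|]; last by rewrite mul0r.
have jE : index a (mindices r) = j.
  by rewrite aE; apply: index_uniq uniq_mindices; rewrite size_mindices.
by case/eqP: jN; apply: val_inj; symmetry.
Qed.

Lemma size_chi (a : seq 'I_n) (l : 'I_(size a)) : size (chi a l) = (size a).-1.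
Proof.
rewrite size_cat size_drop size_takel; last exact: ltnW.
by case: (size a) l => [[]//|m] l /=; rewrite subSS subnKC // -ltnS.
Qed.

Lemma nondec_chi (a : seq 'I_n) l : nondec a -> nondec (chi a l).
Proof.
apply: (subseq_sorted leo_trans).
rewrite -[X in subseq _ X](cat_take_drop l) cat_subseq //.
by rewrite -addn1 addnC -drop_drop; apply: drop_subseq.
Qed.

Lemma nondec_msort (a : seq 'I_n) : nondec (msort a).
Proof. exact: (sort_sorted leo_total). Qed.

Lemma lift_A_monos (A1 : 'M[C R]_n) xh x (i : 'I_(mdim r)) :
  (lift_A A1 r xh *m monos r (x - xh)) i 0 =
  \sum_(l < size (mindex i)) \sum_(m < n)
    A1 (tnth (in_tuple (mindex i)) l) m *
    mono (x - xh) (chi (mindex i) l) * ((x - xh) m 0 + xh m 0).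
Proof.
have := mindex_mem i; rewrite mem_mindices => /andP[si ni].
rewrite mxE (eq_bigr (fun j => \sum_(l < size (mindex i)) \sum_(m < n)
    A1 (tnth (in_tuple (mindex i)) l) m *
    ((msort (m :: chi (mindex i) l) == mindex j)%:R * mono (x - xh) (mindex j) +
     xh m 0 * ((chi (mindex i) l == mindex j)%:R * mono (x - xh) (mindex j)))));
  last first.
  move=> j _; rewrite !mxE big_distrl /=; apply: eq_bigr => l _.
  rewrite big_distrl /=; apply: eq_bigr => m _.
  by rewrite -(mulrA (A1 _ _)) mulrDl -(mulrA (xh m 0)).
rewrite exchange_big; apply: eq_bigr => l _.
rewrite exchange_big; apply: eq_bigr => m _.
have sc := size_chi l; have l_gt0 : (0 < size (mindex i))%N.
  exact: leq_ltn_trans (leq0n l) (ltn_ord l).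
rewrite -big_distrr /= -mulrA; congr (_ * _).
rewrite big_split /= -big_distrr /= !sum_mono.
- by rewrite mono_msort /mono big_cons mulrDr mulrC [xh m 0 * _]mulrC.
- by rewrite sc (leq_trans (leq_pred _)).
- exact: nondec_chi.
- by rewrite size_sort /= sc prednK.
- exact: nondec_msort.
Qed.

Lemma lift_f_monos D (f : 'cV[C R]_n -> 'cV[C R]_n) xh x (i : 'I_(mdim r)) :
  (lift_f D f k r xh *m monos r (x - xh)) i 0 =
  \sum_(l < size (mindex i)) \sum_(m < (k - size (mindex i)).+2)
  \sum_(b : m.-tuple 'I_n | nondec b)
    (gamma b)%:R^-1 *
    pderivs D b (fun z => f z (tnth (in_tuple (mindex i)) l) 0) xh *
    mono (x - xh) (chi (mindex i) l) * mono (x - xh) b.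
Proof.
have := mindex_mem i; rewrite mem_mindices => /andP[si ni].
rewrite mxE (eq_bigr (fun j => \sum_(l < size (mindex i))
  \sum_(m < (k - size (mindex i)).+2) \sum_(b : m.-tuple 'I_n | nondec b)
    (gamma b)%:R^-1 *
    pderivs D b (fun z => f z (tnth (in_tuple (mindex i)) l) 0) xh *
    ((msort (chi (mindex i) l ++ b) == mindex j)%:R *
     mono (x - xh) (mindex j)))); last first.
  move=> j _; rewrite !mxE big_distrl /=; apply: eq_bigr => l _.
  rewrite big_distrl /=; apply: eq_bigr => m _.
  by rewrite big_distrl /=; apply: eq_bigr => b _; rewrite -!mulrA.
rewrite exchange_big; apply: eq_bigr => l _.
rewrite exchange_big; apply: eq_bigr => m _.
rewrite exchange_big; apply: eq_bigr => b _.
have sc := size_chi l; have l_gt0 : (0 < size (mindex i))%N.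
  exact: leq_ltn_trans (leq0n l) (ltn_ord l).
rewrite -big_distrr /= -!mulrA -mono_cat; congr (_ * (_ * _)).
rewrite sum_mono ?mono_msort ?nondec_msort //.
rewrite size_sort size_cat sc size_tuple.
have := ltn_ord m; rewrite ltnS => mle.
apply: leq_trans (leq_add (leqnn _) mle) _.
by rewrite addnS -addSn prednK // subnKC.
Qed.

End LiftSpecification.

(* Main.v *)
(* On a step starting from X_n, the vector of monomials in x - X_n solves the
   linear lifted system up to a Taylor remainder, so its difference delta with
   the lifted numerical solution does too.  Since X_n = O(eps), the lifted
   matrix is 1/eps times the derivation extending A_1 to tensors, plus O(1); in
   tensor coordinates given by eigenvectors of A the first part is diagonal
   with purely imaginary entries, so a Gronwall estimate for the sum of squares
   bounds delta uniformly in eps.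
   The remainder in the component of a multi-index alpha is O(h^(k+1)).  It
   vanishes if alpha contains only the time index; if alpha contains at least
   two of the indices of u, one factor u - U_n makes it O(eps h^k); if it
   contains exactly one, the eigenvalue of the derivation is not zero, and
   integrating against the oscillation gains a factor eps at the price of one
   derivative of the remainder, which is O(h^k).  Hence the degree one part of
   delta yields e_(n+1) <= (1 + C h) e_n + C eps h^(k+1) in a norm in which A is
   skew, with C depending on a bound for e_n / eps.  For small h this bound is
   propagated along with the estimate; for larger h there are boundedly many
   steps. *)
Require Import Defs.
From mathcomp Require Import all_boot all_order all_algebra.
From mathcomp Require Import all_classical all_reals all_analysis.
From mathcomp Require Import complex.
From mathcomp Require Import ring lra.
Import Order.TTheory GRing.Theory Num.Theory numFieldNormedType.Exports.
Set Implicit Arguments.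
Unset Strict Implicit.
Unset Printing Implicit Defensive.
Local Open Scope classical_set_scope.
Local Open Scope ring_scope.


(** The condition [c0 * eps < h] makes x - X_n small in h alone: its u-components are O(eps), its
    time component is at most h, so its norm is O(h). The bounded energy condition makes x' = A_1 x
    / eps + f(x) bounded, which is needed to differentiate remainders. Multi-indices are separated
    by their number of u-entries because of resonance: with two or more such entries the sum of the
    eigenvalues may vanish, with exactly one it is an eigenvalue of A and cannot. The derivative of
    the remainder exists since a multi-index alpha with |alpha| <= k uses Taylor polynomials of
    degree k - |alpha| + 1 >= 1. Since A is only diagonalizable, the change to eigenvectors mixes
    components. Vectors indexed by sorted tuples are therefore read as symmetric functions on all
    tuples, where the eigenvector matrix can act on each entry separately. The domain of F has a
    closed time interval and real or complex u-variables. Symmetry of partial derivatives, the chain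
    rule and Taylor estimates are obtained directly from difference quotients inside that domain. *)

Local Notation nc := ComplexField.Normc.normc.

Local Arguments ComplexField.Normc.normc : simpl never.
Local Arguments toC : simpl never.

(** * Norm, real and imaginary parts, and conjugation of complex scalars *)

Section ComplexNorm.
Context {R : realType}.
Implicit Types (x y z : C R) (r s : R).

Definition imC z : R := complex.Im z.

Lemma nc_ge0 z : 0 <= nc z. Proof. by case: z => a b; exact: sqrtr_ge0. Qed.
Lemma nc0 : nc (0 : C R) = 0. Proof. exact: ComplexField.Normc.normc0. Qed.
Lemma nc1 : nc (1 : C R) = 1. Proof. exact: ComplexField.Normc.normc1. Qed.
Lemma ncM x y : nc (x * y) = nc x * nc y.
Proof. exact: ComplexField.Normc.normcM. Qed.
Lemma ncV x : nc x^-1 = (nc x)^-1.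
Proof. exact: ComplexField.Normc.normcV. Qed.
Lemma ncN x : nc (- x) = nc x. Proof. exact: normcN. Qed.
Lemma ler_ncD x y : nc (x + y) <= nc x + nc y.
Proof. exact: le_normcD. Qed.
Lemma ler_ncB x y : nc (x - y) <= nc x + nc y.
Proof. by rewrite -(ncN y); exact: ler_ncD. Qed.
Lemma nc_eq0 x : nc x = 0 -> x = 0.
Proof. exact: ComplexField.Normc.eq0_normc. Qed.
Lemma ncBC x y : nc (x - y) = nc (y - x).
Proof. by rewrite -ncN opprB. Qed.
Lemma nc_toC r : nc (toC r) = `|r|.
Proof. by rewrite /toC /ComplexField.Normc.normc /= expr0n /= addr0 sqrtr_sqr. Qed.
Lemma nc_gt0 x : x != 0 -> 0 < nc x.
Proof.
move=> x0; rewrite lt_def nc_ge0 andbT.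
by apply: contra x0 => /eqP /nc_eq0 ->.
Qed.
Lemma ler_nc_sum (I : Type) (r : seq I) (P : pred I) (F : I -> C R) :
  nc (\sum_(i <- r | P i) F i) <= \sum_(i <- r | P i) nc (F i).
Proof.
elim/big_ind2: _ => [|x1 y1 x2 y2 h1 h2|//]; first by rewrite nc0.
exact: le_trans (ler_ncD _ _) (lerD h1 h2).
Qed.

Lemma norm_nc z : `|z| = toC (nc z).
Proof. by case: z. Qed.

Lemma toC_inj : injective (@toC R). Proof. by move=> x y []. Qed.
Lemma toCD r s : toC (r + s) = toC r + toC s.
Proof. exact: (rmorphD (real_complex R)). Qed.
Lemma toCB r s : toC (r - s) = toC r - toC s.
Proof. exact: (rmorphB (real_complex R)). Qed.
Lemma toCN r : toC (- r) = - toC r.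
Proof. exact: (rmorphN (real_complex R)). Qed.
Lemma toCM r s : toC (r * s) = toC r * toC s.
Proof. exact: (rmorphM (real_complex R)). Qed.
Lemma toC0 : toC (0 : R) = 0. Proof. by []. Qed.
Lemma toC1 : toC (1 : R) = 1. Proof. by []. Qed.
Lemma toC_nat n : toC (n%:R : R) = n%:R.
Proof. exact: (rmorph_nat (real_complex R)). Qed.
Lemma toCV r : toC r^-1 = (toC r)^-1.
Proof. exact: (fmorphV (real_complex R)). Qed.
Lemma toCX r n : toC (r ^+ n) = toC r ^+ n.
Proof. exact: (rmorphXn (real_complex R)). Qed.
Lemma toC_eq0 r : (toC r == 0) = (r == 0).
Proof. exact: (fmorph_eq0 (real_complex R)). Qed.
Lemma toC_sum (I : Type) (r : seq I) (P : pred I) (F : I -> R) :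
  toC (\sum_(i <- r | P i) F i) = \sum_(i <- r | P i) toC (F i).
Proof. exact: (rmorph_sum (real_complex R)). Qed.
Lemma le_toC r s : (toC r <= toC s) = (r <= s).
Proof. by rewrite /toC lecR. Qed.
Lemma lt_toC r s : (toC r < toC s) = (r < s).
Proof. by rewrite /toC ltcR. Qed.

Lemma reCD x y : reC (x + y) = reC x + reC y.
Proof. by case: x y => [a b] [c e]. Qed.
Lemma reCB x y : reC (x - y) = reC x - reC y.
Proof. by case: x y => [a b] [c e]. Qed.
Lemma reC_toC r : reC (toC r) = r. Proof. by []. Qed.
Lemma imC_toC r : imC (toC r) = 0. Proof. by []. Qed.
Lemma reCM x y : reC (x * y) = reC x * reC y - imC x * imC y.
Proof. by case: x y => [a b] [c e]. Qed.
Lemma imCM x y : imC (x * y) = reC x * imC y + imC x * reC y.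
Proof. by case: x y => [a b] [c e]. Qed.
Lemma imCD x y : imC (x + y) = imC x + imC y.
Proof. by case: x y => [a b] [c e]. Qed.
Lemma imCB x y : imC (x - y) = imC x - imC y.
Proof. by case: x y => [a b] [c e]. Qed.
Lemma reC_le z : `|reC z| <= nc z.
Proof.
case: z => a b; rewrite /reC /ComplexField.Normc.normc /= -sqrtr_sqr ler_wsqrtr //.
by rewrite lerDl sqr_ge0.
Qed.
Lemma imC_le z : `|imC z| <= nc z.
Proof.
case: z => a b; rewrite /imC /ComplexField.Normc.normc /= -sqrtr_sqr ler_wsqrtr //.
by rewrite lerDr sqr_ge0.
Qed.
Lemma reim z : z = toC (reC z) + 'i * toC (imC z).
Proof. exact: complexE. Qed.

Definition cj z : C R := conjc z.
Lemma cjM x y : cj (x * y) = cj x * cj y. Proof. exact: rmorphM. Qed.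
Lemma cjB x y : cj (x - y) = cj x - cj y. Proof. exact: rmorphB. Qed.
Lemma cj_toC r : cj (toC r) = toC r.
Proof. by rewrite /cj /toC /= oppr0. Qed.
Lemma nc_cj z : nc (cj z) = nc z.
Proof. by case: z => a b; rewrite /ComplexField.Normc.normc /= sqrrN. Qed.
Lemma mul_cj z : z * cj z = toC (nc z ^+ 2).
Proof.
case: z => a b; rewrite /ComplexField.Normc.normc sqr_sqrtr ?addr_ge0 ?sqr_ge0 //.
apply/eqP; rewrite eq_complex /=; apply/andP; split; apply/eqP.
- by rewrite mulrN opprK !expr2.
- by rewrite mulrN mulrC addNr.
Qed.
End ComplexNorm.

(** * Derivatives along a real interval and mean value inequalities *)

Section Derivative.
Context {R : realType}.
Implicit Types (f g : R -> C R) (a b t : R).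

(* Derivative along the reals, one-sided at the ends of [a, b]. *)
Definition has_d a b f t (l : C R) : Prop :=
  forall e : R, 0 < e -> exists2 dl : R, 0 < dl &
    forall s, a <= s <= b -> `|s - t| < dl ->
      nc (f s - f t - toC (s - t) * l) <= e * `|s - t|.

Lemma has_d_cst a b t (c : C R) : has_d a b (fun=> c) t 0.
Proof.
by move=> e e0; exists 1 => // s _ _; rewrite subrr mulr0 subr0 nc0 mulr_ge0 // ltW.
Qed.

Lemma has_d_id a b t : has_d a b (@toC R) t 1.
Proof.
move=> e e0; exists 1 => // s _ _.
by rewrite -toCB mulr1 subrr nc0 mulr_ge0 // ltW.
Qed.

Lemma has_d_sub a b a' b' f t l : a <= a' -> b' <= b ->
  has_d a b f t l -> has_d a' b' f t l.
Proof.
move=> aa bb fd e e0; have [dl dl0 h] := fd e e0.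
by exists dl => // s /andP[s1 s2] sdl; apply: h => //; rewrite (le_trans aa s1) (le_trans s2 bb).
Qed.

Lemma has_d_shift a b f c t l :
  has_d (c + a) (c + b) f (c + t) l -> has_d a b (fun s => f (c + s)) t l.
Proof.
move=> fd e e0; have [dl dl0 h] := fd e e0.
exists dl => // s sab sdl; have := h (c + s).
have -> : c + s - (c + t) = s - t by ring.
by rewrite !lerD2l; apply.
Qed.

Lemma has_dD a b f g t l m : has_d a b f t l -> has_d a b g t m ->
  has_d a b (fun s => f s + g s) t (l + m).
Proof.
move=> fd gd e e0; have e20 : 0 < e / 2 by rewrite divr_gt0.
have [d1 d10 h1] := fd _ e20; have [d2 d20 h2] := gd _ e20.
exists (Num.min d1 d2) => [|s sab]; first by rewrite lt_min d10.
rewrite lt_min => /andP[s1 s2].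
have -> : f s + g s - (f t + g t) - toC (s - t) * (l + m) =
  (f s - f t - toC (s - t) * l) + (g s - g t - toC (s - t) * m) by ring.
rewrite (le_trans (ler_ncD _ _)) // (le_trans (lerD (h1 _ sab s1) (h2 _ sab s2))) //.
by rewrite -mulrDl -splitr.
Qed.

Lemma has_d_cont a b f t l : has_d a b f t l -> exists2 dl : R, 0 < dl &
  forall s, a <= s <= b -> `|s - t| < dl -> nc (f s - f t) <= (nc l + 1) * `|s - t|.
Proof.
move=> fd; have [dl dl0 h] := fd _ ltr01; exists dl => // s sab sdl.
have -> : f s - f t = (f s - f t - toC (s - t) * l) + toC (s - t) * l by ring.
rewrite (le_trans (ler_ncD _ _)) // mulrDl addrC lerD ?h //.
by rewrite ncM nc_toC mulrC.
Qed.

Lemma has_dM a b f g t l m : has_d a b f t l -> has_d a b g t m ->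
  has_d a b (fun s => f s * g s) t (l * g t + f t * m).
Proof.
move=> fd gd e e0.
have [c1 c10 k1] := has_d_cont fd; have [c2 c20 k2] := has_d_cont gd.
pose B := (nc l + 1) * (nc m + 1).
have B0 : 0 < B by rewrite mulr_gt0 // ltr_wpDl // nc_ge0.
pose G := nc (g t) + 1; have G0 : 0 < G by rewrite ltr_wpDl // nc_ge0.
pose H := nc (f t) + 1; have H0 : 0 < H by rewrite ltr_wpDl // nc_ge0.
have e1 : 0 < e / 3 / G by rewrite !divr_gt0.
have e2 : 0 < e / 3 / H by rewrite !divr_gt0.
have e3 : 0 < e / 3 / B by rewrite !divr_gt0.
have [d1 d10 h1] := fd _ e1; have [d2 d20 h2] := gd _ e2.
exists (Num.min (Num.min c1 c2) (Num.min (Num.min d1 d2) (e / 3 / B))).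
  by rewrite !lt_min c10 c20 d10 d20.
move=> s sab; rewrite !lt_min => /andP[/andP[sc1 sc2] /andP[/andP[sd1 sd2] sB]].
have -> : f s * g s - f t * g t - toC (s - t) * (l * g t + f t * m) =
  (f s - f t - toC (s - t) * l) * g t + f t * (g s - g t - toC (s - t) * m)
  + (f s - f t) * (g s - g t) by ring.
rewrite (le_trans (ler_ncD _ _)) //.
have -> : e * `|s - t| = e / 3 * `|s - t| + e / 3 * `|s - t| + e / 3 * `|s - t|.
  by field.
apply: lerD; first rewrite (le_trans (ler_ncD _ _)) // lerD //.
- rewrite ncM; apply: le_trans (_ : e / 3 / G * `|s - t| * G <= _).
    by rewrite ler_pM ?nc_ge0 ?h1 // /G lerDl.
  by rewrite mulrAC divfK // gt_eqF.
- rewrite ncM mulrC; apply: le_trans (_ : e / 3 / H * `|s - t| * H <= _).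
    by rewrite ler_pM ?nc_ge0 ?h2 // /H lerDl.
  by rewrite mulrAC divfK // gt_eqF.
- rewrite ncM; apply: le_trans (ler_pM (nc_ge0 _) (nc_ge0 _) (k1 _ sab sc1) (k2 _ sab sc2)) _.
  rewrite mulrACA -/B mulrA ler_wpM2r //.
  by rewrite mulrC -ler_pdivlMr // ltW.
Qed.

Lemma has_dZ a b f t l (c : C R) : has_d a b f t l ->
  has_d a b (fun s => c * f s) t (c * l).
Proof.
move=> fd; have := has_dM (has_d_cst a b t c) fd.
by rewrite mul0r add0r.
Qed.

Lemma has_dZr a b f t l (c : C R) : has_d a b f t l ->
  has_d a b (fun s => f s * c) t (l * c).
Proof.
move=> fd; have := has_dM fd (has_d_cst a b t c).
by rewrite mulr0 addr0.
Qed.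

Lemma has_d_lin a b t (c : C R) : has_d a b (fun s => c * toC s) t c.
Proof. by rewrite -[X in has_d _ _ _ _ X]mulr1; apply: has_dZ; exact: has_d_id. Qed.

Lemma has_dB a b f g t l m : has_d a b f t l -> has_d a b g t m ->
  has_d a b (fun s => f s - g s) t (l - m).
Proof.
move=> fd gd; have := has_dD fd (has_dZ (-1) gd); rewrite mulN1r.
by under eq_fun do rewrite mulN1r.
Qed.

Lemma has_d_sum a b t (I : Type) (r : seq I) (P : pred I) (F : I -> R -> C R) (l : I -> C R) :
  (forall i, P i -> has_d a b (F i) t (l i)) ->
  has_d a b (fun s => \sum_(i <- r | P i) F i s) t (\sum_(i <- r | P i) l i).
Proof.
move=> h; elim: r => [|i r IH].
  rewrite big_nil; under eq_fun do rewrite big_nil; exact: has_d_cst.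
rewrite big_cons; under eq_fun do rewrite big_cons.
by case: ifP => // Pi; apply: has_dD => //; apply: h.
Qed.

Lemma has_d_cj a b f t l : has_d a b f t l -> has_d a b (fun s => cj (f s)) t (cj l).
Proof.
move=> fd e e0; have [dl dl0 h] := fd e e0; exists dl => // s sab sdl.
by rewrite -(cj_toC (s - t)) -cjM -!cjB nc_cj h.
Qed.

Lemma has_d_is_derive a b (f : R -> R) t l : is_derive t 1 f l ->
  has_d a b (fun s => toC (f s)) t (toC l).
Proof.
move=> [fd fl] e e0.
have /cvgrPdist_le /(_ e e0) : (fun h => h^-1 *: ((f \o shift t) (h *: (1:R)) - f t)) @ 0^' --> l.
  by rewrite -fl; exact: fd.
rewrite near_withinE => /nbhs_ballP[dl /= dl0 h]; exists dl => // s _ sdl.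
have [->|st] := eqVneq s t; first by rewrite !subrr toC0 mul0r subr0 nc0 normr0 mulr0.
rewrite -!toCB -toCM -toCB nc_toC.
have := h (s - t); rewrite /ball /= sub0r normrN => /(_ sdl).
rewrite subr_eq0 => /(_ st).
have -> : (s - t) *: (1 : R) + t = s by rewrite /GRing.scale /= mulr1 subrK.
rewrite /GRing.scale /= => le.
have n0 : s - t != 0 by rewrite subr_eq0.
have -> : f s - f t - (s - t) * l = - ((l - (s - t)^-1 * (f s - f t)) * (s - t)) by field.
by rewrite normrN normrM ler_wpM2r.
Qed.

(** At an interior point the increments that stay in [[a, b]] fill a neighbourhood of zero, so the
    restricted derivative is an ordinary one. *)
Lemma has_d_reC_derive a b f t l : a < t < b -> has_d a b f t l ->
  is_derive t 1 (fun s => reC (f s)) (reC l).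
Proof.
move=> /andP[ta tb] fd.
have fc : (fun h : R => h^-1 *: ((fun s => reC (f s)) (h *: (1:R) + t) - reC (f t))) @ 0^' --> reC l.
  apply/cvgrPdist_le => e e0; have [dl dl0 h] := fd e e0.
  rewrite near_withinE; apply/nbhs_ballP.
  exists (Num.min dl (Num.min (t - a) (b - t))) => /=; first by rewrite !lt_min dl0 !subr_gt0 ta.
  move=> s; rewrite /ball /= sub0r normrN !lt_min => /and3P[s1 s2 s3] s0.
  have := h (s + t); rewrite addrK => /(_ _ s1).
  have -> : a <= s + t <= b.
    by move: s2 s3; rewrite !ltr_norml => /andP[+ _] /andP[_]; lra.
  have -> : s *: (1 : R) + t = s + t by rewrite /GRing.scale /= mulr1.
  move=> /(_ isT) le.
  have -> : reC l - s^-1 *: (reC (f (s + t)) - reC (f t)) =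
     - (s^-1 * (reC (f (s + t) - f t - toC s * l))).
    rewrite !reCB.
    have -> : reC (toC s * l) = s * reC l by rewrite reCM imC_toC mul0r subr0.
    by rewrite /GRing.scale /=; field.
  rewrite normrN normrM normfV ler_pdivrMl ?normr_gt0 // [leRHS]mulrC.
  exact: le_trans (reC_le _) le.
by apply: DeriveDef; [apply: cvgP fc | apply: cvg_lim fc].
Qed.

(** The one-sided derivatives at [a] and [b] give continuity there, so the mean value theorem
    applies on the closed interval. The derivative is bounded from above only and not in modulus,
    which is the form that the Gronwall argument uses. *)
Lemma real_mvt a b f (l : R -> C R) B : a <= b ->
  (forall t, a <= t <= b -> has_d a b f t (l t)) ->
  (forall t, a <= t <= b -> reC (l t) <= B) ->
  reC (f b) - reC (f a) <= B * (b - a).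
Proof.
rewrite le_eqVlt => /orP[/eqP <-|ab] fd lB; first by rewrite !subrr mulr0.
have [||c /[!in_itv]/= /andP[ac cb] ->] :=
  @MVT _ (fun s => reC (f s)) (fun s => reC (l s)) a b ab.
- move=> x /[!in_itv]/= xab; apply: has_d_reC_derive (xab) (fd _ _).
  by case/andP: xab => x1 x2; rewrite !ltW.
- apply/continuous_within_itvP => //.
  have ctn t : a <= t <= b -> forall e, 0 < e -> exists2 dl, 0 < dl & forall s, a <= s <= b ->
      `|s - t| < dl -> `|reC (f t) - reC (f s)| <= e.
    move=> tab e e0; have [dl dl0 h] := has_d_cont (fd t tab).
    have N0 : 0 < nc (l t) + 1 by rewrite ltr_wpDl // nc_ge0.
    exists (Num.min dl (e / (nc (l t) + 1))); first by rewrite lt_min dl0 divr_gt0.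
    move=> s sab; rewrite lt_min => /andP[s1 s2]; rewrite distrC -reCB.
    rewrite (le_trans (reC_le _)) // (le_trans (h _ sab s1)) //.
    by rewrite mulrC -ler_pdivlMr // ltW.
  split.
  + move=> x /[!in_itv]/= xab; have xab' : a <= x <= b by case/andP: xab => x1 x2; rewrite !ltW.
    have [gd _] := has_d_reC_derive xab (fd _ xab').
    by apply/differentiable_continuous/derivable1_diffP.
  + apply/cvgrPdist_le => e e0.
    have aab : a <= a <= b by rewrite lexx ltW.
    have [dl dl0 h] := ctn a aab e e0.
    rewrite near_withinE; apply/nbhs_ballP; exists (Num.min dl (b - a)) => /=.
      by rewrite lt_min dl0 subr_gt0.
    move=> s; rewrite /ball /= distrC lt_min => /andP[s1 s2] sa; apply: h => //.
    by rewrite (ltW sa) /=; move: s2; rewrite ltr_norml => /andP[_]; lra.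
  + apply/cvgrPdist_le => e e0.
    have bab : a <= b <= b by rewrite lexx ltW.
    have [dl dl0 h] := ctn b bab e e0.
    rewrite near_withinE; apply/nbhs_ballP; exists (Num.min dl (b - a)) => /=.
      by rewrite lt_min dl0 subr_gt0.
    move=> s; rewrite /ball /= distrC lt_min => /andP[s1 s2] sa; apply: h => //.
    by rewrite (ltW sa) andbT; move: s2; rewrite ltr_norml => /andP[+ _]; lra.
- by rewrite ler_wpM2r ?subr_ge0 ?(ltW ab) // lB // (ltW ac) (ltW cb).
Qed.

(* The real case is applied to the real part of f times a constant phase. *)
Lemma complex_mvi a b f (l : R -> C R) B : a <= b ->
  (forall t, a <= t <= b -> has_d a b f t (l t)) ->
  (forall t, a <= t <= b -> nc (l t) <= B) ->
  nc (f b - f a) <= B * (b - a).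
Proof.
move=> ab fd lB; set w := f b - f a.
have [->|w0] := eqVneq w 0.
  rewrite nc0 mulr_ge0 ?subr_ge0 //; apply: le_trans (nc_ge0 _) (lB a _).
  by rewrite lexx.
have := @real_mvt a b (fun t => cj w * f t) (fun t => cj w * l t) (nc w * B) ab.
move=> /(_ (fun t tab => has_dZ (cj w) (fd t tab))).
have H : forall t, a <= t <= b -> reC (cj w * l t) <= nc w * B.
  move=> t tab; apply: le_trans (ler_norm _) _; apply: le_trans (reC_le _) _.
  by rewrite ncM nc_cj ler_wpM2l ?nc_ge0 ?lB.
move=> /(_ H); rewrite -reCB -mulrBr -/w mulrC mul_cj reC_toC expr2 -mulrA.
by rewrite ler_pM2l // nc_gt0.
Qed.

Lemma has_d0_eq a b f : a <= b -> (forall t, a <= t <= b -> has_d a b f t 0) -> f b = f a.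
Proof.
move=> ab fd; have := @complex_mvi a b f (fun=> 0) 0 ab fd.
rewrite mul0r => H; apply/eqP; rewrite -subr_eq0; apply/eqP/nc_eq0/eqP.
by rewrite eq_le nc_ge0 andbT; apply: H => t _; rewrite nc0.
Qed.
End Derivative.

(** * Limits of complex scalars and matrices in terms of real bounds *)

Section ComplexTopology.
Context {R : realType}.

Lemma cvg_ncP (T : Type) (F : set_system T) (FF : Filter F) (f : T -> C R) (l : C R) :
  f @ F --> l <-> forall e : R, 0 < e -> \forall x \near F, nc (f x - l) <= e.
Proof.
split=> [/cvgrPdist_le h e e0|h].
  have e0' : (0 : C R) < toC e by rewrite -toC0 lt_toC.
  apply: filterS (h _ e0') => x /=; rewrite norm_nc le_toC.
  by rewrite ncBC.
apply/cvgrPdist_le => e e0.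
have eE : e = toC (reC e) by apply/esym; apply: RRe_real; apply: gtr0_real.
have e0' : 0 < reC e by rewrite -lt_toC -eE.
apply: filterS (h _ e0') => x /=; rewrite norm_nc eE le_toC.
by rewrite ncBC.
Qed.

Lemma mx_cvgP (T : Type) (F : set_system T) (FF : Filter F) m n (f : T -> 'M[C R]_(m, n)) (M : 'M[C R]_(m, n)) :
  f @ F --> M <-> forall i j, (fun x => f x i j) @ F --> M i j.
Proof.
split=> [h i j B MB|h A [P MP sPA]].
  apply: (h [set N : 'M[C R]_(m, n) | B (N i j)]).
  (* This basic neighbourhood constrains the entry [(i, j)] alone. *)
  exists (fun i' j' => [set z | (i' == i) && (j' == j) -> B z]).
    move=> i' j'; have [/andP[/eqP -> /eqP ->]|ne] := boolP ((i' == i) && (j' == j)).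
      by apply: filterS MB => z Bz _.
    by apply: filterS (filterT) => z _ /=.
  by move=> N /(_ i j) /=; rewrite !eqxx; apply.
rewrite nbhs_filterE /=.
have : \forall x \near F, forall i, [set y | forall j, P i j (f y i j)] x.
  apply: filter_forall => i; apply: filter_forall => j.
  by apply: h; apply: MP.
by apply: filterS => x Px; apply: sPA => i j; apply: Px.
Qed.

Lemma cvg_fsum (I : Type) (r : seq I) (f : I -> nat -> R) (l : I -> R) :
  (forall i, f i @ \oo --> l i) ->
  (fun n => \sum_(i <- r) f i n) @ \oo --> \sum_(i <- r) l i.
Proof.
move=> h; elim: r => [|i r IH].
  by rewrite big_nil; under eq_fun do rewrite big_nil; exact: cvg_cst.
by rewrite big_cons; under eq_fun do rewrite big_cons; exact: cvgD.
Qed.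

Lemma mx_hausdorff m n : hausdorff_space 'M[C R]_(m, n).
Proof. exact: norm_hausdorff. Qed.

Lemma C_hausdorff : hausdorff_space (C R).
Proof. exact: norm_hausdorff. Qed.
End ComplexTopology.

(** * Power series with factorial denominators *)

Section FactorialSeries.
Context {R : realType}.
Implicit Types (al : nat -> R) (x : R).

(** Dominated termwise by [B] times the exponential series at mu |x|. *)
Lemma cvg_fact_pseries al B mu x : 0 <= mu ->
  (forall n, `|al n| <= B * mu ^+ n) -> cvgn (pseries (fun n => al n / n`!%:R) x).
Proof.
move=> mu0 h; have B0 : 0 <= B.
  by have := h 0%N; rewrite expr0 mulr1; apply: le_trans.
apply: normed_cvg; apply: (@series_le_cvg _ _ (fun n => B * exp_coeff (mu * `|x|) n)).
- by move=> n /=.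
- by move=> n; rewrite mulr_ge0 // exp_coeff_ge0 // mulr_ge0.
- move=> n /=; rewrite /exp_coeff /= !normrM normfV normrX [`|n`!%:R|]ger0_norm //.
  rewrite mulrAC exprMn mulrA mulrA ler_wpM2r ?invr_ge0 //.
  by rewrite ler_wpM2r // exprn_ge0.
- have := @is_cvg_seriesZ _ (exp_coeff (mu * `|x|)) B.
  by apply; exact: is_cvg_series_exp_coeff.
Qed.

(** With factorials in the denominators, differentiation is a shift of [al]. The shifted sequences
    satisfy the same geometric bound, with [B] multiplied by powers of [mu], so the series and its
    first two formal derivatives converge at |x| + 1. *)
Lemma is_derive_fact_pseries al B mu x : 0 <= mu ->
  (forall n, `|al n| <= B * mu ^+ n) ->
  is_derive x 1 (fun x => limn (pseries (fun n => al n / n`!%:R) x))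
    (limn (pseries (fun n => al n.+1 / n`!%:R) x)).
Proof.
move=> mu0 h.
have dE (b : nat -> R) : pseries_diffs (fun n => b n / n`!%:R) = (fun n => b n.+1 / n`!%:R).
  apply/funext => n; rewrite /pseries_diffs factS natrM invfM.
  by rewrite mulrCA mulVKf.
have h1 n : `|al n.+1| <= B * mu * mu ^+ n by rewrite -mulrA -exprS.
have h2 n : `|al n.+2| <= B * mu * mu * mu ^+ n by rewrite -mulrA -exprS.
rewrite -dE; apply: (@pseries_snd_diffs _ _ (`|x| + 1)); rewrite ?dE.
- exact: cvg_fact_pseries h.
- exact: cvg_fact_pseries h1.
- exact: cvg_fact_pseries h2.
- by rewrite [ltRHS]ger0_norm ?addr_ge0 // ltrDl.
Qed.
End FactorialSeries.

(** * The matrix exponential and its derivative *)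

Section MatrixExponential.
Context {R : realType} {m : nat} (M : 'M[C R]_m).

Let mu : R := \sum_i \sum_j nc (M i j).

(** The sum [mu] of all entries in modulus dominates every row sum, so the bound passes from one
    power to the next. The factor 1 stands for the constant [B] of the series lemmas. *)
Lemma mx_pow_bound n i j : nc ((M ^+ n) i j) <= 1 * mu ^+ n.
Proof.
have mu0 : 0 <= mu by apply: sumr_ge0 => ? _; apply: sumr_ge0 => ? _; exact: nc_ge0.
rewrite mul1r; elim: n i j => [|n IH] i j.
  by rewrite !expr0 mxE; case: (i == j); rewrite ?nc1 ?nc0.
rewrite !exprS mxE (le_trans (ler_nc_sum _ _ _)) //.
apply: le_trans (_ : \sum_l nc (M i l) * mu ^+ n <= _).
  by apply: ler_sum => l _; rewrite ncM ler_wpM2l ?nc_ge0.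
rewrite -mulr_suml ler_wpM2r ?exprn_ge0 //.
rewrite /mu [leRHS](bigD1 i) //= lerDl; apply: sumr_ge0 => ? _.
by apply: sumr_ge0 => ? _; exact: nc_ge0.
Qed.

(** Real and imaginary parts are summed separately, because the power series lemmas are about real
    coefficients. *)
Let ere i j n := reC ((M ^+ n) i j) : R.
Let eim i j n := imC ((M ^+ n) i j) : R.
Let S (al : nat -> R) (s : R) : R := limn (pseries (fun n => al n / n`!%:R) s).

Let bre i j n : `|ere i j n| <= 1 * mu ^+ n.
Proof. exact: le_trans (reC_le _) (mx_pow_bound _ _ _). Qed.
Let bim i j n : `|eim i j n| <= 1 * mu ^+ n.
Proof. exact: le_trans (imC_le _) (mx_pow_bound _ _ _). Qed.
Let mu0 : 0 <= mu.
Proof. by apply: sumr_ge0 => ? _; apply: sumr_ge0 => ? _; exact: nc_ge0. Qed.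

Lemma mx_expZ (c : C R) n : (c *: M) ^+ n = c ^+ n *: M ^+ n.
Proof.
elim: n => [|n IH]; first by rewrite !expr0 scale1r.
rewrite !exprS IH; change (c *: M *m (c ^+ n *: M ^+ n) = (c * c ^+ n) *: (M *m M ^+ n)).
by rewrite -scalemxAl -scalemxAr scalerA.
Qed.

Lemma expmxE (s : R) :
  expmx (toC s *: M) = \matrix_(i, j) (toC (S (ere i j) s) + 'i * toC (S (eim i j) s)).
Proof.
apply: cvg_lim; first exact: mx_hausdorff.
apply/mx_cvgP => i j; rewrite mxE; apply/cvg_ncP => e e0.
have e20 : 0 < e / 2 by rewrite divr_gt0.
have /cvgrPdist_le /(_ _ e20) := cvg_fact_pseries (x := s) mu0 (@bre i j).
have /cvgrPdist_le /(_ _ e20) := cvg_fact_pseries (x := s) mu0 (@bim i j).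
apply: filterS2 => n him hre.
have -> : series (fun j0 : nat => (j0`!%:R)^-1 *: (toC s *: M) ^+ j0) n i j =
   toC (pseries (fun n => ere i j n / n`!%:R) s n) + 'i * toC (pseries (fun n => eim i j n / n`!%:R) s n).
  rewrite /pseries /series /= summxE !toC_sum mulr_sumr -big_split /=.
  apply: eq_bigr => l _; rewrite mxE mx_expZ mxE.
  rewrite [X in _ * (_ * X)]reim !toCM toCV toC_nat -toCX.
  by rewrite toCX /ere /eim; ring.
rewrite opprD addrACA -mulrBr -!toCB (le_trans (ler_ncD _ _)) //.
rewrite ncM !nc_toC.
have -> : nc ('i : C R) = 1.
  by apply: toC_inj; rewrite -norm_nc normCi.
by rewrite mul1r (splitr e) lerD // distrC.
Qed.

Lemma expmx0 : expmx (toC 0 *: M) = 1%:M.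
Proof.
rewrite toC0 scale0r; apply: cvg_lim; first exact: mx_hausdorff.
apply: cvg_near_cst; near=> n.
have n0 : (0 < n)%N by near: n; exact: nbhs_infty_gt.
rewrite /series /= big_ltn // expr0 fact0 invr1 scale1r big_nat big1 ?addr0 //.
by move=> i /andP[i0 _]; rewrite expr0n gtn_eqF // scaler0.
Unshelve. all: by end_near. Qed.

(** When [K] is the real line, this is what keeps the numerical solution in the domain of F. *)
Lemma expmx_real s i j : (forall i j, imC (M i j) = 0) -> imC (expmx (toC s *: M) i j) = 0.
Proof.
move=> Mr; rewrite expmxE mxE.
have Z n l : eim i l n = 0.
  have : forall p q, imC ((M ^+ n) p q) = 0.
    elim: n => [|n IH] p q; first by rewrite expr0 mxE; case: (p == q).
    rewrite exprS mxE; apply: (big_ind (fun z : C R => imC z = 0)) => //.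
      by move=> x y hx hy; rewrite imCD hx hy addr0.
    by move=> k _; rewrite imCM IH Mr mulr0 mul0r addr0.
  exact.
have -> : S (eim i j) s = 0.
  rewrite /S /pseries; apply: cvg_lim => //.
  rewrite (_ : series _ = fun=> 0); first exact: cvg_cst.
  by apply/funext => N; rewrite /series /= big1 // => n _; rewrite Z !mul0r.
by rewrite mulr0 addr0 imC_toC.
Qed.

(** Differentiating the entrywise series shifts the power of [M] by one; writing the shifted power
    as [M] times the previous one and summing gives [M] times the exponential. *)
Lemma expmx_has_d a b t i j :
  has_d a b (fun s => expmx (toC s *: M) i j) t ((M *m expmx (toC t *: M)) i j).
Proof.
have -> : (fun s => expmx (toC s *: M) i j) = (fun s => toC (S (ere i j) s) + 'i * toC (S (eim i j) s)).
  by apply/funext => s; rewrite expmxE mxE.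
have -> : (M *m expmx (toC t *: M)) i j =
  toC (S (fun n => ere i j n.+1) t) + 'i * toC (S (fun n => eim i j n.+1) t).
  have cv (al : nat -> R) : (forall n, `|al n| <= 1 * mu ^+ n) ->
      pseries (fun n => al n / n`!%:R) t @ \oo --> S al t.
    by move=> h; apply: cvg_fact_pseries h.
  have lre : S (fun n => ere i j n.+1) t = \sum_l (reC (M i l) * S (ere l j) t - imC (M i l) * S (eim l j) t).
    apply: cvg_lim => //.
    have -> : pseries (fun n => ere i j n.+1 / n`!%:R) t = (fun N => \sum_l (reC (M i l) * pseries (fun n => ere l j n / n`!%:R) t N - imC (M i l) * pseries (fun n => eim l j n / n`!%:R) t N)).
      apply/funext => N; rewrite /pseries /series /=.
      under [RHS]eq_bigr do rewrite !mulr_sumr -sumrB.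
      rewrite exchange_big; apply: eq_bigr => n _ /=.
      have -> : ere i j n.+1 = \sum_l (reC (M i l) * ere l j n - imC (M i l) * eim l j n).
        rewrite /ere exprS mxE (big_morph (@reC R) reCD (reC_toC 0)).
        by apply: eq_bigr => l _; rewrite reCM.
      by rewrite !mulr_suml; apply: eq_bigr => l _; ring.
    apply: cvg_fsum => l; apply: cvgB; apply: cvgM; (try exact: cvg_cst); exact: cv.
  have lim_ : S (fun n => eim i j n.+1) t = \sum_l (reC (M i l) * S (eim l j) t + imC (M i l) * S (ere l j) t).
    apply: cvg_lim => //.
    have -> : pseries (fun n => eim i j n.+1 / n`!%:R) t = (fun N => \sum_l (reC (M i l) * pseries (fun n => eim l j n / n`!%:R) t N + imC (M i l) * pseries (fun n => ere l j n / n`!%:R) t N)).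
      apply/funext => N; rewrite /pseries /series /=.
      under [RHS]eq_bigr do rewrite !mulr_sumr -big_split /=.
      rewrite exchange_big; apply: eq_bigr => n _ /=.
      have -> : eim i j n.+1 = \sum_l (reC (M i l) * eim l j n + imC (M i l) * ere l j n).
        rewrite /eim exprS mxE (big_morph (@imC R) imCD (imC_toC 0)).
        by apply: eq_bigr => l _; rewrite imCM.
      by rewrite !mulr_suml; apply: eq_bigr => l _; ring.
    apply: cvg_fsum => l; apply: cvgD; apply: cvgM; (try exact: cvg_cst); exact: cv.
  rewrite lre lim_ !toC_sum mulr_sumr -big_split mxE /=; apply: eq_bigr => l _.
  rewrite expmxE mxE [X in X * _]reim !toCB !toCD !toCM.
  have i2 : 'i * 'i = -1 :> C R by rewrite -expr2 sqrCi.
  set x := toC (reC _); set y := toC (imC _); set z := toC _; set w := toC (S _ _).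
  have -> : (x + 'i * y) * (z + 'i * w) = x * z + ('i * 'i) * (y * w) + 'i * (x * w + y * z) by ring.
  by rewrite i2; ring.
apply: has_dD; last apply: has_dZ.
- by apply: has_d_is_derive; apply: is_derive_fact_pseries (@bre i j).
- by apply: has_d_is_derive; apply: is_derive_fact_pseries (@bim i j).
Qed.
End MatrixExponential.

(** * Leibniz sums over the entries of a multi-index *)

Section SplitSums.
Context {R : realType} {n : nat}.
Implicit Types (a b c : seq 'I_n) (G : 'I_n -> seq 'I_n -> C R) (Y : seq 'I_n -> C R).

Definition perm_inv {T : Type} (Y : seq 'I_n -> T) := forall a b, perm_eq a b -> Y a = Y b.

(** The Leibniz sum: each entry in turn is split off and the others keep their order. The recursive
    form permits induction on the tuple; [splitsE] identifies it with the sum over positions in the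
    lifted matrices. *)
Fixpoint splits G a : C R :=
  if a is i :: c then G i c + splits (fun i' c' => G i' (i :: c')) c else 0.

Lemma splitsE G a :
  splits G a = \sum_(l < size a) G (tnth (in_tuple a) l) (chi a l).
Proof.
elim: a G => [|i a IH] G /=; first by rewrite big_ord0.
rewrite big_ord_recl IH; congr (_ + _).
  by rewrite /chi /= drop0 (tnth_nth i).
by apply: eq_bigr => l _; rewrite !(tnth_nth i).
Qed.

(** If [G] ignores the order of the remaining entries, only the value of the removed entry matters,
    and its first occurrence can be removed instead. *)
Lemma splits_rem G a : (forall i, perm_inv (G i)) ->
  splits G a = \sum_(i <- a) G i (rem i a).
Proof.
elim: a G => [|i a IH] G pG /=; first by rewrite big_nil.
rewrite big_cons /= eqxx; congr (_ + _).
rewrite IH => [|j b c bc]; last by apply: pG; rewrite perm_cons.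
rewrite big_seq [RHS]big_seq; apply: eq_bigr => j ja.
rewrite eq_sym; case: eqP => // <-; apply: pG.
by rewrite perm_sym; exact: perm_to_rem.
Qed.

Lemma splits_perm G : (forall i, perm_inv (G i)) -> perm_inv (splits G).
Proof.
move=> pG a b ab; rewrite !splits_rem // (perm_big _ ab) /=.
rewrite big_seq [RHS]big_seq; apply: eq_bigr => i ib; apply: pG.
have ia : i \in a by rewrite (perm_mem ab).
by rewrite -(perm_cons i) -(permPl (perm_to_rem ia)) -(permPr (perm_to_rem ib)).
Qed.

Lemma eq_splits G G' a :
  (forall i c, (size c).+1 = size a -> G i c = G' i c) -> splits G a = splits G' a.
Proof.
elim: a G G' => [//|i a IH] G G' h /=; rewrite h //; congr (_ + _).
by apply: IH => j c sc; apply: h; rewrite /= sc.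
Qed.

Lemma splitsD G G' a : splits (fun i c => G i c + G' i c) a = splits G a + splits G' a.
Proof. by elim: a G G' => [|i a IH] G G' /=; rewrite ?addr0 // IH addrACA. Qed.

Lemma splitsZ (z : C R) G a : splits (fun i c => z * G i c) a = z * splits G a.
Proof. by elim: a G => [|i a IH] G /=; rewrite ?mulr0 // IH mulrDr. Qed.

Lemma splitsB G G' a : splits (fun i c => G i c - G' i c) a = splits G a - splits G' a.
Proof.
rewrite -mulN1r -splitsZ -splitsD; apply: eq_splits => i c _.
by rewrite mulN1r.
Qed.

(** The bound is asked only for [i] and [c] that together rearrange [a], so that the length of [c]
    and its number of u-indices can be used. *)
Lemma splits_bound G a (B : R) :
  (forall i c, perm_eq (i :: c) a -> nc (G i c) <= B) ->
  nc (splits G a) <= (size a)%:R * B.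
Proof.
elim: a G => [|i a IH] G h /=; first by rewrite nc0 mul0r.
apply: le_trans (ler_ncD _ _) _; rewrite -addn1 natrD mulrDl mul1r addrC lerD //.
  by apply: IH => j c jc; apply: h; rewrite (perm_catCA [:: j] [:: i] c) perm_cons.
by apply: h.
Qed.

Lemma splits_has_d (u v : R) (t : R) (G : R -> 'I_n -> seq 'I_n -> C R)
  (dG : 'I_n -> seq 'I_n -> C R) a :
  (forall i c, (size c).+1 = size a -> has_d u v (fun s => G s i c) t (dG i c)) ->
  has_d u v (fun s => splits (G s) a) t (splits dG a).
Proof.
elim: a G dG => [|i a IH] G dG h /=; first exact: has_d_cst.
apply: has_dD; first by apply: h.
by apply: IH => j c sc; apply: h; rewrite /= sc.
Qed.

Lemma sum_count (F : 'I_n -> C R) b :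
  \sum_(i <- b) F i = \sum_q (count_mem q b)%:R * F q.
Proof.
elim: b => [|i b IH]; first by rewrite big_nil big1 // => q _; rewrite mul0r.
rewrite big_cons IH /=; under [RHS]eq_bigr do rewrite natrD mulrDl.
rewrite big_split /=; congr (_ + _).
rewrite (bigD1 i) //= eqxx mul1r big1 ?addr0 // => q qi.
by rewrite eq_sym (negbTE qi) mul0r.
Qed.

Lemma perm_inv_mono (y : 'cV[C R]_n) : perm_inv (mono y).
Proof. by move=> a b ab; exact: perm_big. Qed.

Lemma perm_inv_cons {T : Type} (Y : seq 'I_n -> T) i : perm_inv Y -> perm_inv (fun c => Y (i :: c)).
Proof. by move=> pY a b ab; apply: pY; rewrite perm_cons. Qed.

Lemma perm_msort a : perm_eq (msort a) a.
Proof. by rewrite perm_sort. Qed.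

Lemma msort_perm a b : perm_eq a b -> msort a = msort b.
Proof.
move=> ab; apply/perm_sortP => //.
- exact: leo_total.
- exact: leo_trans.
- by move=> x y /anti_leq /val_inj.
Qed.

Lemma gamma_perm a b : perm_eq a b -> gamma a = gamma b.
Proof.
by move=> /permP ab; apply: eq_bigr => q _; rewrite ab.
Qed.

Lemma gamma_cons q c : gamma (q :: c) = ((count_mem q c).+1 * gamma c)%N.
Proof.
rewrite /gamma (bigD1 q) //= [in RHS](bigD1 q) //= eqxx add1n factS -!mulnA.
congr (_ * (_ * _))%N; apply: eq_bigr => i iq.
by rewrite eq_sym (negbTE iq).
Qed.

Lemma gamma_gt0 a : (0 < gamma a)%N.
Proof. by apply: prodn_gt0 => q; exact: fact_gt0. Qed.

(* Inserting q is a bijection from the multi-indices of degree j onto those of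
   degree j + 1 that contain q. *)
Lemma sum_nondec_insert j q (H : seq 'I_n -> C R) : perm_inv H ->
  \sum_(b : j.+1.-tuple 'I_n | nondec b) (gamma b)%:R^-1 * ((count_mem q b)%:R * H b) =
  \sum_(c : j.-tuple 'I_n | nondec c) (gamma c)%:R^-1 * H (q :: c).
Proof.
move=> pH; rewrite (bigID (fun b : j.+1.-tuple 'I_n => q \in b)) /= addrC big1 ?add0r.
  have ins_size (c : j.-tuple 'I_n) : size (msort (q :: c)) == j.+1.
    by rewrite size_sort /= size_tuple.
  pose ins (c : j.-tuple _) : j.+1.-tuple 'I_n := Tuple (ins_size c).
  have del_size (b : j.+1.-tuple 'I_n) : size (take j (rem q b ++ b)) == j.
    rewrite size_takel // size_cat size_tuple; apply: leq_trans (leq_addl _ _).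
    exact: leqnSn.
  pose del (b : j.+1.-tuple _) : j.-tuple 'I_n := Tuple (del_size b).
  have delE (b : j.+1.-tuple _) : q \in b -> del b = rem q b :> seq _.
    move=> qb; rewrite /= take_cat size_rem // size_tuple /= ltnn subnn take0 cats0 //.
  rewrite (reindex_onto ins del) /=; last first.
    move=> b /andP[nb qb]; apply: val_inj => /=; rewrite delE //.
    by rewrite -[RHS](msort_nondec nb); apply: msort_perm; rewrite perm_sym; exact: perm_to_rem.
  apply: eq_big => [c|c _].
    rewrite nondec_msort /= mem_sort inE eqxx /=.
    apply/eqP/idP => [<-|nc].
      rewrite delE ?mem_sort ?inE ?eqxx //; apply: (subseq_sorted (@leo_trans n)) (rem_subseq _ _) _.
      exact: nondec_msort.
    apply: val_inj; change (tval (del (ins c)) = c).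
    rewrite delE /= ?mem_sort ?inE ?eqxx //.
    rewrite -[RHS](msort_nondec nc) -[LHS]msort_nondec.
      apply: msort_perm; rewrite -(perm_cons q).
      rewrite -(permPr (perm_msort (q :: c))) perm_sym perm_to_rem //.
      by rewrite mem_sort inE eqxx.
    apply: (subseq_sorted (@leo_trans n)) (rem_subseq _ _) _.
    exact: nondec_msort.
  have pc := perm_msort (q :: c).
  rewrite (gamma_perm pc) (pH _ _ pc) (permP pc) gamma_cons natrM invfM /= eqxx add1n.
  have : (count_mem q c).+1%:R != 0 :> C R by rewrite pnatr_eq0.
  by move=> x0; rewrite mulrACA mulVf // mul1r.
move=> b /andP[_ qb]; rewrite (_ : count_mem q b = 0%N) ?mul0r ?mulr0 //.
by apply/eqP; rewrite -leqn0 leqNgt -has_count; apply: contra qb; rewrite has_pred1.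
Qed.

(** This is the derivative of the part of degree j + 1 of a Taylor polynomial. Removing an entry [q]
    produces its multiplicity, which [sum_nondec_insert] cancels against [gamma]; the part of degree
    j for the derivative in direction [q] is left. *)
Lemma sum_nondec_splits j (v : 'I_n -> C R) (p : seq 'I_n -> C R) (y : 'cV[C R]_n) :
  (forall a b, perm_eq a b -> size a = j.+1 -> p a = p b) ->
  \sum_(b : j.+1.-tuple 'I_n | nondec b)
     (gamma b)%:R^-1 * p b * splits (fun i c => v i * mono y c) b =
  \sum_q v q * \sum_(c : j.-tuple 'I_n | nondec c) (gamma c)%:R^-1 * p (q :: c) * mono y c.
Proof.
move=> pp.
(* [p] is symmetric on tuples of length j + 1 only; its extension by zero is symmetric
   everywhere. *)
pose p' a := if size a == j.+1 then p a else 0.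
have p'E a : size a = j.+1 -> p' a = p a by rewrite /p' => ->; rewrite eqxx.
have pp' : perm_inv p'.
  move=> a b ab; rewrite /p' (perm_size ab); case: eqP => // sb.
  by apply: pp => //; rewrite (perm_size ab).
rewrite (eq_bigr (fun b : j.+1.-tuple 'I_n => \sum_q v q * ((gamma b)%:R^-1 * ((count_mem q b)%:R * (p' b * mono y (rem q b)))))).
  rewrite exchange_big; apply: eq_bigr => q _ /=; rewrite -big_distrr /=; congr (_ * _).
  rewrite (@sum_nondec_insert j q (fun b => p' b * mono y (rem q b))).
    apply: eq_bigr => c _; rewrite p'E; last by rewrite /= size_tuple.
    by rewrite /= eqxx mulrA.
  move=> a b ab; rewrite (pp' _ _ ab); congr (_ * _); apply: perm_inv_mono.
  have [qa|qa] := boolP (q \in a).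
    have qb : q \in b by rewrite -(perm_mem ab).
    by rewrite -(perm_cons q) -(permPl (perm_to_rem qa)) -(permPr (perm_to_rem qb)).
  by rewrite !rem_id // -(perm_mem ab).
move=> b _; rewrite splits_rem; last first.
  by move=> i c c' cc; rewrite (perm_inv_mono y cc).
rewrite sum_count p'E ?size_tuple // big_distrr /=; apply: eq_bigr => q _.
ring.
Qed.
End SplitSums.

(** * The sum norm and its comparison with the Euclidean norm *)

Section Norms.
Context {R : realType} {n : nat}.
Implicit Types (x y : 'cV[C R]_n).

Definition l1 x : R := \sum_i nc (x i 0).

Lemma l1_ge0 x : 0 <= l1 x. Proof. by apply: sumr_ge0 => i _; exact: nc_ge0. Qed.
Lemma nc_le_l1 x i : nc (x i 0) <= l1 x.
Proof. by rewrite /l1 (bigD1 i) //= lerDl; apply: sumr_ge0 => j _; exact: nc_ge0. Qed.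
Lemma l10 : l1 0 = 0. Proof. by rewrite /l1 big1 // => i _; rewrite mxE nc0. Qed.
Lemma l1D x y : l1 (x + y) <= l1 x + l1 y.
Proof. by rewrite /l1 -big_split; apply: ler_sum => i _; rewrite mxE ler_ncD. Qed.
Lemma l1N x : l1 (- x) = l1 x.
Proof. by apply: eq_bigr => i _; rewrite mxE ncN. Qed.
Lemma l1BC x y : l1 (x - y) = l1 (y - x).
Proof. by rewrite -l1N opprB. Qed.
Lemma l1Z (c : C R) x : l1 (c *: x) = nc c * l1 x.
Proof. by rewrite /l1 mulr_sumr; apply: eq_bigr => i _; rewrite mxE ncM. Qed.
Lemma l1_delta (z : C R) q : l1 (z *: delta_mx q 0) = nc z.
Proof.
rewrite /l1 (bigD1 q) //= big1 ?addr0; first by rewrite !mxE !eqxx mulr1.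
by move=> i iq; rewrite !mxE (negbTE iq) mulr0 nc0.
Qed.

Lemma nc_le_enorm x i : nc (x i 0) <= enorm x.
Proof.
rewrite -[leLHS]ger0_norm ?nc_ge0 // -sqrtr_sqr /enorm ler_wsqrtr //.
by rewrite (bigD1 i) //= lerDl; apply: sumr_ge0 => j _; exact: sqr_ge0.
Qed.
Lemma enorm_le_l1 x : enorm x <= l1 x.
Proof.
rewrite -[leRHS]ger0_norm ?l1_ge0 // -sqrtr_sqr /enorm ler_wsqrtr //.
rewrite expr2 {1}/l1 mulr_suml; apply: ler_sum => i _.
by rewrite expr2 ler_wpM2l ?nc_ge0 ?nc_le_l1.
Qed.
End Norms.

(** * Partial derivatives inside a domain: symmetry, chain rule, Taylor estimates *)

Section PartialDerivativeCalculus.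
Context {R : realType} {n : nat} (D : set 'cV[C R]_n).
Implicit Types (x y : 'cV[C R]_n) (g : 'cV[C R]_n -> C R) (z : C R) (q : 'I_n).

Local Notation e_ q := (delta_mx q 0 : 'cV[C R]_n).

Definition box_like :=
  [/\ forall x y q, D x -> D y -> D (x + (y q 0 - x q 0) *: e_ q),
      forall x y (t : R), 0 <= t <= 1 -> D x -> D y -> D (x + toC t *: (y - x))
    & forall x q (e : R), 0 < e -> D x ->
        exists z, [/\ z != 0, nc z < e & D (x + z *: e_ q)]].

Context (Dbox : box_like).

Lemma near_increments q x (P : C R -> Prop) :
  (\forall z \near increments D q x, P z) <->
  exists2 dl : R, 0 < dl & forall z, z != 0 -> D (x + z *: e_ q) -> nc z < dl -> P z.
Proof.
rewrite /increments near_withinE near_withinE; split.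
  move=> /nbhs_ballP[e /= e0 h]; exists (reC e).
    have eE : e = toC (reC e) by apply/esym; apply: RRe_real; apply: gtr0_real.
    by rewrite -lt_toC -eE.
  move=> z z0 Dz zd; apply: h => //; rewrite /ball /= sub0r normrN norm_nc.
  have -> : e = toC (reC e) by apply/esym; apply: RRe_real; apply: gtr0_real.
  by rewrite lt_toC.
move=> [dl dl0 h]; apply/nbhs_ballP; exists (toC dl) => /=.
  by rewrite -toC0 lt_toC.
move=> z; rewrite /ball /= sub0r normrN norm_nc lt_toC => zd z0 Dz.
exact: h.
Qed.

Lemma increments_proper q x : D x -> ProperFilter (increments D q x).
Proof.
move=> Dx; apply: Build_ProperFilter_ex => P /near_increments [dl dl0 h].
have [_ _ /(_ x q dl dl0 Dx) [z [z0 zd Dz]]] := Dbox.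
by exists z; apply: h.
Qed.

Lemma pderivP g q x : D x -> has_pderiv D q g x -> forall e : R, 0 < e ->
  exists2 dl : R, 0 < dl & forall z, D (x + z *: e_ q) -> nc z < dl ->
   nc (g (x + z *: e_ q) - g x - z * pderiv D q g x) <= e * nc z.
Proof.
move=> Dx hg e e0.
have /cvg_ncP /(_ e e0) /near_increments [dl dl0 h] :
  diff_quot g q x z @[z --> increments D q x] --> pderiv D q g x by [].
exists dl => // z Dz zd; have [->|z0] := eqVneq z 0.
  by rewrite scale0r addr0 mul0r !subrr nc0 mulr0.
have := h z z0 Dz zd; rewrite /diff_quot => le.
have -> : g (x + z *: e_ q) - g x - z * pderiv D q g x =
  (z^-1 * (g (x + z *: e_ q) - g x) - pderiv D q g x) * z by field.
by rewrite ncM ler_wpM2r ?nc_ge0.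
Qed.

Lemma pderiv_eq g q x l : D x ->
  (forall e : R, 0 < e -> exists2 dl : R, 0 < dl & forall z, z != 0 ->
     D (x + z *: e_ q) -> nc z < dl -> nc (diff_quot g q x z - l) <= e) ->
  has_pderiv D q g x /\ pderiv D q g x = l.
Proof.
move=> Dx h; have PF := increments_proper q Dx.
have c : diff_quot g q x z @[z --> increments D q x] --> l.
  by apply/cvg_ncP => e e0; apply/near_increments; exact: h.
split; first exact: cvgP c.
by apply: cvg_lim c; exact: C_hausdorff.
Qed.

(** The increments in the limit stay in [D], so values outside [D] have no influence. *)
Lemma pderiv_ext g g' q x : D x -> (forall y, D y -> g y = g' y) ->
  has_pderiv D q g x -> has_pderiv D q g' x /\ pderiv D q g' x = pderiv D q g x.
Proof.
move=> Dx gg hg; apply: pderiv_eq => // e e0.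
have /cvg_ncP /(_ e e0) /near_increments [dl dl0 h] :
  diff_quot g q x z @[z --> increments D q x] --> pderiv D q g x by [].
by exists dl => // z z0 Dz zd; have := h z z0 Dz zd; rewrite /diff_quot !gg.
Qed.

Lemma pderiv_cst (c : C R) q x : D x -> pderiv D q (fun=> c) x = 0.
Proof.
move=> Dx; have [|_ ->//] := @pderiv_eq (fun=> c) q x 0 Dx.
by move=> e e0; exists 1 => // z _ _ _; rewrite /diff_quot subrr mulr0 subrr nc0 ltW.
Qed.

Lemma box_axis x q z (t : R) : 0 <= t <= 1 -> D x -> D (x + z *: e_ q) ->
  D (x + (toC t * z) *: e_ q).
Proof.
move=> t01 Dx Dz; have [_ /(_ _ _ t t01 Dx Dz) + _] := Dbox.
by rewrite addrAC subrr add0r scalerA.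
Qed.

Lemma coord_has_d g q x z : (forall y, D y -> has_pderiv D q g y) ->
  D x -> D (x + z *: e_ q) -> forall t : R, 0 <= t <= 1 ->
  has_d 0 1 (fun t => g (x + (toC t * z) *: e_ q)) t
    (z * pderiv D q g (x + (toC t * z) *: e_ q)).
Proof.
move=> hg Dx Dz t t01 e e0; set y := x + (toC t * z) *: e_ q.
have Dy : D y by exact: box_axis.
(* [z] may be zero, hence the shift by 1 in the denominators. *)
have z1 : 0 < nc z + 1 by rewrite ltr_wpDl ?nc_ge0.
have [dl dl0 h] := pderivP Dy (hg _ Dy) (divr_gt0 e0 z1).
exists (dl / (nc z + 1)); first by rewrite divr_gt0.
move=> s s01 st.
have E : x + (toC s * z) *: e_ q = y + (toC (s - t) * z) *: e_ q.
  by rewrite /y -addrA -scalerDl -mulrDl -toCD addrCA subrr addr0.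
have Ds : D (y + (toC (s - t) * z) *: e_ q) by rewrite -E; exact: box_axis.
rewrite E mulrA; apply: le_trans (h _ Ds _) _.
  rewrite ncM nc_toC; apply: le_lt_trans (_ : `|s - t| * (nc z + 1) < _).
    by rewrite ler_wpM2l // lerDl.
  by rewrite -ltr_pdivlMr.
rewrite ncM nc_toC mulrCA mulrC ler_wpM2r //.
by rewrite mulrAC ler_pdivrMr // ler_wpM2l ?(ltW e0) // lerDl.
Qed.

(** The mean value inequality for [g] minus the linear function of slope [p]. The slope is free so
    that it can be a derivative at another point. *)
Lemma coord_mvi g q x z p (B : R) : (forall y, D y -> has_pderiv D q g y) ->
  D x -> D (x + z *: e_ q) ->
  (forall t : R, 0 <= t <= 1 -> nc (pderiv D q g (x + (toC t * z) *: e_ q) - p) <= B) ->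
  nc (g (x + z *: e_ q) - g x - z * p) <= nc z * B.
Proof.
move=> hg Dx Dz hB.
have := @complex_mvi _ 0 1 (fun t => g (x + (toC t * z) *: e_ q) - z * p * toC t)
  (fun t => z * pderiv D q g (x + (toC t * z) *: e_ q) - z * p) (nc z * B) ler01.
rewrite toC0 toC1 !mul1r !mul0r mulr0 scale0r addr0 !subr0 mulr1.
rewrite addrAC mulr1; apply.
- by move=> t t01; apply: has_dB; [exact: coord_has_d|exact: has_d_lin].
- by move=> t t01; rewrite -mulrBr ncM ler_wpM2l ?nc_ge0 ?hB.
Qed.

Lemma lipschitz_l1 g : lipschitz_in D g -> exists2 L : R, 0 <= L &
  forall x y, D x -> D y -> nc (g x - g y) <= L * l1 (x - y).
Proof.
move=> [L h]; exists (Num.max L 0); first by rewrite le_max lexx orbT.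
move=> x y Dx Dy; apply: le_trans (h x y Dx Dy) _.
apply: le_trans (_ : Num.max L 0 * enorm (x - y) <= _).
  by rewrite ler_wpM2r ?sqrtr_ge0 // le_max lexx.
by rewrite ler_wpM2l ?enorm_le_l1 // le_max lexx orbT.
Qed.

(** Two mean value inequalities, first in direction [q] for the difference of two translates of [g],
    then in direction [p] for [pderiv D q g]. The Lipschitz bound compares the mixed derivative
    along the way with its value at [x]. *)
Lemma second_difference g p q x s t (L : R) : p != q -> 0 <= L ->
  (forall y, D y -> has_pderiv D q g y) ->
  (forall y, D y -> has_pderiv D p (pderiv D q g) y) ->
  (forall y y', D y -> D y' ->
     nc (pderiv D p (pderiv D q g) y - pderiv D p (pderiv D q g) y') <= L * l1 (y - y')) ->
  D x -> D (x + s *: e_ p) -> D (x + t *: e_ q) ->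
  nc (g (x + s *: e_ p + t *: e_ q) - g (x + s *: e_ p) - (g (x + t *: e_ q) - g x)
      - t * s * pderiv D p (pderiv D q g) x)
  <= nc t * (nc s * (L * (nc s + nc t))).
Proof.
move=> pq L0 hq hpq hL Dx Ds Dt.
set m := pderiv D p (pderiv D q g) x.
(* The fourth corner arises from the corner in direction [p] by replacing its coordinate [q], which
   is still that of [x] because [p] and [q] differ. *)
have Dst : D (x + s *: e_ p + t *: e_ q).
  have [/(_ _ _ q Ds Dt) + _ _] := Dbox.
  rewrite !mxE !eqxx [q == p]eq_sym (negbTE pq) /= !mulr0 addr0 mulr1.
  by rewrite [x q 0 + t]addrC addrK.
pose f (t' : R) := g (x + s *: e_ p + (toC t' * t) *: e_ q) - g (x + (toC t' * t) *: e_ q)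
   - t * s * m * toC t'.
pose l (t' : R) := t * pderiv D q g (x + s *: e_ p + (toC t' * t) *: e_ q) -
   t * pderiv D q g (x + (toC t' * t) *: e_ q) - t * s * m.
have := @complex_mvi _ 0 1 f l (nc t * (nc s * (L * (nc s + nc t)))) ler01.
rewrite subr0 mulr1 /f toC0 toC1 !mul1r !mul0r !scale0r !addr0 !mulr1 mulr0 subr0.
have -> : forall a b c d e : C R, a - b - c - (d - e) = a - d - (b - e) - c by move=> *; ring.
apply.
  move=> t' t01; apply: has_dB; last exact: has_d_lin.
  by apply: has_dB; apply: coord_has_d.
move=> t' t01; rewrite /l.
have -> : forall a b c : C R, t * a - t * b - t * s * c = t * (a - b - s * c) by move=> *; ring.
rewrite ncM ler_wpM2l ?nc_ge0 //.
have Dt' := box_axis t01 Dx Dt.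
have Ds' := box_axis t01 Ds Dst.
have yE : x + s *: e_ p + (toC t' * t) *: e_ q = x + (toC t' * t) *: e_ q + s *: e_ p.
  by rewrite addrAC.
rewrite yE in Ds' *.
apply: (@coord_mvi (pderiv D q g) p) => // t2 t201.
have D2 := box_axis t201 Dt' Ds'.
apply: le_trans (hL _ _ D2 Dx) _; rewrite ler_wpM2l //.
have -> : x + (toC t' * t) *: e_ q + (toC t2 * s) *: e_ p - x = (toC t' * t) *: e_ q + (toC t2 * s) *: e_ p.
  by apply/matrixP => i j; rewrite !mxE; ring.
apply: le_trans (l1D _ _) _.
rewrite !l1_delta !ncM !nc_toC addrC lerD // ger0_norm ?ler_piMl ?nc_ge0 //; lra.
Qed.

(** The second difference is symmetric in [p] and [q], and divided by both increments it
    approximates either mixed derivative. Small increments exclude a gap between the two. *)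
Lemma schwarz g p q x (L L' : R) : 0 <= L -> 0 <= L' ->
  (forall y, D y -> has_pderiv D q g y) ->
  (forall y, D y -> has_pderiv D p g y) ->
  (forall y, D y -> has_pderiv D p (pderiv D q g) y) ->
  (forall y, D y -> has_pderiv D q (pderiv D p g) y) ->
  (forall y y', D y -> D y' ->
     nc (pderiv D p (pderiv D q g) y - pderiv D p (pderiv D q g) y') <= L * l1 (y - y')) ->
  (forall y y', D y -> D y' ->
     nc (pderiv D q (pderiv D p g) y - pderiv D q (pderiv D p g) y') <= L' * l1 (y - y')) ->
  D x -> pderiv D p (pderiv D q g) x = pderiv D q (pderiv D p g) x.
Proof.
move=> L0 L'0 hq hp hpq hqp hL hL' Dx.
have [<-//|pq] := eqVneq p q.
set m := pderiv D p _ x; set m' := pderiv D q _ x.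
apply/eqP; rewrite -subr_eq0; apply/negPn/negP => /nc_gt0 n0.
(* Increments below [e] leave a defect of at most [(L + L') * (2 * e)], which is less than
   [nc (m - m')]. *)
pose e := nc (m - m') / (2 * (L + L' + 1)).
have e0 : 0 < e by rewrite /e divr_gt0 // mulr_gt0 // ltr_wpDl // addr_ge0.
have [_ _ hz] := Dbox.
have [s [s0 se Ds]] := hz x p e e0 Dx; have [t [t0 te Dt]] := hz x q e e0 Dx.
have h1 := second_difference pq L0 hq hpq hL Dx Ds Dt.
have qp : q != p by rewrite eq_sym.
have h2 := second_difference qp L'0 hp hqp hL' Dx Dt Ds.
have st0 : 0 < nc s * nc t by rewrite mulr_gt0 ?nc_gt0.
have : nc (t * s * (m - m')) <= nc s * nc t * ((L + L') * (nc s + nc t)).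
  rewrite (addrAC x) in h2.
  set a1 := g (x + s *: e_ p + t *: e_ q) in h1 h2.
  set a2 := g (x + s *: e_ p) in h1 h2; set a3 := g (x + t *: e_ q) in h1 h2.
  rewrite -/m in h1; rewrite -/m' in h2.
  have -> : t * s * (m - m') = (a1 - a3 - (a2 - g x) - s * t * m') - (a1 - a2 - (a3 - g x) - t * s * m) by ring.
  apply: le_trans (ler_ncB _ _) _; apply: le_trans (lerD h2 h1) _.
  by rewrite le_eqVlt; apply/orP; left; apply/eqP; ring.
rewrite !ncM [nc t * _]mulrC ler_pM2l //.
apply/negP; rewrite -ltNge.
have : nc s + nc t < 2 * e by rewrite mulr_natl mulr2n ltrD.
have : (L + L' + 1) * (2 * e) = nc (m - m').
  by rewrite /e; field; rewrite gt_eqF // ltr_wpDl // addr_ge0.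
move=> <- le; have LL : 0 <= L + L' by rewrite addr_ge0.
apply: le_lt_trans (_ : (L + L') * (2 * e) < _).
  by rewrite ler_wpM2l // ltW.
by rewrite ltr_pM2r ?ltrDl // mulr_gt0.
Qed.

Lemma Ck_has k g a q x : Ck_lipschitz D k g -> (size a < k)%N -> D x ->
  has_pderiv D q (pderivs D a g) x.
Proof. by move=> h sa; apply: (h a (ltnW sa)).2. Qed.

Lemma Ck_lip k g a : Ck_lipschitz D k g -> (size a <= k)%N -> exists2 L : R, 0 <= L &
  forall x y, D x -> D y -> nc (pderivs D a g x - pderivs D a g y) <= L * l1 (x - y).
Proof. by move=> h sa; apply: lipschitz_l1; exact: (h a sa).1. Qed.

(** Induction on the length. If the heads [p] and [q] differ, both tails are rearranged so that the
    other head comes first, and [schwarz] exchanges the two outermost derivatives of the common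
    rest. *)
Lemma pderivs_perm k g a b : Ck_lipschitz D k g -> (size a <= k)%N -> perm_eq a b ->
  forall x, D x -> pderivs D a g x = pderivs D b g x.
Proof.
move=> h; have [N] := ubnP (size a); elim: N a b => // N IH [|p a] b.
  by move=> _ _; rewrite perm_sym => /perm_nilP ->.
rewrite ltnS /= => aN ak ab x Dx.
have pb : p \in b by rewrite -(perm_mem ab) inE eqxx.
case: b ab pb => [|q b] ab pb; first by rewrite in_nil in pb.
change (pderiv D p (pderivs D a g) x = pderiv D q (pderivs D b g) x).
have sab : size a = size b by have /= [] := perm_size ab.
have [pq|pq] := eqVneq p q.
  rewrite -pq perm_cons in ab *.
  by rewrite (pderiv_ext Dx (IH a b aN (ltnW ak) ab) (Ck_has (q := p) h ak Dx)).2.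
have pb' : p \in b by move: pb; rewrite inE (negbTE pq).
pose c := rem p b.
have bc : perm_eq b (p :: c) by exact: perm_to_rem.
have ac : perm_eq a (q :: c).
  rewrite -(perm_cons p) (permPl ab) perm_sym (perm_catCA [:: p] [:: q] c) perm_cons.
  by rewrite perm_sym.
have sc : (size c).+1 = size a by rewrite (perm_size ac).
have ck : (size c < k)%N by apply: leq_trans (ltnW ak); rewrite sc.
have [L L0 hL] : exists2 L : R, 0 <= L & forall y y', D y -> D y' ->
    nc (pderivs D [:: p, q & c] g y - pderivs D [:: p, q & c] g y') <= L * l1 (y - y').
  by apply: Ck_lip h _; rewrite /= sc.
have [L' L'0 hL'] : exists2 L : R, 0 <= L & forall y y', D y -> D y' ->
    nc (pderivs D [:: q, p & c] g y - pderivs D [:: q, p & c] g y') <= L * l1 (y - y').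
  by apply: Ck_lip h _; rewrite /= sc.
have E1 : pderiv D p (pderivs D a g) x = pderiv D p (pderiv D q (pderivs D c g)) x.
  exact: esym (pderiv_ext Dx (IH a (q :: c) aN (ltnW ak) ac) (Ck_has (q := p) h ak Dx)).2.
have bk : (size b < k)%N by rewrite -sab.
have E2 : pderiv D q (pderivs D b g) x = pderiv D q (pderiv D p (pderivs D c g)) x.
  have bN : (size b < N)%N by rewrite -sab.
  exact: esym (pderiv_ext Dx (IH b (p :: c) bN (ltnW bk) bc) (Ck_has (q := q) h bk Dx)).2.
rewrite E1 E2; apply: schwarz L0 L'0 _ _ _ _ hL hL' Dx => y Dy.
- exact: Ck_has h ck Dy.
- exact: Ck_has h ck Dy.
- by apply: (@Ck_has k g (q :: c) p y h) => //; rewrite /= sc.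
- by apply: (@Ck_has k g (p :: c) q y h) => //; rewrite /= sc.
Qed.

Lemma pderivs_rcons a q g : pderivs D a (pderiv D q g) = pderivs D (rcons a q) g.
Proof. by rewrite /pderivs -cats1 foldr_cat. Qed.

Lemma Ck_pderiv k g q : Ck_lipschitz D k.+1 g -> Ck_lipschitz D k (pderiv D q g).
Proof.
by move=> h a sa; rewrite pderivs_rcons; have := h (rcons a q); rewrite size_rcons !ltnS; apply.
Qed.

Lemma Ck_le k k' g : (k' <= k)%N -> Ck_lipschitz D k g -> Ck_lipschitz D k' g.
Proof.
move=> kk h a sa; have [h1 h2] := h a (leq_trans sa kk); split=> // sa' q x Dx.
by apply: h2 => //; apply: leq_trans kk.
Qed.

(** The coordinates are changed from [x] to [y] one after the other. On each axial step the partial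
    derivative is Lipschitz close to its value at [x], which makes the error quadratic. *)
Lemma total_diff g : Ck_lipschitz D 1 g -> exists2 L : R, 0 <= L &
  forall x y, D x -> D y ->
    nc (g y - g x - \sum_q (y q 0 - x q 0) * pderiv D q g x) <= L * l1 (y - x) ^+ 2.
Proof.
move=> h.
have /choice [L hL] : forall q, exists L : R, 0 <= L /\ forall x y, D x -> D y ->
    nc (pderiv D q g x - pderiv D q g y) <= L * l1 (x - y).
  by move=> q; have [L L0 hL] := Ck_lip (a := [:: q]) h isT; exists L.
have Ls0 : 0 <= \sum_q L q by apply: sumr_ge0 => q _; case: (hL q).
exists (\sum_q L q) => // x y Dx Dy.
(* The first [j] coordinates come from [y] and the others from [x]. *)
pose hyb j : 'cV[C R]_n := \col_i (if (i < j)%N then y i 0 else x i 0).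
have hybS (q : 'I_n) : hyb q.+1 = hyb q + (y q 0 - hyb q q 0) *: e_ q.
  apply/matrixP => i j; rewrite ord1 !mxE eqxx andbT ltnn ltnS.
  have [->|iq] := eqVneq i q; first by rewrite leqnn ltnn mulr1 addrC subrK.
  by rewrite mulr0 addr0 leq_eqVlt (inj_eq val_inj) (negbTE iq).
have hyb0 : hyb 0%N = x by apply/matrixP => i j; rewrite ord1 mxE ltn0.
have hybn : hyb n = y by apply/matrixP => i j; rewrite ord1 mxE ltn_ord.
have Dh j : (j <= n)%N -> D (hyb j).
  elim: j => [|j IH] jn; first by rewrite hyb0.
  rewrite (hybS (Ordinal jn)); have [hb _ _] := Dbox.
  by apply: hb => //; apply: IH; exact: ltnW.
have hx j : l1 (hyb j - x) <= l1 (y - x).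
  apply: ler_sum => i _; rewrite !mxE; case: ifP => // _.
  by rewrite subrr nc0 nc_ge0.
have -> : g y - g x = \sum_(q < n) (g (hyb q.+1) - g (hyb q)).
  rewrite -(big_mkord xpredT (fun q : nat => g (hyb q.+1) - g (hyb q))) telescope_sumr //.
  by rewrite hyb0 hybn.
rewrite -sumrB; apply: le_trans (ler_nc_sum _ _ _) _.
apply: le_trans (_ : \sum_q nc ((y - x) q 0) * (\sum_q L q * l1 (y - x)) <= _); last first.
  by rewrite -mulr_suml expr2 -mulr_suml mulrA mulrC [_ * l1 _]mulrC -mulrA.
apply: ler_sum => q _; rewrite hybS mxE ltnn !mxE.
have hq : hyb q + (y q 0 - x q 0) *: e_ q = hyb q.+1 by rewrite hybS mxE ltnn.
apply: coord_mvi.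
- by move=> y' Dy'; exact: (@Ck_has 1 g [::] q y' h isT Dy').
- by apply: Dh; exact: ltnW.
- by rewrite hq; exact: Dh.
move=> t t01.
have Dt : D (hyb q + (toC t * (y q 0 - x q 0)) *: e_ q).
  by apply: box_axis => //; [apply: Dh; exact: ltnW | rewrite hq; exact: Dh].
apply: le_trans ((hL q).2 _ _ Dt Dx) _.
rewrite [leRHS](bigD1 q) //= -[leLHS]addr0; apply: lerD; last first.
  by apply: sumr_ge0 => i _; rewrite mulr_ge0 ?l1_ge0 //; case: (hL i).
apply: ler_wpM2l; first by case: (hL q).
apply: ler_sum => i _; rewrite !mxE eqxx andbT.
have [->|iq] := eqVneq i q.
  rewrite ltnn mulr1 addrAC subrr add0r ncM nc_toC ler_piMl ?nc_ge0 //.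
  by rewrite ger0_norm; lra.
rewrite mulr0 addr0; case: ifP => // _; by rewrite subrr nc0 nc_ge0.
Qed.

Lemma chain_rule g (a b : R) (x : R -> 'cV[C R]_n) (v : 'I_n -> C R) (t : R) :
  Ck_lipschitz D 1 g -> a <= t <= b -> (forall s, a <= s <= b -> D (x s)) ->
  (forall q, has_d a b (fun s => x s q 0) t (v q)) ->
  has_d a b (fun s => g (x s)) t (\sum_q v q * pderiv D q g (x t)).
Proof.
move=> h tab Dx xd; have [L L0 hL] := total_diff h.
have lin : has_d a b (fun s => \sum_q (x s q 0 - x t q 0) * pderiv D q g (x t)) t
    (\sum_q v q * pderiv D q g (x t)).
  apply: has_d_sum => q _; apply: has_dZr.
  by rewrite -[v q]subr0; apply: has_dB; [exact: xd|exact: has_d_cst].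
have /choice [dl hdl] : forall q, exists dl : R, 0 < dl /\ forall s, a <= s <= b ->
    `|s - t| < dl -> nc (x s q 0 - x t q 0) <= (nc (v q) + 1) * `|s - t|.
  by move=> q; have [dl dl0 hd] := has_d_cont (xd q); exists dl.
pose B := \sum_q (nc (v q) + 1).
have B0 : 0 <= B by apply: sumr_ge0 => q _; rewrite addr_ge0 ?nc_ge0.
(* There are finitely many coordinates, so the smallest of their radii serves for all. *)
pose dm := \big[Num.min/1]_q dl q.
have dm0 : 0 < dm.
  by apply: (big_ind (fun z : R => 0 < z)) => // [p q p0 q0|q _]; [rewrite lt_min p0|case: (hdl q)].
have xB s : a <= s <= b -> `|s - t| < dm -> l1 (x s - x t) <= B * `|s - t|.
  move=> sab sd; rewrite /B mulr_suml; apply: ler_sum => q _; rewrite !mxE.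
  apply: (hdl q).2 => //; apply: lt_le_trans sd _.
  exact: bigmin_le.
move=> e e0; have e20 : 0 < e / 2 by rewrite divr_gt0.
have [d1 d10 h1] := lin _ e20.
have K0 : 0 < L * B ^+ 2 + 1 by rewrite ltr_wpDl // mulr_ge0 // sqr_ge0.
exists (Num.min (Num.min d1 dm) (e / 2 / (L * B ^+ 2 + 1))).
  by rewrite !lt_min d10 dm0 !divr_gt0.
move=> s sab; rewrite !lt_min => /andP[/andP[s1 s2] s3].
have := h1 s sab s1.
under [X in _ - X - _]eq_bigr do rewrite subrr mul0r.
rewrite [X in _ - X - _]big1 // subr0 => h1'.
have h2 := hL _ _ (Dx t tab) (Dx s sab).
set S := \sum_q (_ - _) * _ in h1' h2.
have -> : g (x s) - g (x t) - toC (s - t) * \sum_q v q * pderiv D q g (x t) =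
  (g (x s) - g (x t) - S) + (S - toC (s - t) * \sum_q v q * pderiv D q g (x t)) by ring.
apply: le_trans (ler_ncD _ _) _; rewrite [e](splitr e) mulrDl lerD //.
apply: le_trans h2 _.
apply: le_trans (_ : L * (B * `|s - t|) ^+ 2 <= _).
  by rewrite ler_wpM2l // lerXn2r ?nnegrE ?l1_ge0 ?mulr_ge0 ?xB.
rewrite exprMn mulrA expr2 mulrA ler_wpM2r //.
apply: le_trans (_ : `|s - t| * (L * B ^+ 2 + 1) <= _).
  by rewrite mulrC ler_wpM2l // lerDl.
by rewrite -ler_pdivlMr // ltW.
Qed.

Lemma mono_has_d (a b : R) (x : R -> 'cV[C R]_n) xh (v : 'I_n -> C R) (t : R) (al : seq 'I_n) :
  (forall q, has_d a b (fun s => x s q 0) t (v q)) ->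
  has_d a b (fun s => mono (x s - xh) al) t
    (splits (fun i c => v i * mono (x t - xh) c) al).
Proof.
move=> xd; elim: al => [|i al IH] /=.
  by under eq_fun do rewrite /mono big_nil; exact: has_d_cst.
have -> : (fun s => mono (x s - xh) (i :: al)) = (fun s => (x s - xh) i 0 * mono (x s - xh) al).
  by apply/funext => s; rewrite /mono big_cons.
have -> : splits (fun i' c' => v i' * mono (x t - xh) (i :: c')) al =
  (x t - xh) i 0 * splits (fun i' c' => v i' * mono (x t - xh) c') al.
  by rewrite -splitsZ; apply: eq_splits => j c _; rewrite /mono big_cons mulrCA.
apply: has_dM => //; under eq_fun do rewrite !mxE; rewrite -[v i]addr0.
by apply: has_dD; [exact: xd|exact: has_d_cst].
Qed.

Definition taylor (m : nat) g xh y : C R :=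
  \sum_(j < m.+1) \sum_(b : j.-tuple 'I_n | nondec b)
    (gamma b)%:R^-1 * pderivs D b g xh * mono (y - xh) b.

(** Differentiation lowers the degree by one and replaces [g] by its partial derivatives. In
    [sum_nondec_splits] the new index [q] is the outermost derivative, in [pderiv D q g] the
    innermost, hence the use of symmetry. *)
Lemma taylor_has_d m g xh (a b : R) (x : R -> 'cV[C R]_n) (v : 'I_n -> C R) (t : R) :
  Ck_lipschitz D m.+1 g -> D xh ->
  (forall q, has_d a b (fun s => x s q 0) t (v q)) ->
  has_d a b (fun s => taylor m.+1 g xh (x s)) t
    (\sum_q v q * taylor m (pderiv D q g) xh (x t)).
Proof.
move=> h Dxh xd.
have -> : \sum_q v q * taylor m (pderiv D q g) xh (x t) =
  \sum_(j < m.+2) \sum_(b : j.-tuple 'I_n | nondec b)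
    (gamma b)%:R^-1 * pderivs D b g xh * splits (fun i c => v i * mono (x t - xh) c) b.
  rewrite [RHS]big_ord_recl [X in _ = X + _]big1 ?add0r; last first.
    by move=> [[|i0 b0] sb] _ //=; rewrite mulr0.
  rewrite /taylor; under eq_bigr do rewrite big_distrr /=.
  rewrite exchange_big; apply: eq_bigr => j _.
  have lift0E : (lift ord0 j : nat) = j.+1 by [].
  rewrite lift0E (@sum_nondec_splits _ _ j v (fun c => pderivs D c g xh)).
    apply: eq_bigr => q _; congr (_ * _); apply: eq_bigr => c _.
    congr (_ * _ * _); rewrite pderivs_rcons; apply: (pderivs_perm h) => //.
      by rewrite size_rcons size_tuple ltn_ord.
    by rewrite perm_rcons.
  move=> a1 b1 ab sa; apply: (pderivs_perm h) => //.
  by rewrite sa ltn_ord.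
apply: has_d_sum => j _; apply: has_d_sum => c _; apply: has_dZ.
exact: mono_has_d.
Qed.

Lemma taylor0 g xh y : taylor 0 g xh y = g xh.
Proof.
rewrite /taylor big_ord_recl big_ord0 addr0.
rewrite (bigD1 [tuple]) //= big1 ?addr0 => [|b]; last by case/andP => _ /eqP; case; exact: tuple0.
rewrite /gamma /mono big_nil big1 // invr1 mul1r mulr1 //.
Qed.

Lemma taylor_center m g xh : taylor m g xh xh = g xh.
Proof.
rewrite /taylor big_ord_recl [X in _ + X]big1 ?addr0 => [|j _].
  by rewrite -[RHS](taylor0 g xh xh) /taylor big_ord_recl big_ord0 addr0.
apply: big1 => -[[//|i b] sb] _; rewrite /mono big_cons subrr mxE mul0r mulr0 //.
Qed.

(** Induction on [m]. On the segment from [xh] to [y] the remainder starts at zero, and its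
    derivative combines the remainders of degree [m] of the partial derivatives. The base case is
    the Lipschitz bound, so order m + 1 is reached with [m] derivatives. *)
Lemma taylor_bound m g : Ck_lipschitz D m g -> exists2 B : R, 0 <= B &
  forall xh y, D xh -> D y -> nc (g y - taylor m g xh y) <= B * l1 (y - xh) ^+ m.+1.
Proof.
elim: m g => [|m IH] g h.
  have [L L0 hL] := Ck_lip (a := [::]) h isT; exists L => // xh y Dxh Dy.
  by rewrite taylor0 expr1; exact: hL.
have /choice [B hB] : forall q, exists B : R, 0 <= B /\ forall xh y, D xh -> D y ->
   nc (pderiv D q g y - taylor m (pderiv D q g) xh y) <= B * l1 (y - xh) ^+ m.+1.
  by move=> q; have [B B0 hB] := IH _ (Ck_pderiv q h); exists B.
exists (\sum_q B q) => [|xh y Dxh Dy]; first by apply: sumr_ge0 => q _; case: (hB q).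
pose x (t : R) := xh + toC t *: (y - xh).
have Dx t : 0 <= t <= 1 -> D (x t).
  by move=> t01; have [_ + _] := Dbox; apply.
have xd t q : has_d 0 1 (fun s => x s q 0) t ((y - xh) q 0).
  have -> : (fun s => x s q 0) = (fun s => xh q 0 + (y - xh) q 0 * toC s).
    by apply/funext => s; rewrite /x !mxE mulrC.
  rewrite -[X in has_d _ _ _ _ X]add0r; apply: has_dD; first exact: has_d_cst.
  exact: has_d_lin.
have := @complex_mvi _ 0 1 (fun t => g (x t) - taylor m.+1 g xh (x t))
  (fun t => \sum_q (y - xh) q 0 * pderiv D q g (x t) - \sum_q (y - xh) q 0 * taylor m (pderiv D q g) xh (x t))
  ((\sum_q B q) * l1 (y - xh) ^+ m.+2) ler01.
have -> : x 1 = y by rewrite /x toC1 scale1r addrC subrK.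
have -> : x 0 = xh by rewrite /x toC0 scale0r addr0.
rewrite taylor_center subrr !subr0 mulr1; apply.
  move=> t t01; apply: has_dB; last exact: taylor_has_d.
  by apply: chain_rule => //; apply: Ck_le h.
move=> t t01; rewrite -sumrB; apply: le_trans (ler_nc_sum _ _ _) _.
rewrite mulr_suml; apply: ler_sum => q _.
rewrite -mulrBr ncM exprS mulrCA; apply: ler_pM; rewrite ?nc_ge0 ?nc_le_l1 //.
apply: le_trans ((hB q).2 _ _ Dxh (Dx t t01)) _.
apply: ler_wpM2l; first by case: (hB q).
apply: lerXn2r; rewrite ?nnegrE ?l1_ge0 //.
rewrite /x addrC addKr l1Z nc_toC ler_piMl ?l1_ge0 // ger0_norm; lra.
Qed.

Lemma taylor_remainder_has_d m g xh (a b : R) (x : R -> 'cV[C R]_n) (v : 'I_n -> C R) (t : R) :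
  Ck_lipschitz D m.+1 g -> D xh -> a <= t <= b -> (forall s, a <= s <= b -> D (x s)) ->
  (forall q, has_d a b (fun s => x s q 0) t (v q)) ->
  has_d a b (fun s => g (x s) - taylor m.+1 g xh (x s)) t
    (\sum_q v q * (pderiv D q g (x t) - taylor m (pderiv D q g) xh (x t))).
Proof.
move=> h Dxh tab Dx xd; under eq_bigr do rewrite mulrBr.
rewrite sumrB; apply: has_dB; last exact: taylor_has_d.
by apply: chain_rule => //; apply: Ck_le h.
Qed.
End PartialDerivativeCalculus.

(** * Gronwall estimates that do not see imaginary frequencies *)

Section OscillatoryGronwall.
Context {R : realType}.

Lemma reC_imag_norm (om z : C R) : reC om = 0 -> reC (om * (z * cj z)) = 0.
Proof. by move=> om0; rewrite mul_cj reCM om0 imC_toC mul0r mulr0 subrr. Qed.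

(** Multiplication by [expR (- K * t)] turns the hypothesis into a nonpositive derivative. *)
Lemma gronwall_decay (h K : R) (f : R -> C R) (l : R -> C R) : 0 <= h ->
  (forall s, 0 <= s <= h -> has_d 0 h f s (l s)) ->
  (forall s, 0 <= s <= h -> reC (l s) <= K * reC (f s)) ->
  forall s, 0 <= s <= h -> reC (f s) <= expR (K * s) * reC (f 0).
Proof.
move=> h0 fd lK s /andP[s0 sh].
pose g (t : R) := toC (expR (- K * t)) * f t.
have dexp (t : R) : is_derive t 1 (fun t : R => expR (- K * t)) (- K * expR (- K * t)).
  have : is_derive t 1 (expR \o (fun t : R => - K * t)) (- K * expR (- K * t)).
    by apply: is_derive_eq; rewrite /GRing.scale /=; ring.
  exact.
have gd t : 0 <= t <= s -> has_d 0 s g t (toC (- K * expR (- K * t)) * f t + toC (expR (- K * t)) * l t).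
  move=> /andP[t0 ts]; apply: has_dM; first by apply: has_d_is_derive; exact: dexp.
  have th : 0 <= t <= h by rewrite t0 (le_trans ts).
  exact: has_d_sub (lexx 0) sh (fd t th).
have reg x (z : C R) : reC (toC x * z) = x * reC z by rewrite reCM imC_toC mul0r subr0.
have := real_mvt s0 gd (B := 0).
rewrite mul0r subr_le0 /g !reg mulr0 expR0 mul1r => H.
have {}H : expR (- K * s) * reC (f s) <= reC (f 0).
  apply: H => t /andP[t0 ts].
  rewrite reCD !reg; have -> : forall a b c : R, - K * a * b + a * c = a * (c - K * b) by move=> *; ring.
  rewrite mulr_ge0_le0 ?expR_ge0 // subr_le0.
  by apply: lK; rewrite t0 (le_trans ts).
rewrite -(ler_pM2l (expR_gt0 (- K * s))) mulrA -expRD mulNr addNr expR0 mul1r.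
by rewrite -mulNr.
Qed.

(** Imaginary frequencies drop out of the derivative of the sum of squares, so [K2] does not depend
    on them, nor on eps. Adding the constant rho^2 to the sum absorbs the inhomogeneous term and
    gives the homogeneous inequality f' <= 3 m K f. *)
Lemma gronwall_family (I : finType) (T K : R) : 0 <= T -> 0 <= K ->
  exists2 K2 : R, 0 <= K2 & forall (h rho z : R) (eta G : I -> R -> C R) (om : I -> C R),
  0 <= h <= T -> 0 <= rho <= z -> (forall i, reC (om i) = 0) ->
  (forall i s, 0 <= s <= h -> has_d 0 h (eta i) s (om i * eta i s + G i s)) ->
  (forall s E, 0 <= s <= h -> (forall i, nc (eta i s) <= E) -> forall i, nc (G i s) <= K * (E + rho)) ->
  (forall i, nc (eta i 0) <= z) ->
  forall i s, 0 <= s <= h -> nc (eta i s) <= K2 * z.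
Proof.
move=> T0 K0; pose m : R := #|I|%:R; have m0 : 0 <= m by [].
pose X := expR (3 * m * K * T).
(* [X] bounds the growth over [[0, T]]; the factor [m + 1] comes from f(0) <= m z^2 + rho^2 and rho
   <= z. *)
exists (Num.sqrt (X * (m + 1))); first exact: sqrtr_ge0.
move=> h rho z eta G om /andP[h0 hT] /andP[rho0 rz] om0 etad GE eta0 i0 s0 s0h.
have z0 : 0 <= z by exact: le_trans rz.
pose f (s : R) : C R := \sum_i eta i s * cj (eta i s) + toC (rho ^+ 2).
pose l (s : R) : C R := \sum_i ((om i * eta i s + G i s) * cj (eta i s) + eta i s * cj (om i * eta i s + G i s)) + 0.
have fd s : 0 <= s <= h -> has_d 0 h f s (l s).
  move=> sh; apply: has_dD; last exact: has_d_cst.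
  by apply: has_d_sum => i _; apply: has_dM; [exact: etad|apply: has_d_cj; exact: etad].
pose Phi s := \sum_i nc (eta i s) ^+ 2.
have Phi0 s : 0 <= Phi s by apply: sumr_ge0 => i _; exact: sqr_ge0.
have fE s : reC (f s) = Phi s + rho ^+ 2.
  rewrite /f reCD reC_toC; congr (_ + _).
  by rewrite -[RHS]reC_toC toC_sum; congr reC; apply: eq_bigr => i _; rewrite mul_cj.
have lE s : 0 <= s <= h -> reC (l s) <= 3 * m * K * reC (f s).
  move=> sh; rewrite /l addr0 (big_morph (@reC R) reCD (reC_toC 0)) fE.
  pose E := Num.sqrt (Phi s).
  have E0 : 0 <= E by exact: sqrtr_ge0.
  have EE : E ^+ 2 = Phi s by rewrite sqr_sqrtr.
  have etaE i : nc (eta i s) <= E.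
    rewrite -[leLHS]ger0_norm ?nc_ge0 // -sqrtr_sqr ler_wsqrtr // /Phi (bigD1 i) //= lerDl.
    by apply: sumr_ge0 => j _; exact: sqr_ge0.
  apply: le_trans (_ : \sum_(i : I) 3 * K * (E ^+ 2 + rho ^+ 2) <= _); last first.
    rewrite sumr_const -mulr_natl -/m EE.
    by rewrite le_eqVlt; apply/orP; left; apply/eqP; ring.
  apply: ler_sum => i _.
  have -> : reC ((om i * eta i s + G i s) * cj (eta i s) + eta i s * cj (om i * eta i s + G i s)) =
    2 * reC (G i s * cj (eta i s)).
    have cjre (x : C R) : reC (cj x) = reC x by case: x.
    have -> : eta i s * cj (om i * eta i s + G i s) = cj ((om i * eta i s + G i s) * cj (eta i s)).
      by rewrite [RHS]cjM mulrC; congr (_ * _); rewrite /cj conjcK.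
    rewrite reCD cjre mulrDl reCD -mulrA reC_imag_norm // add0r; ring.
  apply: le_trans (_ : 2 * (E * (K * (E + rho))) <= _).
    rewrite ler_wpM2l //; apply: le_trans (ler_norm _) _; apply: le_trans (reC_le _) _.
    by rewrite ncM nc_cj mulrC ler_pM ?nc_ge0 ?etaE //; exact: GE.
  have -> : 2 * (E * (K * (E + rho))) = K * (2 * E ^+ 2 + 2 * (E * rho)) by ring.
  have -> : 3 * K * (E ^+ 2 + rho ^+ 2) = K * (3 * (E ^+ 2 + rho ^+ 2)) by ring.
  rewrite ler_wpM2l //.
  (* What is used is 2 E rho <= E^2 + rho^2. *)
  have := sqr_ge0 (E - rho); have := sqr_ge0 E; have := sqr_ge0 rho.
  rewrite !expr2; nra.
have H := gronwall_decay h0 fd lE s0h.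
have : nc (eta i0 s0) ^+ 2 <= X * (m + 1) * z ^+ 2.
  apply: le_trans (_ : Phi s0 + rho ^+ 2 <= _).
    rewrite /Phi (bigD1 i0) //= -addrA lerDl addr_ge0 ?sqr_ge0 //.
    by apply: sumr_ge0 => j _; exact: sqr_ge0.
  rewrite -fE; apply: le_trans H _; rewrite -[leRHS]mulrA; apply: ler_pM.
  - exact: expR_ge0.
  - by rewrite fE addr_ge0 ?sqr_ge0.
  - rewrite /X ler_expR ler_wpM2l ?mulr_ge0 //; case/andP: s0h => _ sh.
    exact: le_trans hT.
  - rewrite fE mulrDl mul1r lerD //; last by rewrite lerXn2r ?nnegrE.
    rewrite /m mulr_natl -sumr_const; apply: ler_sum => i _.
    by rewrite lerXn2r ?nnegrE ?nc_ge0.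
have X0 : 0 <= X * (m + 1) by rewrite mulr_ge0 ?expR_ge0 // addr_ge0.
move=> /ler_wsqrtr; rewrite sqrtr_sqr ger0_norm ?nc_ge0 // sqrtrM // sqrtr_sqr.
by rewrite [`|z|]ger0_norm.
Qed.

(** Here the initial value enters with factor exactly 1, as a recursion over many steps requires.
    The oscillation is removed by a factor of modulus one instead of by an energy estimate. *)
Lemma phase_bound (h M : R) (eta G : R -> C R) (om : C R) : 0 <= h -> reC om = 0 ->
  (forall s, 0 <= s <= h -> has_d 0 h eta s (om * eta s + G s)) ->
  (forall s, 0 <= s <= h -> nc (G s) <= M) ->
  nc (eta h) <= nc (eta 0) + M * h.
Proof.
move=> h0 om0 etad GM; pose th := - imC om.
have omE : om = - ('i * toC th).
  by rewrite {1}(reim om) om0 toC0 add0r /th toCN mulrN opprK.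
(* [ph s] is exp(- om s), because om = - i th. *)
pose ph (s : R) : C R := toC (cos (th * s)) + 'i * toC (sin (th * s)).
have i2 : 'i * 'i = -1 :> C R by rewrite -expr2 sqrCi.
have dcos (t : R) : is_derive t 1 (fun t : R => cos (th * t)) (- th * sin (th * t)).
  have : is_derive t 1 (cos \o (fun t : R => th * t)) (- th * sin (th * t)).
    by apply: is_derive_eq; rewrite /GRing.scale /=; ring.
  exact.
have dsin (t : R) : is_derive t 1 (fun t : R => sin (th * t)) (th * cos (th * t)).
  have : is_derive t 1 (sin \o (fun t : R => th * t)) (th * cos (th * t)).
    by apply: is_derive_eq; rewrite /GRing.scale /=; ring.
  exact.
have phd s : has_d 0 h ph s ('i * toC th * ph s).
  have -> : 'i * toC th * ph s = toC (- th * sin (th * s)) + 'i * toC (th * cos (th * s)).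
    rewrite /ph !toCM toCN.
    have -> : forall a b c : C R, 'i * a * (b + 'i * c) = 'i * 'i * (a * c) + 'i * (a * b) by move=> *; ring.
    by rewrite i2; ring.
  apply: has_dD; last apply: has_dZ.
  - by apply: has_d_is_derive; exact: dcos.
  - by apply: has_d_is_derive; exact: dsin.
have nph s : nc (ph s) = 1.
  apply: (@pexpIrn _ 2) => //; rewrite ?nnegrE ?nc_ge0 //.
  apply: toC_inj; rewrite -mul_cj expr1n toC1 /ph.
  have cji : cj ('i : C R) = - 'i by rewrite /cj; apply/eqP; rewrite eq_complex /= oppr0 !eqxx.
  have cjD (x y : C R) : cj (x + y) = cj x + cj y by rewrite /cj rmorphD.
  rewrite cjD cjM !cj_toC cji.
  have -> : forall a b : C R, (a + 'i * b) * (a + - 'i * b) = a * a - 'i * 'i * (b * b) by move=> *; ring.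
  by rewrite i2 mulN1r opprK -!toCM -toCD -!expr2 cos2Dsin2.
have d s : 0 <= s <= h -> has_d 0 h (fun s => ph s * eta s) s (ph s * G s).
  move=> sh; have := has_dM (phd s) (etad s sh).
  suff -> : ph s * G s = 'i * toC th * ph s * eta s + ph s * (om * eta s + G s) by [].
  by rewrite [X in _ = _ + _ * (X * _ + _)]omE; ring.
have := complex_mvi h0 d (B := M).
move=> H; have {}H : nc (ph h * eta h - ph 0 * eta 0) <= M * (h - 0).
  by apply: H => s sh; rewrite ncM nph mul1r GM.
rewrite -(mul1r (nc (eta h))) -(nph h) -ncM -(mul1r (nc (eta 0))) -(nph 0) -ncM.
rewrite -[X in nc X <= _](subrK (ph 0 * eta 0)) (le_trans (ler_ncD _ _)) // addrC lerD2l.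
by rewrite subr0 in H.
Qed.
End OscillatoryGronwall.

(** * Tensor powers of a linear map and diagonalization of derivations *)

Section TensorCoordinates.
Context {R : realType} {n : nat}.
Implicit Types (P Q A : 'M[C R]_n) (Y : seq 'I_n -> C R) (a b c : seq 'I_n).

(* The derivation extending A to tensors. *)
Fixpoint lsum A Y a : C R :=
  if a is i :: c then \sum_m A i m * Y (m :: c) + lsum A (fun c' => Y (i :: c')) c
  else 0.

(* The action of P on every tensor factor. *)
Fixpoint tr P Y b : C R :=
  if b is i :: c then \sum_j P i j * tr P (fun a => Y (j :: a)) c else Y [::].

Lemma splits_lsum A Y : perm_inv Y ->
  forall a, splits (fun i c => \sum_m A i m * Y (m :: c)) a = lsum A Y a.
Proof.
move=> pY a; elim: a Y pY => [//|i a IH] Y pY /=; congr (_ + _).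
rewrite -IH; last exact: perm_inv_cons.
apply: eq_splits => j c _; apply: eq_bigr => m _; congr (_ * _).
by apply: pY; rewrite (perm_catCA [:: m] [:: i] c).
Qed.

Lemma trD P Y Y' b : tr P (fun a => Y a + Y' a) b = tr P Y b + tr P Y' b.
Proof.
elim: b Y Y' => [//|i b IH] Y Y' /=; rewrite -big_split; apply: eq_bigr => j _.
by rewrite IH mulrDr.
Qed.

Lemma trZ P (z : C R) Y b : tr P (fun a => z * Y a) b = z * tr P Y b.
Proof.
elim: b Y => [//|i b IH] Y /=; rewrite mulr_sumr; apply: eq_bigr => j _.
by rewrite IH mulrCA.
Qed.

Lemma tr_sum P (I : Type) (r : seq I) (F : I -> seq 'I_n -> C R) b :
  tr P (fun a => \sum_(i <- r) F i a) b = \sum_(i <- r) tr P (F i) b.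
Proof.
elim: b F => [//|i b IH] F /=; rewrite exchange_big /=; apply: eq_bigr => j _.
by rewrite IH mulr_sumr.
Qed.

(** The rows of [P] are left eigenvectors of [A], so in each tensor factor [A] becomes
    multiplication by an eigenvalue, and these eigenvalues add up. *)
Lemma tr_lsum P A (lam : 'I_n -> C R) Y b :
  (forall i m, \sum_j P i j * A j m = lam i * P i m) ->
  tr P (lsum A Y) b = (\sum_(i <- b) lam i) * tr P Y b.
Proof.
move=> PA; elim: b Y => [|i b IH] Y /=; first by rewrite big_nil mul0r.
rewrite big_cons mulrDl.
under eq_bigr do rewrite trD tr_sum IH mulrDr mulr_sumr.
rewrite big_split /=; congr (_ + _); last first.
  by rewrite mulr_sumr; apply: eq_bigr => j _; rewrite mulrCA.
rewrite exchange_big /= mulr_sumr; apply: eq_bigr => m _.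
under eq_bigr do rewrite trZ mulrA.
by rewrite -mulr_suml PA mulrA.
Qed.

Lemma tr_inv P Q Y a : Q *m P = 1%:M -> tr Q (tr P Y) a = Y a.
Proof.
move=> QP; elim: a Y => [//|i a IH] Y /=.
transitivity (\sum_m (Q *m P) i m * Y (m :: a)).
  under [RHS]eq_bigr do rewrite mxE mulr_suml.
  rewrite exchange_big; apply: eq_bigr => j _ /=.
  by rewrite tr_sum mulr_sumr; apply: eq_bigr => m _; rewrite trZ IH mulrA.
rewrite QP (bigD1 i) //= mxE eqxx mul1r big1 ?addr0 // => m mi.
by rewrite mxE eq_sym (negbTE mi) mul0r.
Qed.

Lemma tr_has_d P (u v t : R) (Y : R -> seq 'I_n -> C R) dY b :
  (forall a, size a = size b -> has_d u v (fun s => Y s a) t (dY a)) ->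
  has_d u v (fun s => tr P (Y s) b) t (tr P dY b).
Proof.
elim: b Y dY => [|i b IH] Y dY h /=; first exact: h.
by apply: has_d_sum => j _; apply: has_dZ; apply: IH => a sa; apply: h; rewrite /= sa.
Qed.

(** The summand 1 makes the powers nondecreasing, so that the exponent [k] covers all tuples of
    length at most [k]. *)
Definition mx1 P : R := 1 + \sum_i \sum_j nc (P i j).

Lemma mx1_ge1 P : 1 <= mx1 P.
Proof. by rewrite lerDl; apply: sumr_ge0 => i _; apply: sumr_ge0 => j _; exact: nc_ge0. Qed.

Lemma mx1_row P i : \sum_j nc (P i j) <= mx1 P.
Proof.
rewrite /mx1 [X in _ <= _ + X](bigD1 i) //= addrCA lerDl addr_ge0 //.
by apply: sumr_ge0 => l _; apply: sumr_ge0 => j _; exact: nc_ge0.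
Qed.

(** [P] does not mix the u-indices with the time index, so [tr P Y b] involves only tuples with the
    same positions of u-indices as [b]. Thus a bound known only for certain numbers of u-indices
    survives the change of coordinates. *)
Lemma tr_bound_pattern (isu : pred 'I_n) P k Y b (B : R) : 0 <= B ->
  (forall i j, isu i != isu j -> P i j = 0) -> (size b <= k)%N ->
  (forall a, map isu a = map isu b -> nc (Y a) <= B) ->
  nc (tr P Y b) <= mx1 P ^+ k * B.
Proof.
move=> B0 Pi bk h; apply: le_trans (_ : mx1 P ^+ size b * B <= _); last first.
  by rewrite ler_wpM2r // ler_weXn2l // mx1_ge1.
elim: b Y {bk} h => [|i b IH] Y h /=; first by rewrite mul1r h.
have p0 : 0 <= mx1 P by apply: le_trans (mx1_ge1 P).
apply: le_trans (ler_nc_sum _ _ _) _.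
rewrite exprS -mulrA; apply: le_trans (_ : (\sum_j nc (P i j)) * (mx1 P ^+ size b * B) <= _).
  rewrite mulr_suml; apply: ler_sum => j _; rewrite ncM.
  have [ij|ij] := eqVneq (isu i) (isu j).
    by rewrite ler_wpM2l ?nc_ge0 //; apply: IH => a sa; apply: h; rewrite /= sa ij.
  by rewrite Pi // nc0 !mul0r.
by rewrite ler_wpM2r ?mx1_row // mulr_ge0 // exprn_ge0.
Qed.

Lemma tr_bound P k Y b (B : R) : 0 <= B -> (size b <= k)%N ->
  (forall a, (size a <= k)%N -> nc (Y a) <= B) -> nc (tr P Y b) <= mx1 P ^+ k * B.
Proof.
move=> B0 bk h; apply: (@tr_bound_pattern predT) => // a ab; apply: h.
by move/(congr1 size): ab; rewrite !size_map => ->.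
Qed.
End TensorCoordinates.

(** * The error of the lifted linear system, uniformly in eps *)

Section LiftedBound.
Context {R : realType} {n : nat}.
Context (P Q A : 'M[C R]_n) (lam : 'I_n -> C R) (isu : pred 'I_n).
Context (QP : Q *m P = 1%:M).
Context (Ppat : forall i j, isu i != isu j -> P i j = 0).
Context (PA : forall i m, \sum_j P i j * A j m = lam i * P i m).
Context (lam_im : forall i, reC (lam i) = 0).
Context (lam_u : forall i, isu i -> lam i != 0).
Context (lam_t : forall i, ~~ isu i -> lam i = 0).

Let om (b : seq 'I_n) : C R := \sum_(i <- b) lam i.
(** The zero eigenvalue contributes nothing, as its inverse is 0 by convention. *)
Let Lam : R := \sum_i nc (lam i)^-1.

Lemma Lam_ge0 : 0 <= Lam.
Proof. by apply: sumr_ge0 => i _; exact: nc_ge0. Qed.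

Lemma om_im b : reC (om b) = 0.
Proof. by rewrite /om (big_morph (@reC R) reCD (reC_toC 0)) big1. Qed.

Lemma om0 b : count isu b = 0%N -> om b = 0.
Proof.
rewrite /om; elim: b => [|i b IH] /=; first by rewrite big_nil.
case: (boolP (isu i)) => // iu; rewrite add0n => /IH; rewrite big_cons => ->.
by rewrite lam_t // addr0.
Qed.

Lemma om1 b : count isu b = 1%N -> om b != 0 /\ nc (om b)^-1 <= Lam.
Proof.
suff : count isu b = 1%N -> exists2 i, isu i & om b = lam i.
  move=> H /H [i iu ->]; split; first exact: lam_u.
  by rewrite /Lam (bigD1 i) //= lerDl; apply: sumr_ge0 => j _; exact: nc_ge0.
elim: b => [//|i b IH] /=; rewrite /om big_cons; case: (boolP (isu i)) => iu.
  rewrite add1n => -[b0]; exists i => //.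
  by have := om0 b0; rewrite /om => ->; rewrite addr0.
by rewrite add0n => /IH [j ju]; rewrite /om => ->; exists j => //; rewrite lam_t // add0r.
Qed.

(* Along the eigendirections with exactly one oscillating factor the remainder
   is traded, at the price of a factor eps, for its derivative. *)
Lemma lifted_bound k (T B : R) : 0 <= T -> 0 <= B ->
  exists2 K : R, 0 <= K &
  forall (eps h kap e0 : R) (dlt g rem drem : R -> seq 'I_n -> C R),
  0 < eps <= 1 -> 0 <= h <= T -> 0 <= kap -> 0 <= e0 ->
  (forall a s, (size a <= k)%N -> 0 <= s <= h ->
     has_d 0 h (dlt^~ a) s (toC eps^-1 * lsum A (dlt s) a + g s a + rem s a)) ->
  (forall s M, 0 <= s <= h -> (forall a, (size a <= k)%N -> nc (dlt s a) <= M) ->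
     forall a, (size a <= k)%N -> nc (g s a) <= B * M) ->
  (forall a s, (size a <= k)%N -> 0 <= s <= h -> has_d 0 h (rem^~ a) s (drem s a)) ->
  (forall a s, (size a <= k)%N -> 0 <= s <= h -> nc (rem s a) <= kap * h) ->
  (forall a s, (size a <= k)%N -> 0 <= s <= h -> nc (drem s a) <= kap) ->
  (forall a s, (size a <= k)%N -> 0 <= s <= h -> count isu a != 1%N ->
     nc (rem s a) <= eps * kap) ->
  (forall a, (size a <= k)%N -> nc (dlt 0 a) <= B * e0) ->
  forall i, (0 < k)%N ->
    nc (tr P (dlt h) [:: i]) <= nc (tr P (dlt 0) [:: i]) + K * h * (e0 + eps * kap).
Proof.
move=> T0 B0.
pose W := mx1 P ^+ k; pose V := mx1 Q ^+ k.
have W0 : 0 <= W by rewrite exprn_ge0 // (le_trans ler01) // mx1_ge1.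
have V0 : 0 <= V by rewrite exprn_ge0 // (le_trans ler01) // mx1_ge1.
have L0 := Lam_ge0.
(* The first summand bounds the lower-order terms [g], expressed through [eta] by way of [Q]; the
   second bounds what is left of the remainder and the derivative [dcorr]. *)
pose K1 := W * B * V * (1 + Lam * W * T) + W * (1 + Lam).
have K10 : 0 <= K1 by rewrite addr_ge0 ?mulr_ge0 // addr_ge0 ?mulr_ge0.
(* All tuples of length at most [k], the finite family of the Gronwall estimate. *)
pose I : finType := {j : 'I_k.+1 & (j : nat).-tuple 'I_n}.
have [K2 K20 gron] := @gronwall_family R I T K1 T0 K10.
pose Z := W * B + Lam * W * T + 1.
have Z0 : 0 <= Z by rewrite !addr_ge0 ?mulr_ge0.
(* The first term pays for [corr] at both ends of the step, where it already carries a factor [h];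
   the second is the bound on [G], integrated over the step. *)
exists (2 * Lam * W + K1 * (K2 * Z + 1)).
  by rewrite addr_ge0 ?mulr_ge0 // addr_ge0 ?mulr_ge0.
move=> eps h kap e0 dlt g rem drem /andP[eps0 eps1] /andP[h0 hT] kap0 e00 dltd gB remd remB dremB remU dlt0 i0 k0.
have eps0' : 0 <= eps by exact: ltW.
pose rho := eps * kap; have rho0 : 0 <= rho by rewrite mulr_ge0.
(* Multiplied by om / eps, the correction is minus the remainder. Subtracting it from the error thus
   cancels the remainder in the equation, and only its derivative, with the factor eps / om, comes
   in. *)
pose corr s b : C R := if count isu b == 1%N then - (toC eps / om b) * tr P (rem s) b else 0.
pose dcorr s b : C R := if count isu b == 1%N then - (toC eps / om b) * tr P (drem s) b else 0.
pose eta s b : C R := tr P (dlt s) b - corr s b.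
pose G s b : C R := tr P (g s) b + (if count isu b == 1%N then 0 else tr P (rem s) b) - dcorr s b.
have epsn0 : toC eps != 0 by rewrite toC_eq0 gt_eqF.
have ncf b : count isu b = 1%N -> nc (- (toC eps / om b)) <= eps * Lam.
  move=> b1; rewrite ncN ncM nc_toC [`|eps|]ger0_norm ?(ltW eps0) // ler_wpM2l ?(ltW eps0) //.
  by case: (om1 b1).
have corrB b s : (size b <= k)%N -> 0 <= s <= h -> nc (corr s b) <= Lam * W * h * rho.
  move=> bk sh; rewrite /corr; case: eqP => [b1|_]; last by rewrite nc0 !mulr_ge0.
  rewrite ncM; apply: le_trans (_ : eps * Lam * (W * (kap * h)) <= _).
    apply: ler_pM; rewrite ?nc_ge0 ?ncf //; apply: tr_bound => //.
      by rewrite mulr_ge0.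
    by move=> a ak; apply: remB.
  by rewrite le_eqVlt /rho; apply/orP; left; apply/eqP; ring.
have corrBT b s : (size b <= k)%N -> 0 <= s <= h -> nc (corr s b) <= Lam * W * T * rho.
  move=> bk sh; apply: le_trans (corrB b s bk sh) _.
  by rewrite ler_wpM2r // ler_wpM2l // mulr_ge0.
have dcorrB b s : (size b <= k)%N -> 0 <= s <= h -> nc (dcorr s b) <= Lam * W * rho.
  move=> bk sh; rewrite /dcorr; case: eqP => [b1|_]; last by rewrite nc0 !mulr_ge0.
  rewrite ncM; apply: le_trans (_ : eps * Lam * (W * kap) <= _).
    apply: ler_pM; rewrite ?nc_ge0 ?ncf //; apply: tr_bound => //.
    by move=> a ak; apply: dremB.
  by rewrite le_eqVlt /rho; apply/orP; left; apply/eqP; ring.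
have etad b s : (size b <= k)%N -> 0 <= s <= h ->
    has_d 0 h (eta^~ b) s (toC eps^-1 * om b * eta s b + G s b).
  move=> bk sh.
  have tdlt : has_d 0 h (fun s => tr P (dlt s) b) s
      (toC eps^-1 * (om b * tr P (dlt s) b) + tr P (g s) b + tr P (rem s) b).
    rewrite -(tr_lsum _ _ PA) -trZ -!trD; apply: tr_has_d => a ab; apply: dltd => //.
    by rewrite ab.
  have trem : has_d 0 h (fun s => tr P (rem s) b) s (tr P (drem s) b).
    by apply: tr_has_d => a ab; apply: remd; rewrite ?ab.
  have -> : toC eps^-1 * om b * eta s b + G s b =
    (toC eps^-1 * (om b * tr P (dlt s) b) + tr P (g s) b + tr P (rem s) b) - dcorr s b.
    rewrite /eta /G /corr; case: eqP => [b1|_]; last by ring.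
    have [ob _] := om1 b1; rewrite toCV; field.
    by rewrite epsn0 ob.
  rewrite /eta; apply: has_dB => //; rewrite /corr /dcorr.
  case: eqP => _; last exact: has_d_cst.
  exact: has_dZ.
have dltE s E : 0 <= s <= h -> (forall b, (size b <= k)%N -> nc (eta s b) <= E) ->
    forall a, (size a <= k)%N -> nc (dlt s a) <= V * (E + Lam * W * T * rho).
  move=> sh hE a ak; rewrite -(tr_inv _ _ QP); apply: tr_bound => //.
    rewrite addr_ge0 ?mulr_ge0 //; apply: le_trans (nc_ge0 _) (hE [::] _) => //.
  move=> b bk; have -> : tr P (dlt s) b = eta s b + corr s b by rewrite /eta subrK.
  by apply: le_trans (ler_ncD _ _) _; rewrite lerD ?hE ?corrBT.
have GE s E : 0 <= s <= h -> (forall b, (size b <= k)%N -> nc (eta s b) <= E) ->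
    forall b, (size b <= k)%N -> nc (G s b) <= K1 * (E + rho).
  move=> sh hE b bk.
  have E0 : 0 <= E by apply: le_trans (nc_ge0 _) (hE [::] _).
  have M0 : 0 <= V * (E + Lam * W * T * rho) by rewrite mulr_ge0 // addr_ge0 ?mulr_ge0.
  have trg : nc (tr P (g s) b) <= W * (B * (V * (E + Lam * W * T * rho))).
    apply: tr_bound => //; first by rewrite mulr_ge0.
    move=> a ak; apply: gB => //; exact: dltE.
  have trr : nc (if count isu b == 1%N then 0 else tr P (rem s) b) <= W * rho.
    case: eqP => [_|/eqP b1]; first by rewrite nc0 mulr_ge0.
    apply: (@tr_bound_pattern _ _ isu) => // a ab; apply: remU => //.
      by move/(congr1 size): ab; rewrite !size_map => ->.
    suff -> : count isu a = count isu b by [].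
    by have := congr1 (count id) ab; rewrite !count_map.
  apply: le_trans (ler_ncB _ _) _; apply: le_trans (lerD (ler_ncD _ _) (dcorrB b s bk sh)) _.
  apply: le_trans (lerD (lerD trg trr) (lexx _)) _.
  have -> : W * (B * (V * (E + Lam * W * T * rho))) + W * rho + Lam * W * rho =
    W * B * V * (E + Lam * W * T * rho) + W * (1 + Lam) * rho by ring.
  rewrite /K1 [leRHS]mulrDl; apply: lerD; last by rewrite ler_wpM2l ?mulr_ge0 ?addr_ge0 // lerDr.
  rewrite -[leRHS]mulrA ler_wpM2l ?mulr_ge0 //.
  have -> : (1 + Lam * W * T) * (E + rho) = (E + Lam * W * T * rho) + (Lam * W * T * E + rho) by ring.
  by rewrite lerDl addr_ge0 ?mulr_ge0.
have h0h : 0 <= (0 : R) <= h by apply/andP.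
pose z := Z * (e0 + rho).
have z00 : 0 <= e0 + rho by rewrite addr_ge0.
have eta0 b : (size b <= k)%N -> nc (eta 0 b) <= z.
  move=> bk; apply: le_trans (ler_ncB _ _) _.
  apply: le_trans (lerD (tr_bound (B := B * e0) P _ bk dlt0) (corrBT b 0 bk h0h)) _.
    by rewrite mulr_ge0.
  rewrite -/W /z /Z.
  have -> : (W * B + Lam * W * T + 1) * (e0 + rho) = (W * (B * e0) + Lam * W * T * rho) +
     (W * B * rho + Lam * W * T * e0 + (e0 + rho)) by ring.
  by rewrite lerDl !addr_ge0 ?mulr_ge0.
have rz : 0 <= rho <= z.
  rewrite rho0 /=; apply: le_trans (_ : e0 + rho <= _); first by rewrite lerDr.
  by rewrite /z -[leLHS]mul1r ler_wpM2r // /Z lerDr addr_ge0 ?mulr_ge0.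
have im0 b : reC (toC eps^-1 * om b) = 0 by rewrite reCM om_im imC_toC mulr0 mul0r subrr.
pose bs (i : I) : seq 'I_n := tval (tagged i).
have bsk i : (size (bs i) <= k)%N by rewrite /bs size_tuple -ltnS ltn_ord.
have bsE b : (size b <= k)%N -> exists i, bs i = b.
  move=> bk; have bk' : (size b < k.+1)%N by [].
  by exists (@Tagged _ (Ordinal bk') (fun j : 'I_k.+1 => (j : nat).-tuple 'I_n) (in_tuple b)).
have H : forall b s, (size b <= k)%N -> 0 <= s <= h -> nc (eta s b) <= K2 * z.
  move=> b s bk sh; have [i <-] := bsE b bk.
  apply: (gron h rho z (fun i s => eta s (bs i)) (fun i s => G s (bs i)) (fun i => toC eps^-1 * om (bs i))) => //.
  - by rewrite h0.
  - by move=> j s' s'h; apply: etad.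
  - move=> s' E s'h hE j; apply: GE => // b' b'k; have [j' <-] := bsE b' b'k; exact: hE.
  - by move=> j; apply: eta0.
have i0k : (size [:: i0] <= k)%N by [].
(* The Gronwall bound controls [G]; only now are the components of degree one estimated again, with
   factor 1 on their initial value. *)
have phb := @phase_bound _ h (K1 * (K2 * z + rho)) (eta^~ [:: i0]) (G^~ [:: i0]) _ h0 (im0 [:: i0])
  (fun s sh => etad _ _ i0k sh) (fun s sh => GE _ _ sh (fun b bk => H b s bk sh) _ i0k).
have hh : 0 <= h <= h by apply/andP.
have -> : tr P (dlt h) [:: i0] = eta h [:: i0] + corr h [:: i0] by rewrite /eta subrK.
apply: le_trans (ler_ncD _ _) _; apply: le_trans (lerD phb (corrB _ _ i0k hh)) _.
have : nc (eta 0 [:: i0]) <= nc (tr P (dlt 0) [:: i0]) + Lam * W * h * rho.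
  by apply: le_trans (ler_ncB _ _) _; rewrite lerD2l corrB.
have r1 : rho <= e0 + rho by rewrite lerDr.
have l1_ : Lam * W * h * rho <= Lam * W * h * (e0 + rho) by rewrite ler_wpM2l ?mulr_ge0.
have l2_ : K1 * (K2 * z + rho) * h <= K1 * (K2 * z + (e0 + rho)) * h.
  by rewrite ler_wpM2r // ler_wpM2l // lerD2l.
have -> : (2 * Lam * W + K1 * (K2 * Z + 1)) * h * (e0 + rho) =
  Lam * W * h * (e0 + rho) + Lam * W * h * (e0 + rho) + K1 * (K2 * z + (e0 + rho)) * h.
  by rewrite /z; ring.
move: l1_ l2_; clear; lra.
Qed.
End LiftedBound.

(** * The augmented domain as a product of axes *)

Section AugmentedDomain.
Context {R : realType} (K : set (C R)) (HK : scalars K) (d : nat) (T : R) (T_gt0 : 0 < T).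

Definition axis_set (q : 'I_(d + 1)) : set (C R) :=
  if (q < d)%N then K else [set z | exists2 t : R, 0 <= t <= T & z = toC t].

Lemma axis_set_u (i : 'I_d) : axis_set (lshift 1 i) = K.
Proof. by rewrite /axis_set (ltn_ord i : (lshift 1 i < d)%N). Qed.

Lemma axis_set_t (i : 'I_1) : axis_set (rshift d i) = [set z | exists2 t : R, 0 <= t <= T & z = toC t].
Proof.
have E : (rshift d i < d)%N = false by rewrite ltnNge leq_addr.
by rewrite /axis_set E.
Qed.

Lemma aug_domE (x : 'cV[C R]_(d + 1)) :
  aug_dom K T x <-> forall q, axis_set q (x q 0).
Proof.
split=> [[hu [t t0 ht]] q|h].
  case: (split_ordP q) => j ->.
    by rewrite axis_set_u; have := hu j; rewrite mxE.
  by rewrite axis_set_t; exists t => //; move: ht; rewrite mxE ord1.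
split=> [i|].
  by have := h (lshift 1 i); rewrite axis_set_u mxE.
have := h (rshift d ord0); rewrite axis_set_t => -[t t0 ht].
by exists t => //; rewrite mxE.
Qed.

Lemma axis_convex q (t : R) z w : 0 <= t <= 1 -> axis_set q z -> axis_set q w ->
  axis_set q (z + toC t * (w - z)).
Proof.
move=> /andP[t0 t1]; rewrite /axis_set; case: ifP => _.
  case: HK => -> // [a _ <-] [b _ <-]; exists (a + t * (b - a)) => //.
  by rewrite toCD toCM toCB.
move=> [a /andP[a0 aT] ->] [b /andP[b0 bT] ->]; exists (a + t * (b - a)).
  have -> : a + t * (b - a) = (1 - t) * a + t * b by ring.
  have t1' : 0 <= 1 - t by rewrite subr_ge0.
  rewrite addr_ge0 ?mulr_ge0 //=.
  have -> : T = (1 - t) * T + t * T by ring.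
  by rewrite lerD ?ler_wpM2l.
by rewrite toCD toCM toCB.
Qed.

Lemma axis_limit q z (e : R) : 0 < e -> axis_set q z ->
  exists w, [/\ w != 0, nc w < e & axis_set q (z + w)].
Proof.
move=> e0; rewrite /axis_set; case: ifP => _.
  move=> Kz; exists (toC (e / 2)); split.
  - by rewrite toC_eq0 gt_eqF // divr_gt0.
  - by rewrite nc_toC ger0_norm; lra.
  - move: Kz; case: HK => -> // [a _ <-]; exists (a + e / 2) => //.
    by rewrite toCD.
move=> [a /andP[a0 aT] ->].
pose m := Num.min (e / 2) (T / 2).
have m0 : 0 < m by rewrite lt_min !divr_gt0.
have me : m < e by rewrite gt_min; apply/orP; left; lra.
have mT : m <= T / 2 by rewrite ge_min lexx orbT.
(* From the first half of the time interval one moves forward, from the second half backward, by at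
   most [T / 2]. *)
have [aT2|aT2] := leP a (T / 2).
  exists (toC m); split.
  - by rewrite toC_eq0 gt_eqF.
  - by rewrite nc_toC ger0_norm // ltW.
  - exists (a + m); last by rewrite toCD.
    by rewrite addr_ge0 // ?(ltW m0) //=; move: aT2 mT; clear; lra.
exists (toC (- m)); split.
- by rewrite toC_eq0 oppr_eq0 gt_eqF.
- by rewrite nc_toC normrN ger0_norm // ltW.
- exists (a - m); last by rewrite toCB toCN.
  by apply/andP; split; move: aT2 mT aT (ltW m0); clear; lra.
Qed.

Lemma aug_dom_box : box_like (@aug_dom R K d T).
Proof.
split.
- move=> x y q /aug_domE Dx /aug_domE Dy; apply/aug_domE => i; rewrite !mxE eqxx andbT.
  have [->|_] := eqVneq i q; first by rewrite mulr1 addrC subrK.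
  by rewrite mulr0 addr0.
- move=> x y t t01 /aug_domE Dx /aug_domE Dy; apply/aug_domE => i; rewrite !mxE.
  exact: axis_convex.
- move=> x q e e0 /aug_domE Dx; have [w [w0 we Kw]] := axis_limit e0 (Dx q).
  exists w; split=> //; apply/aug_domE => i; rewrite !mxE eqxx andbT.
  have [->|_] := eqVneq i q; first by rewrite mulr1.
  by rewrite mulr0 addr0.
Qed.
End AugmentedDomain.

(** * Real-valued functions and constants under partial derivatives *)

Section RealValues.
Context {R : realType} {n : nat} (D : set 'cV[C R]_n) (Dbox : box_like D).

(** All points of [D] have the same imaginary part in coordinate [q], so increments and difference
    quotients are real. *)
Lemma pderiv_real g q x : D x -> has_pderiv D q g x -> (forall y, D y -> imC (x q 0) = imC (y q 0)) ->
  (forall y, D y -> imC (g y) = 0) -> imC (pderiv D q g x) = 0.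
Proof.
move=> Dx hg Dq gr; apply/eqP; rewrite -normr_le0; apply/ler_addgt0Pr => e e0.
have [dl dl0 h] := pderivP Dx hg e0.
have [_ _ /(_ x q dl dl0 Dx) [z [z0 zd Dz]]] := Dbox.
have zr : imC z = 0.
  have := Dq _ Dz; rewrite !mxE !eqxx mulr1 imCD => /eqP.
  by rewrite -subr_eq0 opprD addrA subrr sub0r oppr_eq0 => /eqP.
have := le_trans (imC_le _) (h z Dz zd).
rewrite !imCB !gr // subrr sub0r imCM zr mul0r addr0 normrN normrM.
have -> : `|reC z| = nc z by rewrite -nc_toC [in RHS](reim z) zr toC0 mulr0 addr0.
by rewrite [e * _]mulrC ler_pM2l ?nc_gt0 // add0r.
Qed.

Lemma pderivs_real k g a x : Ck_lipschitz D k g ->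
  (forall q y y', D y -> D y' -> imC (y q 0) = imC (y' q 0)) ->
  (forall y, D y -> imC (g y) = 0) -> (size a <= k)%N -> D x -> imC (pderivs D a g x) = 0.
Proof.
move=> h Dr gr; elim: a x => [|q a IH] x ak Dx; first exact: gr.
apply: pderiv_real => //; first exact: Ck_has h ak Dx.
- by move=> y Dy; exact: Dr.
- by move=> y Dy; apply: IH => //; exact: ltnW.
Qed.

(** Serves for the time component of [aug_f], which is the constant 1. *)
Lemma pderivs_cst (c : C R) a x : D x ->
  pderivs D a (fun=> c) x = if a is [::] then c else 0.
Proof.
elim: a x => [//|q a IH] x Dx /=.
pose c' : C R := if a is [::] then c else 0.
have ext y : D y -> (fun=> c') y = pderivs D a (fun=> c) y by move=> Dy; rewrite IH.
have hc : has_pderiv D q (fun=> c') x.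
  have [] // := @pderiv_eq _ _ D Dbox (fun=> c') q x 0 Dx.
  by move=> e e0; exists 1 => // z _ _ _; rewrite /diff_quot subrr mulr0 subrr nc0 ltW.
by have [_ ->] := pderiv_ext Dbox Dx ext hc; exact: pderiv_cst.
Qed.

Lemma Ck_cst k (c : C R) : Ck_lipschitz D k (fun=> c).
Proof.
move=> a sa; split.
  exists 0 => x y Dx Dy; rewrite !pderivs_cst // subrr nc0 mul0r //.
move=> _ q x Dx; pose c' : C R := if a is [::] then c else 0.
have ext y : D y -> (fun=> c') y = pderivs D a (fun=> c) y by move=> Dy; rewrite pderivs_cst.
have [] // := @pderiv_ext _ _ D Dbox (fun=> c') _ q x Dx ext.
have [] // := @pderiv_eq _ _ D Dbox (fun=> c') q x 0 Dx.
by move=> e e0; exists 1 => // z _ _ _; rewrite /diff_quot subrr mulr0 subrr nc0 ltW.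
Qed.

Lemma taylor_cst m (c : C R) xh y : D xh -> taylor D m (fun=> c) xh y = c.
Proof.
move=> Dxh; rewrite /taylor big_ord_recl [X in _ + X]big1 ?addr0 => [|j _].
  by rewrite -[RHS](taylor0 D (fun=> c) xh xh) /taylor big_ord_recl big_ord0 addr0;
     apply: eq_bigr => -[[|//] sb] _; rewrite /mono !big_nil.
by apply: big1 => -[[//|i b] sb] _; rewrite pderivs_cst // mulr0 mul0r.
Qed.
End RealValues.

(** * Vectors over sorted multi-indices as symmetric functions of tuples *)

Section LiftedScheme.
Context {R : realType} {n : nat} (k : nat) (r : seq (seq 'I_n)).
Context (k_gt0 : (0 < k)%N) (r_order : tail_order k r).
Implicit Types (y : 'cV[C R]_(mdim r)) (xh : 'cV[C R]_n) (a c : seq 'I_n).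

(** Every rearrangement of a multi-index reads the same component. Under [tail_order], tuples longer
    than [k] match no component and get the value 0. *)
Definition unsort y a : C R := \sum_j (msort a == mindex j)%:R * y j 0.

Lemma unsort_perm y : perm_inv (unsort y).
Proof. by move=> a b ab; rewrite /unsort (msort_perm ab). Qed.

Lemma mindex_inj : injective (@mindex n r).
Proof.
move=> i j ij; apply: val_inj; apply/eqP.
have ilt (l : 'I_(mdim r)) : (l < size (mindices r))%N by rewrite size_mindices ltn_ord.
by rewrite -(nth_uniq [::] (ilt i) (ilt j) (uniq_mindices r_order)); apply/eqP.
Qed.

Lemma mindex_msort a : (size a <= k)%N -> exists i : 'I_(mdim r), mindex i = msort a.
Proof.
move=> sa; have ain : msort a \in mindices r.
  by rewrite (mem_mindices k_gt0 r_order) size_sort sa nondec_msort.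
have ilt : (index (msort a) (mindices r) < mdim r)%N by rewrite -size_mindices index_mem.
by exists (Ordinal ilt); rewrite /mindex nth_index.
Qed.

Lemma unsortE y a i : mindex i = msort a -> unsort y a = y i 0.
Proof.
move=> ia; rewrite /unsort (bigD1 i) //= -ia eqxx mul1r big1 ?addr0 // => j ji.
by case: eqP => [/mindex_inj /esym E|]; rewrite ?mul0r // E eqxx in ji *.
Qed.

Lemma mindex_size (i : 'I_(mdim r)) : (size (mindex i) <= k)%N /\ nondec (mindex i).
Proof. by have := mindex_mem i; rewrite (mem_mindices k_gt0 r_order) => /andP. Qed.

Lemma lift_A_unsort (A1 : 'M[C R]_n) xh y i :
  (lift_A A1 r xh *m y) i 0 =
  splits (fun q c => \sum_m A1 q m * (unsort y (m :: c) + xh m 0 * unsort y c)) (mindex i).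
Proof.
have [si ni] := mindex_size i.
rewrite splitsE mxE (eq_bigr (fun j => \sum_(l < size (mindex i)) \sum_(m < n)
    A1 (tnth (in_tuple (mindex i)) l) m *
    ((msort (m :: chi (mindex i) l) == mindex j)%:R * y j 0 +
     xh m 0 * ((chi (mindex i) l == mindex j)%:R * y j 0)))); last first.
  move=> j _; rewrite !mxE big_distrl /=; apply: eq_bigr => l _.
  rewrite big_distrl /=; apply: eq_bigr => m _.
  by rewrite -(mulrA (A1 _ _)) mulrDl -(mulrA (xh m 0)).
rewrite exchange_big; apply: eq_bigr => l _.
rewrite exchange_big; apply: eq_bigr => m _.
rewrite -big_distrr /= big_split /= -big_distrr /=; congr (_ * (_ + _ * _)).
by rewrite /unsort msort_nondec //; exact: nondec_chi.
Qed.

Lemma lift_f_unsort D (f : 'cV[C R]_n -> 'cV[C R]_n) xh y i :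
  (lift_f D f k r xh *m y) i 0 =
  splits (fun q c => \sum_(m < (k - size c).+1) \sum_(b : m.-tuple 'I_n | nondec b)
    (gamma b)%:R^-1 * pderivs D b (fun z => f z q 0) xh * unsort y (c ++ b)) (mindex i).
Proof.
have [si ni] := mindex_size i.
rewrite splitsE mxE (eq_bigr (fun j => \sum_(l < size (mindex i))
  \sum_(m < (k - size (mindex i)).+2) \sum_(b : m.-tuple 'I_n | nondec b)
    (gamma b)%:R^-1 *
    pderivs D b (fun z => f z (tnth (in_tuple (mindex i)) l) 0) xh *
    ((msort (chi (mindex i) l ++ b) == mindex j)%:R * y j 0))); last first.
  move=> j _; rewrite !mxE big_distrl /=; apply: eq_bigr => l _.
  rewrite big_distrl /=; apply: eq_bigr => m _.
  by rewrite big_distrl /=; apply: eq_bigr => b _; rewrite -!mulrA.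
rewrite exchange_big; apply: eq_bigr => l _.
have sl : (0 < size (mindex i))%N by apply: leq_ltn_trans (ltn_ord l).
(* Removing one entry raises the admissible degree of the Taylor polynomial by one, since the
   multi-index is nonempty and of length at most [k]. *)
have -> : (k - size (chi (mindex i) l)).+1 = (k - size (mindex i)).+2.
  by rewrite size_chi; case: (size (mindex i)) sl si => // s _ sk; rewrite subnS prednK // subn_gt0.
rewrite exchange_big; apply: eq_bigr => m _.
rewrite exchange_big; apply: eq_bigr => b _.
by rewrite -big_distrr.
Qed.
End LiftedScheme.

(** * The lifted flow and the equation of its error *)

Section LiftedFlow.
Context {R : realType} {n : nat} (k : nat) (r : seq (seq 'I_n)).
Context (k_gt0 : (0 < k)%N) (r_order : tail_order k r).
Context (D : set 'cV[C R]_n) (A1 : 'M[C R]_n) (f : 'cV[C R]_n -> 'cV[C R]_n) (eps : R) (xh : 'cV[C R]_n).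
Implicit Types (a c : seq 'I_n) (Y : seq 'I_n -> C R).

Let M := toC eps^-1 *: lift_A A1 r xh + lift_f D f k r xh.

Definition lift_flow (s : R) : 'cV[C R]_(mdim r) :=
  expmx (toC s *: M) *m (col_mx 1%:M 0 : 'cV[C R]_(1 + (n + size r))).

Definition taylor_coef q (b : seq 'I_n) : C R :=
  (gamma b)%:R^-1 * pderivs D b (fun z => f z q 0) xh.

Definition lift_term Y q c : C R :=
  toC eps^-1 * (\sum_m A1 q m * (Y (m :: c) + xh m 0 * Y c)) +
  \sum_(m < (k - size c).+1) \sum_(b : m.-tuple 'I_n | nondec b) taylor_coef q b * Y (c ++ b).

Lemma lift_term_perm Y q : perm_inv Y -> perm_inv (lift_term Y q).
Proof.
move=> pY a b ab; rewrite /lift_term (perm_size ab); congr (_ * _ + _).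
  by apply: eq_bigr => m _; rewrite (pY a b ab) (pY (m :: a) (m :: b)) // perm_cons.
apply: eq_bigr => m _; apply: eq_bigr => c _; congr (_ * _).
by apply: pY; rewrite perm_cat2r.
Qed.

Lemma lift_flow_has_d a (u v t : R) : (size a <= k)%N ->
  has_d u v (fun s => unsort (lift_flow s) a) t (splits (lift_term (unsort (lift_flow t))) a).
Proof.
move=> ak; have [i ia] := mindex_msort k_gt0 r_order ak.
have -> : (fun s => unsort (lift_flow s) a) = (fun s => lift_flow s i 0).
  by apply/funext => s; rewrite (unsortE r_order _ ia).
have -> : splits (lift_term (unsort (lift_flow t))) a = (M *m lift_flow t) i 0.
  rewrite mulmxDl mxE -scalemxAl mxE (lift_A_unsort k_gt0 r_order) (lift_f_unsort k_gt0 r_order).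
  rewrite -splitsZ -splitsD ia.
  apply: splits_perm; last by rewrite perm_sym perm_msort.
  by move=> q; apply: lift_term_perm; exact: unsort_perm.
rewrite /lift_flow mulmxA mxE.
under eq_fun do rewrite mxE.
by apply: has_d_sum => j _; apply: has_dZr; exact: expmx_has_d.
Qed.

(** The initial vector e_1 lists the values of the monomials at the base point [xh] itself. *)
Lemma lift_flow0 a : (size a <= k)%N -> unsort (lift_flow 0) a = (a == [::])%:R.
Proof.
move=> ak; have [i ia] := mindex_msort k_gt0 r_order ak.
rewrite (unsortE r_order _ ia) /lift_flow expmx0 mul1mx.
case: (split_ordP i) => j iE.
  have := ia; rewrite iE col_mxEu mxE ord1 eqxx /mindex /= => E.
  by case: a {ak ia} E => // q a /(congr1 size); rewrite size_sort.
rewrite iE col_mxEd mxE; case: eqP => // a0; move: ia; rewrite a0 iE.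
have n0 : mindex (rshift 1 j : 'I_(mdim r)) != [::].
  apply/eqP => E; have E' : mindex (rshift 1 j : 'I_(mdim r)) = mindex (lshift (n + size r) ord0 : 'I_(mdim r)) by [].
  by move/(mindex_inj r_order)/eqP: E'; rewrite eq_rlshift.
by move=> E; rewrite E in n0.
Qed.

Lemma scheme_stepE (h : R) i :
  scheme_step D A1 f k r eps h xh i 0 = xh i 0 + unsort (lift_flow h) [:: i].
Proof.
rewrite /scheme_step mxE; congr (_ + _); rewrite !mxE.
pose i' : 'I_(mdim r) := rshift 1 (lshift (size r) i).
have iE : mindex i' = msort [:: i].
  rewrite /mindex /= nth_cat size_map size_enum_ord ltn_ord.
  by rewrite add0n (nth_map i) ?size_enum_ord ?ltn_ord // nth_ord_enum.
by rewrite (unsortE r_order _ iE) /lift_flow mxE.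
Qed.

(** The row of the empty tuple is zero. *)
Lemma lift_flow_nil (s : R) : 0 <= s -> unsort (lift_flow s) [::] = 1.
Proof.
move=> s0.
rewrite -[RHS](lift_flow0 (leq0n k : (size [::] <= k)%N)).
apply: (has_d0_eq (f := fun t => unsort (lift_flow t) [::]) s0) => t _.
exact: (@lift_flow_has_d [::] 0 s t (leq0n k)).
Qed.

Section Curve.
Context (h : R) (x : R -> 'cV[C R]_n).
Context (xd : forall q s, 0 <= s <= h -> has_d 0 h (fun s => x s q 0) s
  (toC eps^-1 * (\sum_m A1 q m * x s m 0) + f (x s) q 0)).

Definition lift_err (s : R) a : C R := mono (x s - xh) a - unsort (lift_flow s) a.

(** The part of the lifted matrix that stays bounded in eps, applied to the error: A_1 [xh] / eps is
    O(1) when the u-components of [xh] are O(eps). *)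
Definition lift_low (s : R) a : C R :=
  splits (fun q c => toC eps^-1 * (\sum_m A1 q m * xh m 0) * lift_err s c +
    \sum_(m < (k - size c).+1) \sum_(b : m.-tuple 'I_n | nondec b) taylor_coef q b * lift_err s (c ++ b)) a.

(** The lift keeps total degree at most [k], so next to a monomial of degree |c| the Taylor
    polynomial of [f] ends at degree k - |c|. *)
Definition lift_rem (s : R) a : C R :=
  splits (fun q c => mono (x s - xh) c *
    (f (x s) q 0 - taylor D (k - size c) (fun z => f z q 0) xh (x s))) a.

Lemma lift_err_perm s : perm_inv (lift_err s).
Proof. by move=> a b ab; rewrite /lift_err (perm_inv_mono _ ab) (unsort_perm _ ab). Qed.

(** By the Leibniz rule the exact monomials satisfy the lifted equation up to [lift_rem]. Writing
    x_m = (x_m - xh_m) + xh_m separates the derivation, which preserves the degree, from a term of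
    lower degree. *)
Lemma lift_err_has_d a s : (size a <= k)%N -> 0 <= s <= h ->
  has_d 0 h (lift_err^~ a) s (toC eps^-1 * lsum A1 (lift_err s) a + lift_low s a + lift_rem s a).
Proof.
move=> ak sh.
have -> : toC eps^-1 * lsum A1 (lift_err s) a + lift_low s a + lift_rem s a =
  splits (fun q c => (toC eps^-1 * (\sum_m A1 q m * x s m 0) + f (x s) q 0) * mono (x s - xh) c) a
  - splits (lift_term (unsort (lift_flow s))) a.
  rewrite -splits_lsum; last exact: lift_err_perm.
  rewrite -splitsZ -!splitsD -splitsB; apply: eq_splits => q c _.
  rewrite /lift_term /taylor /lift_err.
  have E1 : \sum_m A1 q m * x s m 0 * mono (x s - xh) c =
     \sum_m (A1 q m * mono (x s - xh) (m :: c) + A1 q m * xh m 0 * mono (x s - xh) c).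
    by apply: eq_bigr => m _; rewrite /mono big_cons !mxE; ring.
  have E2 : \sum_m A1 q m * (unsort (lift_flow s) (m :: c) + xh m 0 * unsort (lift_flow s) c) =
     \sum_m (A1 q m * unsort (lift_flow s) (m :: c) + A1 q m * xh m 0 * unsort (lift_flow s) c).
    by apply: eq_bigr => m _; rewrite mulrDr mulrA.
  have E3 : \sum_m A1 q m * (mono (x s - xh) (m :: c) - unsort (lift_flow s) (m :: c)) =
     \sum_m A1 q m * mono (x s - xh) (m :: c) - \sum_m A1 q m * unsort (lift_flow s) (m :: c).
    by rewrite -sumrB; apply: eq_bigr => m _; rewrite mulrBr.
  have E4 : \sum_(m < (k - size c).+1) \sum_(b : m.-tuple 'I_n | nondec b)
      taylor_coef q b * (mono (x s - xh) (c ++ b) - unsort (lift_flow s) (c ++ b)) =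
    mono (x s - xh) c * (\sum_(m < (k - size c).+1) \sum_(b : m.-tuple 'I_n | nondec b)
      (gamma b)%:R^-1 * pderivs D b (fun z => f z q 0) xh * mono (x s - xh) b) -
    \sum_(m < (k - size c).+1) \sum_(b : m.-tuple 'I_n | nondec b)
      taylor_coef q b * unsort (lift_flow s) (c ++ b).
    rewrite mulr_sumr -sumrB; apply: eq_bigr => m _.
    rewrite mulr_sumr -sumrB; apply: eq_bigr => b _.
    by rewrite /taylor_coef mono_cat; ring.
  rewrite E3 E4 E2 [in RHS]mulrDl -[in RHS]mulrA mulr_suml E1 !big_split /=.
  by rewrite -!mulr_suml; ring.
apply: has_dB; last exact: lift_flow_has_d.
by apply: mono_has_d => q; exact: xd.
Qed.
End Curve.
End LiftedFlow.

(** The sum of finitely many nonnegative constants works for all of them. *)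
Lemma finite_bound {R : realType} (I : finType) (Pr : I -> R -> Prop) :
  (forall i B B', B <= B' -> Pr i B -> Pr i B') ->
  (forall i, exists2 B, 0 <= B & Pr i B) -> exists2 B, 0 <= B & forall i, Pr i B.
Proof.
move=> mon ex; have /choice [b hb] : forall i, exists B, 0 <= B /\ Pr i B.
  by move=> i; have [B B0 PB] := ex i; exists B.
exists (\sum_i b i) => [|i]; first by apply: sumr_ge0 => i _; case: (hb i).
apply: mon (hb i).2; rewrite (bigD1 i) //= lerDl.
by apply: sumr_ge0 => j _; case: (hb j).
Qed.

(** * Size of the Taylor remainders of the lifted system *)

Section RemainderEstimates.
Context {R : realType} {n : nat} (k : nat) (D : set 'cV[C R]_n) (Dbox : box_like D).
Context (f : 'cV[C R]_n -> 'cV[C R]_n).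
Context (fCk : forall q, Ck_lipschitz D k (fun z => f z q 0)).
Implicit Types (xh y : 'cV[C R]_n) (a c : seq 'I_n) (l : R).

Lemma nc_mono_le y c l : l1 y <= l -> nc (mono y c) <= l ^+ size c.
Proof.
move=> yl; elim: c => [|i c IH]; first by rewrite /mono big_nil nc1.
rewrite /mono big_cons ncM /= exprS; apply: ler_pM; rewrite ?nc_ge0 //.
exact: le_trans (nc_le_l1 _ _) yl.
Qed.

Lemma nc_mono_small (isu : pred 'I_n) y c l (m : R) : l1 y <= l ->
  (forall i, isu i -> nc (y i 0) <= m) -> has isu c ->
  nc (mono y c) <= m * l ^+ (size c).-1.
Proof.
move=> yl ym; have l0 : 0 <= l by exact: le_trans (l1_ge0 _) yl.
move=> /hasP [i ic iu]; rewrite (perm_inv_mono y (perm_to_rem ic)) /mono big_cons ncM.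
apply: ler_pM; rewrite ?nc_ge0 ?ym //.
by apply: le_trans (nc_mono_le _ yl) _; rewrite size_rem.
Qed.

Lemma splits_mono_le (v : 'I_n -> C R) y c l (Cv : R) : l1 y <= l ->
  (forall i, nc (v i) <= Cv) ->
  nc (splits (fun i c' => v i * mono y c') c) <= (size c)%:R * (Cv * l ^+ (size c).-1).
Proof.
move=> yl vC; apply: splits_bound => i c' ic; rewrite ncM.
apply: ler_pM; rewrite ?nc_ge0 //.
by apply: le_trans (nc_mono_le _ yl) _; rewrite -(perm_size ic).
Qed.

(** Finitely many Lipschitz functions, each controlled on a ball by its value at [x0]. *)
Lemma pderivs_bounded (Bd : R) (x0 : 'cV[C R]_n) : D x0 -> exists2 Cf : R, 0 <= Cf &
  forall q (b : seq 'I_n) y, (size b <= k)%N -> D y -> l1 y <= Bd ->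
    nc (pderivs D b (fun z => f z q 0) y) <= Cf.
Proof.
move=> D0; pose I : finType := ('I_n * {j : 'I_k.+1 & (j : nat).-tuple 'I_n})%type.
have [|i|Cf Cf0 H] := @finite_bound R I (fun i Cf => forall y, D y -> l1 y <= Bd ->
  nc (pderivs D (tagged i.2) (fun z => f z i.1 0) y) <= Cf).
- by move=> i B B' BB h y Dy yB; apply: le_trans BB; exact: h.
- case: i => q [j b] /=; have bk : (size b <= k)%N by rewrite size_tuple -ltnS ltn_ord.
  have [L L0 hL] := Ck_lip (fCk q) bk.
  exists (nc (pderivs D b (fun z => f z q 0) x0) + L * (`|Bd| + l1 x0)).
    by rewrite addr_ge0 ?nc_ge0 // mulr_ge0 // addr_ge0 // l1_ge0.
  move=> y Dy yB; rewrite -[X in nc X](subrK (pderivs D b (fun z => f z q 0) x0)).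
  apply: le_trans (ler_ncD _ _) _; rewrite addrC lerD2l.
  apply: le_trans (hL _ _ Dy D0) _; rewrite ler_wpM2l //.
  apply: le_trans (l1D _ _) _; rewrite l1N lerD2r.
  exact: le_trans yB (ler_norm _).
exists Cf => // q b y bk; have bk' : (size b < k.+1)%N by [].
exact: (H (q, @Tagged _ (Ordinal bk') (fun j : 'I_k.+1 => (j : nat).-tuple 'I_n) (in_tuple b)) y).
Qed.

Lemma taylor_bounded : exists2 CT : R, 0 <= CT &
  (forall q m xh y, (m <= k)%N -> D xh -> D y ->
    nc (f y q 0 - taylor D m (fun z => f z q 0) xh y) <= CT * l1 (y - xh) ^+ m.+1) /\
  (forall q p m xh y, (m < k)%N -> D xh -> D y ->
    nc (pderiv D p (fun z => f z q 0) y - taylor D m (pderiv D p (fun z => f z q 0)) xh y)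
    <= CT * l1 (y - xh) ^+ m.+1).
Proof.
have [|i|C1 C10 H1] := @finite_bound R ('I_n * 'I_k.+1)%type (fun i CT => forall xh y, D xh -> D y ->
    nc (f y i.1 0 - taylor D i.2 (fun z => f z i.1 0) xh y) <= CT * l1 (y - xh) ^+ i.2.+1).
- move=> i B B' BB h xh y Dx Dy; apply: le_trans (h _ _ Dx Dy) _.
  by rewrite ler_wpM2r // exprn_ge0 // l1_ge0.
- apply: (taylor_bound Dbox (m := i.2)); apply: Ck_le (fCk _).
  by rewrite -ltnS ltn_ord.
have [|[[q p] m]|C2 C20 H2] := @finite_bound R ('I_n * 'I_n * 'I_k)%type (fun i CT => forall xh y, D xh -> D y ->
    nc (pderiv D i.1.2 (fun z => f z i.1.1 0) y - taylor D i.2 (pderiv D i.1.2 (fun z => f z i.1.1 0)) xh y)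
     <= CT * l1 (y - xh) ^+ i.2.+1).
- move=> i B B' BB h xh y Dx Dy; apply: le_trans (h _ _ Dx Dy) _.
  by rewrite ler_wpM2r // exprn_ge0 // l1_ge0.
- apply: (taylor_bound Dbox (m := m)); apply: Ck_pderiv.
  by apply: Ck_le (fCk q); exact: ltn_ord.
exists (C1 + C2); first by rewrite addr_ge0.
have e0 (xh y : 'cV[C R]_n) m : 0 <= l1 (y - xh) ^+ m by rewrite exprn_ge0 // l1_ge0.
split=> [q m xh y mk Dx Dy|q p m xh y mk Dx Dy].
  have mk' : (m < k.+1)%N by [].
  apply: le_trans (H1 (q, Ordinal mk') xh y Dx Dy) _.
  by rewrite ler_wpM2r // lerDl.
apply: le_trans (H2 (q, p, Ordinal mk) xh y Dx Dy) _.
by rewrite ler_wpM2r // lerDr.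
Qed.

Section AlongCurve.
Context (h : R) (x : R -> 'cV[C R]_n) (v : R -> 'I_n -> C R) (xh : 'cV[C R]_n).
Context (Dxh : D xh) (Dx : forall s, 0 <= s <= h -> D (x s)).
Context (xd : forall q s, 0 <= s <= h -> has_d 0 h (fun s => x s q 0) s (v s q)).
Context (CT l Cv : R) (CT0 : 0 <= CT) (l0 : 0 <= l) (Cv0 : 0 <= Cv).
Context (CTf : forall q m xh y, (m <= k)%N -> D xh -> D y ->
    nc (f y q 0 - taylor D m (fun z => f z q 0) xh y) <= CT * l1 (y - xh) ^+ m.+1).
Context (CTd : forall q p m xh y, (m < k)%N -> D xh -> D y ->
    nc (pderiv D p (fun z => f z q 0) y - taylor D m (pderiv D p (fun z => f z q 0)) xh y)
    <= CT * l1 (y - xh) ^+ m.+1).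
Context (xl : forall s, 0 <= s <= h -> l1 (x s - xh) <= l).
Context (vC : forall s q, 0 <= s <= h -> nc (v s q) <= Cv).

Let Rr q (m : nat) s := f (x s) q 0 - taylor D m (fun z => f z q 0) xh (x s).

Definition lift_drem (s : R) a : C R :=
  splits (fun q c => splits (fun i c' => v s i * mono (x s - xh) c') c * Rr q (k - size c) s
    + mono (x s - xh) c * (\sum_p v s p * (pderiv D p (fun z => f z q 0) (x s) -
         taylor D (k - size c).-1 (pderiv D p (fun z => f z q 0)) xh (x s)))) a.

Let taylor_le q m s : (m <= k)%N -> 0 <= s <= h -> nc (Rr q m s) <= CT * l ^+ m.+1.
Proof.
move=> mk sh; apply: le_trans (CTf _ mk Dxh (Dx sh)) _.
by rewrite ler_wpM2l // lerXn2r ?nnegrE ?l1_ge0 // xl.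
Qed.

Lemma lift_rem_has_d a s : (size a <= k)%N -> 0 <= s <= h ->
  has_d 0 h ((lift_rem k D f xh x)^~ a) s (lift_drem s a).
Proof.
move=> ak sh; apply: splits_has_d => q c ca.
apply: has_dM; first by apply: mono_has_d => p; exact: xd.
have kc : (k - size c)%N = (k - size c).-1.+1 by rewrite prednK // subn_gt0 ca.
rewrite kc /=; apply: taylor_remainder_has_d => //.
  by rewrite -kc; apply: Ck_le (fCk q); exact: leq_subr.
by move=> p; exact: xd.
Qed.

(** Each term has |c| factors from the monomial and k - |c| + 1 from the remainder of [f]. *)
Lemma lift_rem_bound a s : (size a <= k)%N -> 0 <= s <= h ->
  nc (lift_rem k D f xh x s a) <= k%:R * (CT * l ^+ k.+1).
Proof.
move=> ak sh; apply: le_trans (_ : (size a)%:R * (CT * l ^+ k.+1) <= _); last first.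
  by rewrite ler_wpM2r ?mulr_ge0 ?exprn_ge0 // ler_nat.
apply: splits_bound => q c /perm_size /= sc; rewrite ncM mulrC.
have ck : (size c <= k)%N by apply: ltnW; rewrite sc.
apply: le_trans (ler_pM (nc_ge0 _) (nc_ge0 _) (taylor_le q (leq_subr _ _) sh) (nc_mono_le c (xl sh))) _.
by rewrite -mulrA -exprD addSn subnK.
Qed.

(** The derivative costs one power of [l], in the monomial or in the Taylor remainder. There are at
    most [k] terms of the first kind and [n] of the second for every splitting. *)
Lemma lift_drem_bound a s : (size a <= k)%N -> 0 <= s <= h ->
  nc (lift_drem s a) <= k%:R * ((k%:R + n%:R) * Cv * CT * l ^+ k).
Proof.
move=> ak sh; have E0 : 0 <= (k%:R + n%:R) * Cv * CT * l ^+ k.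
  by rewrite !mulr_ge0 ?exprn_ge0 // addr_ge0.
apply: le_trans (_ : (size a)%:R * ((k%:R + n%:R) * Cv * CT * l ^+ k) <= _); last first.
  by rewrite ler_wpM2r // ler_nat.
apply: splits_bound => q c /perm_size /= sc.
have ck : (size c < k)%N by rewrite sc.
apply: le_trans (ler_ncD _ _) _; rewrite !mulrDl; apply: lerD.
  rewrite ncM.
  apply: le_trans (ler_pM (nc_ge0 _) (nc_ge0 _) (splits_mono_le c (xl sh) (fun i => vC i sh)) (taylor_le q (leq_subr _ _) sh)) _.
  (* For empty [c] the truncated exponent [(size c).-1] would spoil the count of powers, but the
     coefficient is zero. *)
  have [c0|c0] := posnP (size c).
    by rewrite c0 !mul0r !mulr_ge0 ?exprn_ge0.
  have -> : (size c)%:R * (Cv * l ^+ (size c).-1) * (CT * l ^+ (k - size c).+1) =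
    (size c)%:R * (Cv * CT * l ^+ k).
    have -> : l ^+ k = l ^+ (size c).-1 * l ^+ (k - size c).+1.
      by rewrite -exprD addnS -addSn prednK // subnKC // ltnW.
    ring.
  by rewrite !mulrA -!(mulrA _ Cv) ler_wpM2r ?exprn_ge0 // ler_wpM2r // ?mulr_ge0 // ler_nat ltnW.
rewrite ncM; apply: le_trans (_ : l ^+ size c * (n%:R * (Cv * (CT * l ^+ (k - size c)))) <= _).
  apply: ler_pM; rewrite ?nc_ge0 ?nc_mono_le ?xl //.
  apply: le_trans (ler_nc_sum _ _ _) _.
  apply: le_trans (_ : \sum_(p < n) Cv * (CT * l ^+ (k - size c)) <= _); last first.
    by rewrite sumr_const card_ord mulr_natl.
  apply: ler_sum => p _; rewrite ncM; apply: ler_pM; rewrite ?nc_ge0 ?vC //.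
  have kc : (k - size c)%N = (k - size c).-1.+1 by rewrite prednK // subn_gt0.
  apply: le_trans (CTd q p _ Dxh (Dx sh)) _.
    by rewrite -kc leq_subr.
  by rewrite -kc ler_wpM2l // lerXn2r ?nnegrE ?l1_ge0 // xl.
have -> : l ^+ k = l ^+ size c * l ^+ (k - size c) by rewrite -exprD subnKC // ltnW.
by rewrite le_eqVlt; apply/orP; left; apply/eqP; ring.
Qed.

(* A factor u_i - uh_i of the monomial is O(eps); without one, only
   components whose remainder vanishes are left. *)
Lemma lift_rem_small (isu : pred 'I_n) (m : R) a s : (size a <= k)%N -> 0 <= s <= h ->
  0 <= m -> (forall i, isu i -> nc ((x s - xh) i 0) <= m) ->
  (forall q j, ~~ isu q -> Rr q j s = 0) -> count isu a != 1%N ->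
  nc (lift_rem k D f xh x s a) <= k%:R * (m * CT * l ^+ k).
Proof.
move=> ak sh m0 xm Rt au.
have E0 : 0 <= m * CT * l ^+ k by rewrite !mulr_ge0 ?exprn_ge0.
apply: le_trans (_ : (size a)%:R * (m * CT * l ^+ k) <= _); last first.
  by rewrite ler_wpM2r // ler_nat.
apply: splits_bound => q c qc; have /= sc := perm_size qc.
have [qu|qt] := boolP (isu q); last by have := Rt q (k - size c)%N qt; rewrite /Rr => ->; rewrite mulr0 nc0.
have cu : has isu c.
  rewrite has_count lt0n; apply: contra au => /eqP c0.
  by rewrite -(permP qc) /= qu c0.
have ck : (size c < k)%N by rewrite sc.
have c0 : (0 < size c)%N by case: c cu {qc sc ck}.
rewrite ncM.
apply: le_trans (ler_pM (nc_ge0 _) (nc_ge0 _) (nc_mono_small (xl sh) xm cu) (taylor_le q (leq_subr _ _) sh)) _.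
have -> : l ^+ k = l ^+ (size c).-1 * l ^+ (k - size c).+1.
  by rewrite -exprD addnS -addSn prednK // subnKC // ltnW.
by rewrite le_eqVlt; apply/orP; left; apply/eqP; ring.
Qed.
End AlongCurve.
End RemainderEstimates.

(** * Real scalars are closed under sums and products *)

Section RealClosure.
Context {R : realType}.
Implicit Types (z w : C R).

Lemma imC_sum (I : Type) (r : seq I) (Pr : pred I) (F : I -> C R) :
  (forall i, Pr i -> imC (F i) = 0) -> imC (\sum_(i <- r | Pr i) F i) = 0.
Proof.
move=> h; apply: (big_ind (fun z : C R => imC z = 0)) => // x y x0 y0.
by rewrite imCD x0 y0 addr0.
Qed.

Lemma imCM0 z w : imC z = 0 -> imC w = 0 -> imC (z * w) = 0.
Proof. by move=> z0 w0; rewrite imCM z0 w0 mulr0 mul0r addr0. Qed.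

Lemma imC_nat m : imC (m%:R : C R) = 0. Proof. by rewrite -toC_nat. Qed.

Lemma imC_natV m : imC ((m%:R)^-1 : C R) = 0. Proof. by rewrite -toC_nat -toCV. Qed.

Lemma range_toCP z : range (@toC R) z <-> imC z = 0.
Proof.
split=> [[a _ <-]//|z0]; exists (reC z) => //.
by rewrite [RHS]reim z0 toC0 mulr0 addr0.
Qed.
End RealClosure.

(** * The augmented system and its time component *)

Section AugmentedSystem.
Context {R : realType} (K : set (C R)) (HK : scalars K) (d k : nat) (k_gt0 : (0 < k)%N).
Context (T : R) (T_gt0 : 0 < T).
Context (A : 'M[C R]_d) (AK : forall i j, K (A i j)).
Context (F : 'cV[C R]_d -> R -> 'cV[C R]_d).
Context (FK : forall (v : 'cV[C R]_d) (t : R), (forall i, K (v i 0)) -> 0 <= t <= T ->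
       forall i, K (F v t i 0)).
Context (F_lip : forall i : 'I_d,
       Ck_lipschitz (aug_dom K T) k (fun x => aug_f F x (lshift 1 i) 0)).
Context (r : seq (seq 'I_(d + 1))) (r_order : tail_order k r).

Local Notation DD := (@aug_dom R K d T).
Local Notation tq := (rshift d ord0 : 'I_(d + 1)).

Let Dbox : box_like DD := aug_dom_box HK d T_gt0.

Lemma aug_f_t j : (fun z => aug_f F z (rshift d j) 0) = fun=> 1.
Proof. by apply/funext => z; rewrite /aug_f col_mxEd mxE. Qed.

Lemma aug_f_Ck q : Ck_lipschitz DD k (fun z => aug_f F z q 0).
Proof.
case: (split_ordP q) => j ->; first exact: F_lip.
by rewrite aug_f_t; exact: Ck_cst.
Qed.

Lemma aug_A_row j m : aug_A A (rshift d j) m = 0.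
Proof.
rewrite /aug_A; case: (split_ordP m) => i ->; first by rewrite block_mxEdl mxE.
by rewrite block_mxEdr mxE.
Qed.

Lemma aug_A_col q j : aug_A A q (rshift d j) = 0.
Proof.
rewrite /aug_A; case: (split_ordP q) => i ->; first by rewrite block_mxEur mxE.
by rewrite block_mxEdr mxE.
Qed.

Lemma sum_aug_A q (x : 'cV[C R]_(d + 1)) :
  \sum_m aug_A A q m * x m 0 = \sum_i aug_A A q (lshift 1 i) * x (lshift 1 i) 0.
Proof.
by rewrite big_split_ord /= big_ord1 aug_A_col mul0r addr0.
Qed.

Definition curve (u : R -> 'cV[C R]_d) (t : R) : 'cV[C R]_(d + 1) :=
  col_mx (u t) (const_mx (toC t)).

Lemma curve_u u t i : curve u t (lshift 1 i) 0 = u t i 0.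
Proof. by rewrite /curve col_mxEu. Qed.
Lemma curve_t u t : curve u t tq 0 = toC t.
Proof. by rewrite /curve col_mxEd mxE. Qed.

Lemma curve_dom u eps u0 t : solves K A F T eps u0 u -> 0 <= t <= T -> DD (curve u t).
Proof.
move=> [_ sol] tT; have [uK _] := sol t tT; split=> [i|].
  by rewrite /curve col_mxKu.
by exists t => //; rewrite /curve col_mxKd mxE.
Qed.

Lemma solves_has_d u eps u0 q t : solves K A F T eps u0 u -> 0 <= t <= T ->
  has_d 0 T (fun s => curve u s q 0) t
    (toC eps^-1 * (\sum_m aug_A A q m * curve u t m 0) + aug_f F (curve u t) q 0).
Proof.
move=> [_ sol] tT; have [_ /mx_cvgP du] := sol t tT.
rewrite sum_aug_A; case: (split_ordP q) => i ->; last first.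
  rewrite big1 ?mulr0 ?add0r; last by move=> m _; rewrite aug_A_row mul0r.
  have -> : aug_f F (curve u t) (rshift d i) 0 = 1 by rewrite /aug_f col_mxEd mxE.
  have -> : (fun s => curve u s (rshift d i) 0) = @toC R.
    by apply/funext => s; rewrite ord1 curve_t.
  exact: has_d_id.
have -> : (fun s => curve u s (lshift 1 i) 0) = (fun s => u s i 0).
  by apply/funext => s; rewrite curve_u.
have -> : toC eps^-1 * (\sum_i0 aug_A A (lshift 1 i) (lshift 1 i0) * curve u t (lshift 1 i0) 0) +
    aug_f F (curve u t) (lshift 1 i) 0 = (toC eps^-1 *: (A *m u t) + F (u t) t) i 0.
  rewrite [RHS]mxE [X in _ = X + _]mxE [X in _ = _ * X + _]mxE; congr (_ * _ + _).
    by apply: eq_bigr => m _; rewrite curve_u /aug_A block_mxEul.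
  by rewrite /aug_f col_mxEu /curve col_mxKu col_mxKd mxE reC_toC.
have := du i ord0; set w := (toC eps^-1 *: (A *m u t) + F (u t) t) i 0 => dui.
move=> e e0; have /cvg_ncP /(_ e e0) := dui.
rewrite near_withinE near_withinE => /nbhs_ballP [dl /= dl0 h].
exists dl => // s sT sd; have [->|st] := eqVneq s t.
  by rewrite !subrr toC0 mul0r subr0 nc0 normr0 mulr0.
have := h (s - t); rewrite /ball /= sub0r normrN => /(_ sd).
have -> : t + (s - t) = s by rewrite addrCA subrr addr0.
rewrite subr_eq0 => H; have {H} := H st sT; rewrite mxE [X in nc (_ * X - _)]mxE [X in nc (_ * (_ + X) - _)]mxE => le.
have n0 : toC (s - t) != 0 by rewrite toC_eq0 subr_eq0.
have -> : u s i 0 - u t i 0 - toC (s - t) * w =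
   (toC (s - t)^-1 * (u s i 0 - u t i 0) - w) * toC (s - t).
  by rewrite toCV mulrBl mulrAC mulVf // mul1r [w * _]mulrC.
by rewrite ncM nc_toC ler_wpM2r.
Qed.

Section Step.
Context (eps h : R) (xh : 'cV[C R]_(d + 1)) (Dxh : DD xh) (h0 : 0 <= h).

Let x1 := scheme_step DD (aug_A A) (aug_f F) k r eps h xh.
Let Y s a := unsort (lift_flow k r DD (aug_A A) (aug_f F) eps xh s) a.

(** The time row of A_1 is zero and the time component of [f] is constant, so the right-hand side is
    just the component of the empty tuple, which is 1. Hence time advances by exactly [h]. *)
Lemma step_time : x1 tq 0 = xh tq 0 + toC h.
Proof.
rewrite /x1 (scheme_stepE r_order); congr (_ + _).
have tk : (size [:: tq] <= k)%N by [].
suff E : Y h [:: tq] - toC h = 0 by apply/eqP; rewrite -subr_eq0; apply/eqP.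
have -> : 0 = Y 0 [:: tq] - toC 0.
  by rewrite /Y (lift_flow0 k_gt0 r_order) // toC0 subr0.
apply: (has_d0_eq (f := fun s => Y s [:: tq] - toC s) h0) => s sh.
rewrite -[X in has_d _ _ _ _ X](subrr 1); apply: has_dB; last exact: has_d_id.
suff -> : 1 = splits (lift_term k DD (aug_A A) (aug_f F) eps xh (Y s)) [:: tq].
  exact: (lift_flow_has_d k_gt0 r_order).
rewrite /= addr0 /lift_term [X in _ * X]big1 ?mulr0 ?add0r; last first.
  by move=> m _; rewrite aug_A_row mul0r.
rewrite big_ord_recl [X in _ + X]big1 ?addr0 => [|j _]; last first.
  apply: big1 => -[[//|i b] sb] _; rewrite /taylor_coef aug_f_t pderivs_cst //.
  by rewrite mulr0 mul0r.
rewrite (bigD1 [tuple]) //= big1 ?addr0 => [|b]; last by case/andP => _ /eqP; case; exact: tuple0.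
rewrite /taylor_coef aug_f_t /gamma big1 // invr1 !mul1r.
by rewrite /= /Y (lift_flow_nil k_gt0 r_order) //; case/andP: sh.
Qed.
End Step.
End AugmentedSystem.

(** * Invariance of the domain and the recursion for one step *)

Section OneStep.
Context {R : realType} (K : set (C R)) (HK : scalars K) (d k : nat) (k_gt0 : (0 < k)%N).
Context (T : R) (T_gt0 : 0 < T).
Context (A : 'M[C R]_d) (AK : forall i j, K (A i j)).
Context (F : 'cV[C R]_d -> R -> 'cV[C R]_d).
Context (FK : forall (v : 'cV[C R]_d) (t : R), (forall i, K (v i 0)) -> 0 <= t <= T ->
       forall i, K (F v t i 0)).
Context (F_lip : forall i : 'I_d,
       Ck_lipschitz (aug_dom K T) k (fun x => aug_f F x (lshift 1 i) 0)).
Context (r : seq (seq 'I_(d + 1))) (r_order : tail_order k r).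

Local Notation DD := (@aug_dom R K d T).
Local Notation tq := (rshift d ord0 : 'I_(d + 1)).
Local Notation n := (d + 1)%N.

Let Dbox : box_like DD := aug_dom_box HK d T_gt0.
Let fCk := aug_f_Ck HK T_gt0 F_lip.

(** Real matrix, real base point and real derivatives of [f] make every entry of the exponent
    real. *)
Lemma step_real eps h xh i : K = range (@toC R) -> DD xh ->
  imC (scheme_step DD (aug_A A) (aug_f F) k r eps h xh i 0) = 0.
Proof.
move=> KE Dxh.
have Dreal y q : DD y -> imC (y q 0) = 0.
  move=> /(aug_domE _ _ _).1 /(_ q); rewrite /axis_set; case: ifP => _.
    by rewrite KE => /range_toCP.
  by move=> [t _ ->].
have Areal p q : imC (aug_A A p q) = 0.
  case: (split_ordP q) => j ->; last by rewrite aug_A_col.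
  case: (split_ordP p) => j' ->; last by rewrite aug_A_row.
  by rewrite /aug_A block_mxEul; apply/range_toCP; rewrite -KE.
have freal q y : DD y -> imC (aug_f F y q 0) = 0.
  move=> Dy; case: (split_ordP q) => j ->; last by rewrite /aug_f col_mxEd mxE.
  rewrite /aug_f col_mxEu; apply/range_toCP; rewrite -KE.
  by have [yK [t tT ->]] := Dy; rewrite reC_toC; apply: FK.
have nat0 (b : bool) : imC (b%:R : C R) = 0 by exact: imC_nat.
rewrite (scheme_stepE r_order) imCD Dreal // add0r /unsort.
apply: imC_sum => j _; apply: imCM0 => //; rewrite /lift_flow mxE.
apply: imC_sum => l _; apply: imCM0; last first.
  case: (split_ordP l) => l' ->; first by rewrite col_mxEu mxE.
  by rewrite col_mxEd mxE.
apply: expmx_real => p q; rewrite !mxE imCD imCM0 ?add0r //.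
  apply: imC_sum => a _; apply: imC_sum => m _; apply: imC_sum => b _.
  apply: imCM0 => //; apply: imCM0; first exact: imC_natV.
  apply: pderivs_real (fCk _) _ _ _ Dxh => //.
  - by move=> q' y y' Dy Dy'; rewrite !Dreal.
  - by move=> y Dy; exact: freal.
  - rewrite size_tuple -ltnS; apply: leq_trans (ltn_ord m) _.
    have sp : (0 < size (mindex p))%N by apply: leq_ltn_trans (ltn_ord a).
    by rewrite ltnS; move: (mindex_size k_gt0 r_order p).1 sp; case: (size (mindex p)) => // s sk _;
       rewrite -subSn // subSS leq_subr.
apply: imC_sum => a _; apply: imC_sum => m _; apply: imCM0; first exact: Areal.
by rewrite imCD nat0 add0r; apply: imCM0 => //; exact: Dreal.
Qed.

(** The derivatives of [F] are controlled only inside the domain, so the next base point has to lie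
    there again. *)
Lemma step_dom eps h tn xh : DD xh -> xh tq 0 = toC tn -> 0 <= tn -> 0 <= h -> tn + h <= T ->
  DD (scheme_step DD (aug_A A) (aug_f F) k r eps h xh).
Proof.
move=> Dxh xt t0 h0 tT; apply/(aug_domE _ _ _).2 => q.
case: (split_ordP q) => j ->.
  rewrite axis_set_u; have [KT|KE] := HK.
    have KP z : K z by rewrite KT.
    exact: KP.
  have KP z : imC z = 0 -> K z by rewrite KE => /range_toCP.
  by apply: KP; exact: (step_real eps h (lshift 1 j) KE Dxh).
rewrite axis_set_t ord1 (step_time HK k_gt0 T_gt0) // xt -toCD; exists (tn + h) => //.
by rewrite addr_ge0.
Qed.

Lemma l1_le (x : 'cV[C R]_n) (m t : R) : (forall i, nc (x (lshift 1 i) 0) <= m) ->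
  nc (x tq 0) <= t -> l1 x <= d%:R * m + t.
Proof.
move=> xm xt; rewrite /l1 big_split_ord /= big_ord1 lerD //.
apply: le_trans (_ : \sum_(i < d) m <= _); first by apply: ler_sum.
by rewrite sumr_const card_ord mulr_natl.
Qed.

Context (P Q : 'M[C R]_n) (lam : 'I_n -> C R).
Let isu : pred 'I_n := fun q => (q < d)%N.
Context (QP : Q *m P = 1%:M).
Context (Ppat : forall i j : 'I_n, (i < d)%N != (j < d)%N -> P i j = 0).
Context (PA : forall i m, \sum_j P i j * aug_A A j m = lam i * P i m).
Context (lam_im : forall i, reC (lam i) = 0).
Context (lam_u : forall i : 'I_n, (i < d)%N -> lam i != 0).
Context (lam_t : forall i : 'I_n, ~~ (i < d)%N -> lam i = 0).
Context (u : R -> R -> 'cV[C R]_d) (u0 : R -> 'cV[C R]_d).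
Context (u_sol : forall eps : R, 0 < eps <= 1 -> solves K A F T eps (u0 eps) (u eps)).
Context (C0 : R) (u_osc : forall eps : R, 0 < eps <= 1 ->
       forall t : R, 0 <= t <= T -> enorm (u eps t) <= C0 * eps).
Context (c0 : R) (c0_gt0 : 0 < c0).

Lemma isu_lshift q : isu q -> exists i : 'I_d, q = lshift 1 i.
Proof.
case: (split_ordP q) => j ->; first by exists j.
by rewrite /isu /= ltnNge leq_addr.
Qed.

Lemma isu_rshift q : ~~ isu q -> q = tq.
Proof.
case: (split_ordP q) => j ->; first by rewrite /isu (ltn_ord j : (lshift 1 j < d)%N).
by rewrite ord1.
Qed.

(** The time column of A_1 is zero, so only the u-components, which are O(eps), meet the factor 1 /
    eps. *)
Lemma aug_A_scaled (eps B : R) q (x : 'cV[C R]_n) : 0 < eps -> 0 <= B ->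
  (forall i, nc (x (lshift 1 i) 0) <= B * eps) ->
  nc (toC eps^-1 * (\sum_m aug_A A q m * x m 0)) <= mx1 (aug_A A) * B.
Proof.
move=> eps0 B0 xB; rewrite ncM nc_toC ger0_norm ?invr_ge0 ?(ltW eps0) //.
rewrite ler_pdivrMl // mulrC -mulrA; apply: le_trans (ler_nc_sum _ _ _) _.
apply: le_trans (_ : (\sum_m nc (aug_A A q m)) * (B * eps) <= _); last first.
  by rewrite ler_wpM2r ?mx1_row // mulr_ge0 // ltW.
rewrite mulr_suml; apply: ler_sum => m _; rewrite ncM.
case: (split_ordP m) => j ->; last by rewrite aug_A_col nc0 !mul0r.
by rewrite ler_wpM2l ?nc_ge0.
Qed.

(** The error in eigenvector coordinates, where the oscillation does not amplify it. *)
Local Notation err eps t x := (l1 (P *m (curve (u eps) t - x))).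

Lemma l1_mulmx_inv (w : 'cV[C R]_n) : l1 w <= mx1 Q * l1 (P *m w).
Proof.
have {1}-> : w = Q *m (P *m w) by rewrite mulmxA QP mul1mx.
set z := P *m w.
apply: le_trans (_ : (\sum_i \sum_j nc (Q i j)) * l1 z <= _); last first.
  by rewrite ler_wpM2r ?l1_ge0 // /mx1 lerDr.
rewrite mulr_suml; apply: ler_sum => i _; rewrite mxE.
apply: le_trans (ler_nc_sum _ _ _) _; rewrite mulr_suml; apply: ler_sum => j _.
by rewrite ncM ler_wpM2l ?nc_ge0 // nc_le_l1.
Qed.

Lemma C0_ge0 : 0 <= C0.
Proof.
have e1 : 0 < (1 : R) <= 1 by rewrite ltr01 lexx.
have t0 : 0 <= (0 : R) <= T by rewrite lexx ltW.
have := u_osc e1 t0; rewrite mulr1; apply: le_trans; exact: sqrtr_ge0.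
Qed.

Lemma step_bound (B : R) : 0 <= B -> exists2 Cs : R, 0 <= Cs &
  forall eps h tn xh, 0 < eps <= 1 -> c0 * eps < h -> 0 <= tn -> tn + h <= T ->
    DD xh -> xh tq 0 = toC tn -> (forall i, nc (xh (lshift 1 i) 0) <= B * eps) ->
    err eps (tn + h) (scheme_step DD (aug_A A) (aug_f F) k r eps h xh)
    <= err eps tn xh + Cs * h * (err eps tn xh + eps * h ^+ k).
Proof.
move=> B0; have C00 := C0_ge0.
have e1 : 0 < (1 : R) <= 1 by rewrite ltr01 lexx.
have t00 : 0 <= (0 : R) <= T by rewrite lexx ltW.
have D0 : DD (curve (u 1) 0) := curve_dom (u_sol e1) t00.
have T0 : 0 <= T by exact: ltW.
pose a1 := mx1 (aug_A A).
have a10 : 0 <= a1 by apply: le_trans (mx1_ge1 _).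
(* Bounds the exact and the numerical augmented state, using [eps <= 1]. *)
pose Bd := d%:R * (C0 + B) + T.
have Bd0 : 0 <= Bd by rewrite addr_ge0 // mulr_ge0 // addr_ge0.
have [Cf Cf0 fB] := pderivs_bounded fCk Bd D0.
have [CT CT0 [CTf CTd]] := taylor_bounded Dbox fCk.
pose Cv := a1 * C0 + Cf.
have Cv0 : 0 <= Cv by rewrite addr_ge0 // mulr_ge0.
(* Bounds the norm of x - X_n divided by [h]: the u-components are at most [(C0 + B) * eps] with eps
   < h / c0, and the time component is at most [h]. *)
pose Cx := d%:R * ((C0 + B) / c0) + 1.
have Cx0 : 0 <= Cx by rewrite addr_ge0 // mulr_ge0 // divr_ge0 ?addr_ge0 // ltW.
pose Ng : R := \sum_(m < k.+1) #|{: m.-tuple 'I_n}|%:R.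
have Ng0 : 0 <= Ng by apply: sumr_ge0.
(* Bounds [lift_low]: at most [k] splittings, each with A_1 X_n / eps of size [a1 * B] and at most
   [Ng] Taylor coefficients of size [Cf]. *)
pose Bg := k%:R * (a1 * B + Ng * Cf).
have Bg0 : 0 <= Bg by rewrite mulr_ge0 // addr_ge0 ?mulr_ge0.
(* For the initial error: a nonconstant monomial contributes one factor [e0], and the others are at
   most 2 [Bd]. The added 1 allows the exponent [k] throughout. *)
pose Be := (1 + 2 * Bd) ^+ k.
have Bd1 : 1 <= 1 + 2 * Bd by rewrite lerDl mulr_ge0.
have Be0 : 0 <= Be by rewrite exprn_ge0 // (le_trans ler01).
pose Bh := Bg + Be.
have Bh0 : 0 <= Bh by rewrite addr_ge0.
pose Kc1 := k%:R * (CT * Cx ^+ k.+1).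
pose Kc2 := k%:R * ((k%:R + n%:R) * Cv * CT * Cx ^+ k).
pose Kc3 := k%:R * ((C0 + B) * CT * Cx ^+ k).
have Kc10 : 0 <= Kc1 by rewrite !mulr_ge0 // exprn_ge0.
have Kc20 : 0 <= Kc2 by rewrite !mulr_ge0 // ?exprn_ge0 // addr_ge0.
have Kc30 : 0 <= Kc3 by rewrite !mulr_ge0 // ?exprn_ge0 // addr_ge0.
(* One constant for the three bounds: on the remainder, on its derivative, and on the remainder when
   the number of u-indices is not one. *)
pose Kc := Kc1 + Kc2 + Kc3.
have Kc0 : 0 <= Kc by rewrite !addr_ge0.
have [Kh Kh0 heart] := @lifted_bound R n P Q (aug_A A) lam isu QP Ppat PA lam_im lam_u lam_t k T Bh T0 Bh0.
have Q0 : 0 <= mx1 Q by apply: le_trans (mx1_ge1 _).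
exists (n%:R * Kh * (mx1 Q + Kc)); first by rewrite !mulr_ge0 // addr_ge0.
move=> eps h tn xh eps01 eh tn0 tT Dxh xt xB; have /andP[eps0 eps1] := eps01.
have eps0' := ltW eps0.
have h0 : 0 < h by apply: le_lt_trans eh; rewrite mulr_ge0 // ltW.
have h0' := ltW h0.
have hT : h <= T by apply: le_trans tT; rewrite lerDr.
pose x (s : R) := curve (u eps) (tn + s).
have tnT s : 0 <= s <= h -> 0 <= tn + s <= T.
  move=> /andP[s0 sh]; rewrite addr_ge0 //=; apply: le_trans tT; by rewrite lerD2l.
have sol := u_sol eps01.
have Dx s : 0 <= s <= h -> DD (x s) by move=> sh; apply: curve_dom sol (tnT s sh).
have xu s i : 0 <= s <= h -> nc (x s (lshift 1 i) 0) <= C0 * eps.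
  move=> sh; rewrite /x curve_u; apply: le_trans (nc_le_enorm _ _) _.
  exact: u_osc (tnT s sh).
have xd q s : 0 <= s <= h -> has_d 0 h (fun s => x s q 0) s
    (toC eps^-1 * (\sum_m aug_A A q m * x s m 0) + aug_f F (x s) q 0).
  move=> sh; apply: (has_d_shift (f := fun t => curve (u eps) t q 0)).
  have := solves_has_d q sol (tnT s sh); apply: has_d_sub; last exact: tT.
  by rewrite addr0.
pose v s q := toC eps^-1 * (\sum_m aug_A A q m * x s m 0) + aug_f F (x s) q 0.
have eC : eps * C0 <= C0 by rewrite ler_piMl.
have xBd s : 0 <= s <= h -> l1 (x s) <= Bd.
  move=> sh; apply: le_trans (l1_le (fun i => xu s i sh) (_ : _ <= T)) _.
    by rewrite /x curve_t nc_toC; case/andP: (tnT s sh) => t1 t2; rewrite ger0_norm.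
  rewrite lerD2r ler_wpM2l // mulrC; apply: le_trans eC _; by rewrite lerDl.
have xhBd : l1 xh <= Bd.
  apply: le_trans (l1_le xB (_ : _ <= T)) _.
    by rewrite xt nc_toC ger0_norm //; apply: le_trans tT; rewrite lerDl.
  rewrite lerD2r ler_wpM2l //; apply: le_trans (_ : B <= _); last by rewrite lerDr.
  by rewrite ler_piMr.
have vC s q : 0 <= s <= h -> nc (v s q) <= Cv.
  move=> sh; apply: le_trans (ler_ncD _ _) _; apply: lerD.
    by apply: aug_A_scaled => // i; exact: xu.
  exact: (fB q [::] _ isT (Dx s sh) (xBd s sh)).
have xiu s q : 0 <= s <= h -> isu q -> nc ((x s - xh) q 0) <= (C0 + B) * eps.
  move=> sh /isu_lshift [i ->]; rewrite mxE [X in _ + X]mxE; apply: le_trans (ler_ncB _ _) _.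
  by rewrite mulrDl lerD ?xB // xu.
have xit s : (x s - xh) tq 0 = toC s.
  by rewrite [LHS]mxE [X in _ + X]mxE /x curve_t xt -toCB addrC addKr.
pose l := Cx * h.
have l0 : 0 <= l by rewrite mulr_ge0.
have xil s : 0 <= s <= h -> l1 (x s - xh) <= l.
  move=> sh; have H i : nc ((x s - xh) (lshift 1 i) 0) <= (C0 + B) * eps.
    by apply: xiu sh _; exact: (ltn_ord i : (lshift 1 i < d)%N).
  apply: le_trans (l1_le H (_ : _ <= h)) _.
    by rewrite xit nc_toC; case/andP: sh => s0 sh'; rewrite ger0_norm.
  rewrite /l /Cx [leRHS]mulrDl mul1r lerD2r -[leRHS]mulrA ler_wpM2l //.
  have -> : (C0 + B) / c0 * h = (C0 + B) * (h / c0) by rewrite mulrAC mulrA.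
  rewrite ler_wpM2l ?addr_ge0 // ler_pdivlMr // mulrC; exact: ltW.
pose kap := Kc * h ^+ k.
have hk0 : 0 <= h ^+ k by rewrite exprn_ge0.
have kap0 : 0 <= kap by rewrite mulr_ge0.
pose e0 := l1 (x 0 - xh).
have e00 : 0 <= e0 by exact: l1_ge0.
have h0h : 0 <= (0 : R) <= h by apply/andP.
pose dlt := lift_err k r DD (aug_A A) (aug_f F) eps xh x.
pose g := lift_low k r DD (aug_A A) (aug_f F) eps xh x.
pose rem := lift_rem k DD (aug_f F) xh x.
pose drem := lift_drem k DD (aug_f F) x v xh.
have lk : l ^+ k = Cx ^+ k * h ^+ k by rewrite exprMn.
have gB s M : 0 <= s <= h -> (forall a, (size a <= k)%N -> nc (dlt s a) <= M) ->
    forall a, (size a <= k)%N -> nc (g s a) <= Bh * M.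
  move=> sh hM a ak; have M0 : 0 <= M by apply: le_trans (nc_ge0 _) (hM [::] _).
  apply: le_trans (_ : Bg * M <= _); last by rewrite ler_wpM2r // lerDl.
  rewrite /Bg -mulrA; apply: le_trans (_ : (size a)%:R * ((a1 * B + Ng * Cf) * M) <= _); last first.
    by rewrite ler_wpM2r ?ler_nat // mulr_ge0 // addr_ge0 ?mulr_ge0.
  apply: splits_bound => q c /perm_size /= sc.
  have ck : (size c < k)%N by rewrite sc.
  apply: le_trans (ler_ncD _ _) _; rewrite mulrDl; apply: lerD.
    rewrite ncM; apply: ler_pM; rewrite ?nc_ge0 //; last by apply: hM; exact: ltnW.
    exact: aug_A_scaled.
  apply: le_trans (ler_nc_sum _ _ _) _.
  apply: le_trans (_ : \sum_(m < (k - size c).+1) #|{: m.-tuple 'I_n}|%:R * (Cf * M) <= _).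
    apply: ler_sum => m _; apply: le_trans (ler_nc_sum _ _ _) _.
    apply: le_trans (_ : \sum_(b : m.-tuple 'I_n | nondec b) Cf * M <= _).
      apply: ler_sum => b _; rewrite ncM; apply: ler_pM; rewrite ?nc_ge0 //; last first.
        apply: hM; rewrite size_cat size_tuple; have := ltn_ord m; rewrite ltnS => mk.
        by apply: leq_trans (leq_add (leqnn _) mk) _; rewrite subnKC // ltnW.
      rewrite /taylor_coef ncM -[leRHS]mul1r; apply: ler_pM; rewrite ?nc_ge0 //.
        rewrite ncV -toC_nat nc_toC ger0_norm // invf_le1 ?ltr0n ?gamma_gt0 //.
        by rewrite ler1n gamma_gt0.
      apply: fB => //; rewrite size_tuple; have := ltn_ord m; rewrite ltnS => mk.
      exact: leq_trans mk (leq_subr _ _).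
    rewrite sumr_const -[leLHS]mulr_natl ler_wpM2r ?mulr_ge0 // ler_nat.
    exact: max_card.
  rewrite -mulr_suml -mulrA ler_wpM2r ?mulr_ge0 // /Ng.
  have kle : ((k - size c).+1 <= k.+1)%N by rewrite ltnS leq_subr.
  rewrite -(big_mkord xpredT (fun m => #|{: m.-tuple 'I_n}|%:R)) -(big_mkord xpredT (fun m => #|{: m.-tuple 'I_n}|%:R)).
  rewrite [leRHS](big_cat_nat (leq0n _) kle) /= lerDl; exact: sumr_ge0.
have dlt0 a : (size a <= k)%N -> nc (dlt 0 a) <= Bh * e0.
  move=> ak; apply: le_trans (_ : Be * e0 <= _); last by rewrite ler_wpM2r // lerDr.
  rewrite /dlt /lift_err (lift_flow0 k_gt0 r_order) //; case: a ak => [|q a] ak.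
    by rewrite /mono big_nil subrr nc0 mulr_ge0.
  rewrite subr0; apply: le_trans (nc_mono_le _ (lexx _)) _.
  rewrite /= exprS mulrC -/e0 ler_wpM2r //.
  have e0B : e0 <= 1 + 2 * Bd.
    have : e0 <= Bd + Bd.
      by apply: le_trans (l1D _ _) _; rewrite l1N lerD // xBd.
    by move: Bd0; lra.
  apply: le_trans (_ : (1 + 2 * Bd) ^+ size a <= _).
    by rewrite lerXn2r // nnegrE (le_trans e00).
  by rewrite /Be ler_weXn2l // ltnW.
have remB a s : (size a <= k)%N -> 0 <= s <= h -> nc (rem s a) <= kap * h.
  move=> ak sh; apply: le_trans (lift_rem_bound Dxh Dx CT0 l0 CTf xil ak sh) _.
  rewrite /l exprMn exprS.
  have -> : k%:R * (CT * (Cx * Cx ^+ k * h ^+ k.+1)) = Kc1 * h ^+ k * h by rewrite /Kc1 !exprS; ring.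
  by rewrite ler_wpM2r // ler_wpM2r // /Kc -addrA lerDl addr_ge0.
have dremB a s : (size a <= k)%N -> 0 <= s <= h -> nc (drem s a) <= kap.
  move=> ak sh; apply: le_trans (lift_drem_bound Dxh Dx CT0 l0 Cv0 CTf CTd xil vC ak sh) _.
  rewrite lk mulrA mulrA -/Kc2 ler_wpM2r //.
  by rewrite -!mulrA !mulrA -[leLHS]mulrA; rewrite /Kc /Kc2 !mulrA addrAC lerDr addr_ge0.
have remU a s : (size a <= k)%N -> 0 <= s <= h -> count isu a != 1%N -> nc (rem s a) <= eps * kap.
  move=> ak sh au.
  apply: le_trans (lift_rem_small Dxh Dx CT0 l0 CTf xil (m := (C0 + B) * eps) ak sh _ _ _ au) _.
  - by rewrite mulr_ge0 // addr_ge0.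
  - by move=> i iu; exact: xiu.
  - by move=> q j /isu_rshift ->; rewrite aug_f_t taylor_cst // /aug_f col_mxEd mxE subrr.
  rewrite lk; have -> : k%:R * ((C0 + B) * eps * CT * (Cx ^+ k * h ^+ k)) = eps * (Kc3 * h ^+ k).
    by rewrite /Kc3; ring.
  by rewrite ler_wpM2l // ler_wpM2r // /Kc lerDr addr_ge0.
have hh : 0 <= h <= T by rewrite h0'.
have dltE s q : dlt s [:: q] = (x s - xh) q 0 - unsort (lift_flow k r DD (aug_A A) (aug_f F) eps xh s) [:: q].
  by rewrite /dlt /lift_err /mono big_seq1.
have tr0 i : tr P (dlt 0) [:: i] = (P *m (curve (u eps) tn - xh)) i 0.
  rewrite mxE /=; apply: eq_bigr => q _; congr (_ * _).
  by rewrite dltE (lift_flow0 k_gt0 r_order) // subr0 /x addr0.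
have tr1 i : tr P (dlt h) [:: i] =
    (P *m (curve (u eps) (tn + h) - scheme_step DD (aug_A A) (aug_f F) k r eps h xh)) i 0.
  rewrite mxE /=; apply: eq_bigr => q _; congr (_ * _).
  rewrite dltE [RHS]mxE [X in _ = _ + X]mxE (scheme_stepE r_order) opprD addrA.
  by congr (_ - _); rewrite mxE [X in _ + X = _]mxE.
have H i := heart eps h kap e0 dlt g rem drem eps01 hh kap0 e00
  (fun a s ak sh => lift_err_has_d k_gt0 r_order DD xh xd ak sh) gB
  (fun a s ak sh => lift_rem_has_d Dbox fCk Dxh Dx xd ak sh) remB dremB remU dlt0 i k_gt0.
apply: le_trans (_ : \sum_i (nc ((P *m (curve (u eps) tn - xh)) i 0) + Kh * h * (e0 + eps * kap)) <= _).
  by apply: ler_sum => i _; rewrite -tr1 -tr0; exact: H.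
rewrite big_split /= sumr_const card_ord lerD2l -[leLHS]mulr_natl.
have e0E : e0 <= mx1 Q * err eps tn xh.
  by apply: le_trans (l1_mulmx_inv _) _; rewrite /x addr0.
have E0 : 0 <= err eps tn xh by exact: l1_ge0.
have -> : n%:R * Kh * (mx1 Q + Kc) * h * (err eps tn xh + eps * h ^+ k) =
  n%:R * (Kh * h * ((mx1 Q + Kc) * (err eps tn xh + eps * h ^+ k))) by ring.
rewrite ler_wpM2l // ler_wpM2l ?mulr_ge0 //.
have -> : (mx1 Q + Kc) * (err eps tn xh + eps * h ^+ k) =
   (mx1 Q * err eps tn xh + eps * kap) + (mx1 Q * (eps * h ^+ k) + Kc * err eps tn xh) by rewrite /kap; ring.
rewrite -[leLHS]addr0; apply: lerD; first by rewrite lerD2r.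
by rewrite addr_ge0 ?mulr_ge0.
Qed.
End OneStep.

(** [P] is the block matrix of a left eigenvector basis of [A] and the number 1 for time. The block
    form separates u from time, and the time index gets the eigenvalue 0. *)
Lemma eigen_coordinates {R : realType} (d : nat) (A : 'M[C R]_d) : diagonalizable A ->
  (forall a : C R, eigenvalue A a -> exists2 lam : R, lam != 0 & a = 'i * toC lam) ->
  exists (P Q : 'M[C R]_(d + 1)) (lam : 'I_(d + 1) -> C R),
    Q *m P = 1%:M /\
    (forall i j : 'I_(d + 1), (i < d)%N != (j < d)%N -> P i j = 0) /\
    (forall i m, \sum_j P i j * aug_A A j m = lam i * P i m) /\
    (forall i, reC (lam i) = 0) /\
    (forall i : 'I_(d + 1), (i < d)%N -> lam i != 0) /\
    (forall i : 'I_(d + 1), ~~ (i < d)%N -> lam i = 0).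
Proof.
move=> [P0 P0u /similar_diagPex [D0 /(similarP P0u) PD]] eigA.
(* Row [i] of [P0] is a nonzero left eigenvector for the diagonal entry [i], so that this entry is
   an eigenvalue of [A]. *)
have eigD i : exists2 lam : R, lam != 0 & D0 0 i = 'i * toC lam.
  apply: eigA; apply/eigenvalueP; exists (row i P0).
    by rewrite -row_mul PD row_mul row_diag_mx -scalemxAl -rowE.
  apply/eqP => r0; have : (delta_mx 0 i : 'rV[C R]_d) *m P0 = 0 by rewrite -rowE.
  move=> /(congr1 (fun Z : 'rV[C R]_d => Z *m invmx P0)); rewrite mulmxK // mul0mx.
  move=> /matrixP /(_ 0 i); rewrite !mxE !eqxx => /eqP; exact/negP/oner_neq0.
have iu (i : 'I_d) : (lshift 1 i < d)%N by exact: (ltn_ord i).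
have it (i : 'I_1) : (rshift d i < d)%N = false by rewrite ltnNge leq_addr.
pose P : 'M[C R]_(d + 1) := block_mx P0 0 0 1%:M.
pose lam (q : 'I_(d + 1)) : C R := if fintype.split q is inl i then D0 0 i else 0.
have lamu i : lam (lshift 1 i) = D0 0 i by rewrite /lam (unsplitK (inl i)).
have lamt i : lam (rshift d i) = 0 by rewrite /lam (unsplitK (inr i)).
exists P, (block_mx (invmx P0) 0 0 1%:M), lam; split; [|split; [|split; [|split; [|split]]]].
- rewrite /P mulmx_block !mulmx0 !mul0mx !addr0 mulVmx // mul1mx add0r -scalar_mx_block //.
- move=> i j; rewrite /P; case: (split_ordP i) => i' ->; case: (split_ordP j) => j' ->;
    rewrite ?iu ?it // => _.
    by rewrite block_mxEur mxE.
  by rewrite block_mxEdl mxE.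
- move=> i m; transitivity ((P *m aug_A A) i m); first by rewrite mxE.
  rewrite /P /aug_A mulmx_block !mulmx0 !mul0mx !addr0 PD.
  case: (split_ordP i) => i' ->; case: (split_ordP m) => m' ->;
    rewrite ?block_mxEul ?block_mxEur ?block_mxEdl ?block_mxEdr ?lamu ?lamt ?mul0r ?mxE ?mulr0 //.
  by rewrite (bigD1 i') //= !mxE eqxx mulr1n big1 ?addr0 // => j ji; rewrite mxE eq_sym (negbTE ji) mul0r.
- move=> i; case: (split_ordP i) => i' ->; last by rewrite lamt.
  by rewrite lamu; have [l _ ->] := eigD i'; rewrite reCM imC_toC mulr0 subr0 (_ : reC 'i = 0) ?mul0r.
- move=> i; case: (split_ordP i) => i' -> //.
  move=> _; rewrite lamu; have [l l0 ->] := eigD i'.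
  by rewrite mulf_neq0 ?toC_eq0 // neq0Ci.
- by move=> i; case: (split_ordP i) => i' ->; rewrite ?iu // lamt.
Qed.

(** * Accumulation of the local errors *)

Theorem theorem4p2 (R : realType) (K : set (C R)) (K_scalars : scalars K)
    (d k : nat) (d_ge1 : (1 <= d)%N) (k_ge1 : (1 <= k)%N)
    (nu T : R) (T_gt0 : 0 < T)
    (uin : 'cV[C R]_d) (uinK : forall i, K (uin i 0))
    (A : 'M[C R]_d) (AK : forall i j, K (A i j))
    (A_diag : diagonalizable A)
    (A_eig : forall a : C R, eigenvalue A a ->
       exists2 lam : R, lam != 0 & a = 'i * toC lam)
    (F : 'cV[C R]_d -> R -> 'cV[C R]_d)
    (FK : forall (v : 'cV[C R]_d) (t : R), (forall i, K (v i 0)) -> 0 <= t <= T ->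
       forall i, K (F v t i 0))
    (F_lip : forall i : 'I_d,
       Ck_lipschitz (aug_dom K T) k (fun x => aug_f F x (lshift 1 i) 0))
    (u : R -> R -> 'cV[C R]_d)
    (u_sol : forall eps : R, 0 < eps <= 1 ->
       solves K A F T eps (toC (eps `^ nu) *: uin) (u eps))
    (C0 : R)
    (u_osc : forall eps : R, 0 < eps <= 1 ->
       forall t : R, 0 <= t <= T -> enorm (u eps t) <= C0 * eps)
    (r : seq (seq 'I_(d + 1))) (r_order : tail_order k r)
    (c0 : R) (c0_gt0 : 0 < c0) :
  exists C1 : R, forall (eps : R) (N : nat),
    0 < eps <= 1 -> (0 < N)%N ->
    let h := T / N%:R in
    c0 * eps < h ->
    forall n : nat, (n <= N)%N ->
      enorm (usubmx (lle_scheme K A F T k r eps h (toC (eps `^ nu) *: uin) n)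
             - u eps (n%:R * h))
      <= C1 * eps * h ^+ k.
Proof.
have [P [Q [lam [QP [Ppat [PA [lam_im [lam_u lam_t]]]]]]]] := eigen_coordinates A_diag A_eig.
have step B (B0 : 0 <= B) := step_bound K_scalars k_ge1 T_gt0 F_lip r_order QP Ppat PA lam_im
  lam_u lam_t u_sol u_osc c0_gt0 B0.
have T0 : 0 <= T := ltW T_gt0.
have C00 : 0 <= C0 := C0_ge0 T_gt0 u_osc.
pose X eps h n := lle_scheme K A F T k r eps h (toC (eps `^ nu) *: uin) n.
pose err eps h n : R := l1 (P *m (curve (u eps) (n%:R * h) - X eps h n)).
pose q1 := mx1 Q.
have q1_ge1 : 1 <= q1 := mx1_ge1 Q.
have q1_gt0 : 0 < q1 by exact: lt_le_trans q1_ge1.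
have tS (h : R) n : n%:R * h + h = n.+1%:R * h by rewrite -addn1 natrD mulrDl mul1r.
have hN (N : nat) : (0 < N)%N -> 0 < T / N%:R /\ N%:R * (T / N%:R) = T.
  move=> N0; have N0' : 0 < (N%:R : R) by rewrite ltr0n.
  by split; [rewrite divr_gt0|rewrite mulrC divfK // gt_eqF].
have nhT n N : (0 < N)%N -> (n <= N)%N -> 0 <= n%:R * (T / N%:R) <= T.
  move=> N0 nN; have [h0 hT] := hN N N0; rewrite mulr_ge0 ?(ltW h0) //=.
  by rewrite -[leRHS]hT ler_wpM2r ?(ltW h0) // ler_nat.
have XS eps h n : X eps h n.+1 = scheme_step (aug_dom K T) (aug_A A) (aug_f F) k r eps h (X eps h n).
  by [].
have X0 eps h : 0 < eps <= 1 -> X eps h 0%N = curve (u eps) 0.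
  move=> e1; rewrite /X /lle_scheme /= /curve; have [-> _] := u_sol eps e1.
  by congr col_mx; apply/matrixP => i j; rewrite !mxE.
have inv eps N n : 0 < eps <= 1 -> (0 < N)%N -> (n <= N)%N ->
    aug_dom K T (X eps (T / N%:R) n) /\ X eps (T / N%:R) n (rshift d ord0) 0 = toC (n%:R * (T / N%:R)).
  move=> e1 N0; have [h0 _] := hN N N0; elim: n => [|n IH] nN.
    rewrite X0 // mul0r curve_t; split=> //; apply: curve_dom (u_sol eps e1) _.
    by rewrite lexx.
  have [Dn tn] := IH (ltnW nN); have /andP[tn0 _] := nhT n N N0 (ltnW nN).
  rewrite XS (step_time K_scalars k_ge1 T_gt0) ?(ltW h0) // tn -toCD tS; split=> //.
  apply: (step_dom K_scalars k_ge1 T_gt0 AK FK F_lip r_order eps Dn tn) => //; first exact: ltW.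
  by rewrite tS; have /andP[] := nhT _ _ N0 nN.
have dist eps h n : l1 (curve (u eps) (n%:R * h) - X eps h n) <= q1 * err eps h n.
  exact: l1_mulmx_inv.
(* X_n is the exact solution minus an error of norm at most [q1 * M * eps]. This gives the constant
   [B] with which the one-step bound is used. *)
have Xu eps N n (M : R) : 0 < eps <= 1 -> (0 < N)%N -> (n <= N)%N -> err eps (T / N%:R) n <= M * eps ->
    forall i, nc (X eps (T / N%:R) n (lshift 1 i) 0) <= (C0 + q1 * M) * eps.
  move=> e1 N0 nN eM i; set x := X _ _ _.
  have -> : x (lshift 1 i) 0 = u eps (n%:R * (T / N%:R)) i 0 -
      (curve (u eps) (n%:R * (T / N%:R)) - x) (lshift 1 i) 0.
    by rewrite mxE [X in _ - (_ + X)]mxE curve_u opprB addrC subrK.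
  apply: le_trans (ler_ncB _ _) _; rewrite mulrDl; apply: lerD.
    by apply: le_trans (nc_le_enorm _ _) _; exact: u_osc e1 _ (nhT n N N0 nN).
  apply: le_trans (nc_le_l1 _ _) _; apply: le_trans (dist eps _ n) _.
  by rewrite -mulrA ler_wpM2l // ltW.
have err0 eps h : 0 < eps <= 1 -> err eps h 0%N = 0.
  by move=> e1; rewrite /err X0 // mul0r subrr mulmx0 l10.
have estep M : 0 <= M -> exists2 Cs : R, 0 <= Cs & forall eps N n, 0 < eps <= 1 -> (0 < N)%N ->
    c0 * eps < T / N%:R -> (n < N)%N -> err eps (T / N%:R) n <= M * eps ->
    err eps (T / N%:R) n.+1 <= err eps (T / N%:R) n +
      Cs * (T / N%:R) * (err eps (T / N%:R) n + eps * (T / N%:R) ^+ k).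
  move=> M0; have B0 : 0 <= C0 + q1 * M by rewrite addr_ge0 // mulr_ge0 // ltW.
  have [Cs Cs0 H] := step _ B0; exists Cs => // eps N n e1 N0 eh nN eM.
  have [Dn tn] := inv eps N n e1 N0 (ltnW nN); have /andP[tn0 _] := nhT n N N0 (ltnW nN).
  rewrite /err -tS XS; apply: H => //.
    by rewrite tS; have /andP[] := nhT _ _ N0 nN.
  exact: (Xu eps N n M e1 N0 (ltnW nN) eM).
(* With M = 1 / q1 the numerical solution is bounded by [(C0 + 1) * eps], so a single constant [Cs]
   serves as long as the error stays below eps / q1. *)
have q1V : 0 <= q1^-1 by rewrite invr_ge0 ltW.
have [Cs Cs0 Hs] := estep _ q1V.
pose E := expR (Cs * T).
have E1 : 1 <= E by rewrite -expR0 ler_expR mulr_ge0.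
have E0 : 0 < E by exact: expR_gt0.
(* For h <= h1 one has h^k <= h <= 1 / (q1 E), so the claimed bound [E * (eps * h ^+ k)] is itself
   at most eps / q1. *)
pose h1 : R := Num.min 1 (q1 * E)^-1.
have h10 : 0 < h1 by rewrite lt_min ltr01 invr_gt0 mulr_gt0.
(* Small steps: a discrete Gronwall argument, in which the bound
   q1 err <= eps needed for the next step is part of the induction. *)
have small eps N n : 0 < eps <= 1 -> (0 < N)%N -> c0 * eps < T / N%:R -> T / N%:R <= h1 ->
    (n <= N)%N -> err eps (T / N%:R) n <= E * (eps * (T / N%:R) ^+ k).
  move=> e1 N0 eh hh1; have /andP[eps0 _] := e1; have [h0 hNT] := hN N N0.
  set h := T / N%:R in h0 hNT eh hh1 *; set rho := eps * h ^+ k.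
  have rho0 : 0 <= rho by rewrite mulr_ge0 ?exprn_ge0 // ltW.
  have g1 : 1 <= 1 + Cs * h by rewrite lerDl mulr_ge0 // ltW.
  have gE j : (j <= N)%N -> (1 + Cs * h) ^+ j <= E.
    move=> jN; apply: le_trans (_ : (1 + Cs * h) ^+ N <= _); first by rewrite ler_weXn2l.
    apply: le_trans (_ : expR (Cs * h) ^+ N <= _).
      rewrite lerXn2r ?nnegrE ?expR_ge0 ?expR_ge1Dx //.
      exact: le_trans g1.
    by rewrite -expRM_natl -mulrCA -[N%:R * h]/(N%:R * h) hNT /E.
  have rhoq : E * rho <= q1^-1 * eps.
    have hk : h ^+ k <= h1.
      have hle1 : h <= 1 by apply: le_trans hh1 _; rewrite ge_min lexx.
      apply: le_trans (_ : h ^+ 1 <= _); last by rewrite expr1.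
      by apply: ler_wiXn2l => //; exact: ltW.
    have : h ^+ k <= (q1 * E)^-1 by apply: le_trans hk _; rewrite ge_min lexx orbT.
    rewrite -(ler_pM2l (mulr_gt0 q1_gt0 E0)) divff ?gt_eqF ?mulr_gt0 // => H.
    rewrite ler_pdivlMl // /rho.
    have -> : q1 * (E * (eps * h ^+ k)) = q1 * E * h ^+ k * eps by ring.
    by rewrite ler_piMl // ltW.
  (* With [rho] added, the recursion is purely multiplicative, with factor 1 + Cs h. *)
  move=> nN; suff : err eps h n + rho <= (1 + Cs * h) ^+ n * rho.
    move=> H; apply: le_trans (_ : err eps h n + rho <= _); first by rewrite lerDl.
    by apply: le_trans H _; rewrite ler_wpM2r // gE.
  elim: n nN => [|n IH] nN; first by rewrite err0 // add0r expr0 mul1r.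
  have En := IH (ltnW nN).
  have EM : err eps h n <= q1^-1 * eps.
    apply: le_trans rhoq; apply: le_trans (_ : err eps h n + rho <= _); first by rewrite lerDl.
    by apply: le_trans En _; rewrite ler_wpM2r // gE // ltnW.
  apply: le_trans (lerD (Hs eps N n e1 N0 eh nN EM) (lexx _)) _.
  rewrite -/h -/rho exprS.
  have -> : err eps h n + Cs * h * (err eps h n + rho) + rho = (1 + Cs * h) * (err eps h n + rho) by ring.
  by rewrite -mulrA ler_wpM2l // (le_trans ler01).
(* Large steps: there are boundedly many, so that the constants may depend on
   the number of steps. *)
have large n : exists2 M : R, 0 <= M & forall eps N, 0 < eps <= 1 -> (0 < N)%N ->
    c0 * eps < T / N%:R -> (n <= N)%N -> err eps (T / N%:R) n <= M * eps.
  elim: n => [|n [M M0 IH]].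
    by exists 0 => // eps N e1 N0 _ _; rewrite err0 // mul0r.
  have [C CC HC] := estep M M0.
  exists (M + C * T * (M + T ^+ k)).
    by rewrite addr_ge0 // !mulr_ge0 // addr_ge0 // exprn_ge0.
  move=> eps N e1 N0 eh nN; have /andP[eps0 _] := e1; have [h0 hNT] := hN N N0.
  have EM := IH eps N e1 N0 eh (ltnW nN).
  apply: le_trans (HC eps N n e1 N0 eh nN EM) _.
  have hT : T / N%:R <= T.
    by rewrite ler_pdivrMr ?ltr0n // ler_peMr // ler1n.
  set h := T / N%:R in EM h0 hT *.
  have -> : (M + C * T * (M + T ^+ k)) * eps = M * eps + C * T * (M * eps + eps * T ^+ k) by ring.
  apply: lerD => //; apply: ler_pM.
  - by rewrite mulr_ge0 // ltW.
  - by rewrite addr_ge0 ?l1_ge0 // mulr_ge0 ?exprn_ge0 // ltW.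
  - by rewrite ler_wpM2l.
  - apply: lerD => //; rewrite ler_wpM2l ?(ltW eps0) // lerXn2r ?nnegrE // ltW //.
have /choice [M HM] : forall n, exists M : R, 0 <= M /\ forall eps N, 0 < eps <= 1 -> (0 < N)%N ->
    c0 * eps < T / N%:R -> (n <= N)%N -> err eps (T / N%:R) n <= M * eps.
  by move=> n; have [M M0 H] := large n; exists M.
(* If h > h1 then N < T / h1, so at most [Nm] steps occur. *)
pose Nm := Num.bound (T / h1).
pose Mm := \sum_(j < Nm.+1) M j.
have Mm0 : 0 <= Mm by apply: sumr_ge0 => j _; case: (HM j).
(* [E] covers the small steps. For the large ones the bound [Mm * eps] gains the missing h^k from
   h1^k <= h^k. The factor [q1] leads back from eigenvector coordinates. *)
exists (q1 * (E + Mm / h1 ^+ k)) => eps N e1 N0 h eh n nN.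
have /andP[eps0 _] := e1; have [h0 hNT] := hN N N0; rewrite -/h in h0 hNT.
have hk0 : 0 < h ^+ k by rewrite exprn_gt0.
have h1k0 : 0 < h1 ^+ k by rewrite exprn_gt0.
have errB : err eps h n <= (E + Mm / h1 ^+ k) * (eps * h ^+ k).
  have rho0 : 0 <= eps * h ^+ k by rewrite mulr_ge0 ?ltW.
  have [hh1|hh1] := leP h h1.
    apply: le_trans (small eps N n e1 N0 eh hh1 nN) _.
    by rewrite ler_wpM2r // lerDl divr_ge0 // ltW.
  have nNm : (n < Nm.+1)%N.
    rewrite ltnS; apply: leq_trans nN _; rewrite -(ler_nat R).
    have Th1 : 0 <= T / h1 by rewrite divr_ge0 // ltW.
    apply: le_trans (ltW (archi_boundP Th1)); rewrite ler_pdivlMr //.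
    by rewrite -hNT ler_wpM2l // ltW.
  apply: le_trans ((HM n).2 eps N e1 N0 eh nN) _.
  apply: le_trans (_ : Mm * eps <= _).
    rewrite ler_wpM2r ?(ltW eps0) // /Mm (bigD1 (Ordinal nNm)) //= lerDl.
    by apply: sumr_ge0 => j _; case: (HM j).
  apply: le_trans (_ : Mm / h1 ^+ k * (eps * h ^+ k) <= _).
    have -> : Mm / h1 ^+ k * (eps * h ^+ k) = Mm * eps * (h ^+ k / h1 ^+ k) by ring.
    rewrite ler_peMr ?mulr_ge0 ?(ltW eps0) // ler_pdivlMr // mul1r.
    by rewrite lerXn2r ?nnegrE ?(ltW h10) ?(ltW h0) ?(ltW hh1).
  by rewrite ler_wpM2r // lerDr ltW.
apply: le_trans (enorm_le_l1 _) _.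
apply: le_trans (_ : l1 (curve (u eps) (n%:R * h) - X eps h n) <= _).
  rewrite [leRHS]l1BC {2}/l1 big_split_ord /= -[leLHS]addr0; apply: lerD.
    apply: ler_sum => i _; rewrite [X in nc X <= _]mxE [X in nc (X + _) <= _]mxE
      [X in nc (_ + X) <= _]mxE [X in _ <= nc X]mxE [X in _ <= nc (_ + X)]mxE curve_u //.
  by apply: sumr_ge0 => i _; exact: nc_ge0.
apply: le_trans (dist eps h n) _.
by rewrite -!mulrA ler_wpM2l ?(ltW q1_gt0) // mulrA.
Qed.
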